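(* There exists a constant $C>0$ (not depending on $A$, $B$, $\varepsilon$, or the solution $\omega$) such that the following holds. Let $A,B\in\mathbb R$ with $B\ge 0$, and let $$\mathbf O:=\{A J_0(\mathsf j r)+B J_1(\mathsf j r)\cos(\theta+\alpha) : \alpha\in\mathbb R\}.$$ (i) If $B\neq 0$, then for any $\varepsilon>0$ and any smooth solution $\omega(t,\mathbf x)$ of the two-dimensional Euler equation in vorticity form on the unit disk $D$, writing $\omega_t=\omega(t,\cdot)$, $$\mathrm{dist}_2(\omega_0,\mathbf O)\le \varepsilon \ \Longrightarrow\ \mathrm{dist}_2(\omega_t,\mathbf O)\le C B^{-1}(A^2+B^2)^{1/2}\varepsilon + C B^{-1}\varepsilon^2 \quad \text{for all } t\in\mathbb R.$$ (ii) If $B=0$, then for any $\varepsilon>0$ and any smooth solution $\omega(t,\mathbf x)$ of the two-dimensional Euler equation in vorticity form on $D$, $$\mathrm{dist}_2(\omega_0,\mathbf O)\le \varepsilon \ \Longrightarrow\ \mathrm{dist}_2(\omega_t,\mathbf O)\le C |A|^{1/2}\varepsilon^{1/2} + C\varepsilon \quad \text{for all } t\in\mathbb R.$$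
   Context: $D\subset\mathbb R^2$ is the open unit disk centered at the origin, with polar coordinates $(r,\theta)$. $J_n(s)=\sum_{i=0}^\infty \frac{(-1)^i}{i!(n+i)!}(s/2)^{n+2i}$ is the Bessel function of the first kind of order $n$, and $\mathsf j=j_{1,1}\approx 3.831706$ is the first positive zero of $J_1$. The Euler equation in vorticity form on $D$ is $$\partial_t\omega+\mathbf v\cdot\nabla\omega=0\ \ (t\in\mathbb R,\ \mathbf x\in D),\qquad \mathbf v=\nabla^\perp\mathcal G\omega,$$ where $\nabla^\perp=(\partial_{x_2},-\partial_{x_1})$ and $\mathcal G$ is the inverse of $-\Delta$ on $D$ with zero Dirichlet boundary condition (i.e. $u=\mathcal G\omega$ solves $-\Delta u=\omega$ in $D$, $u=0$ on $\partial D$). A smooth solution is a function $\omega$ that is smooth on $\mathbb R\times\overline D$ and satisfies this equation. For $v\in L^2(D)$ and $K\subset L^2(D)$, $\mathrm{dist}_2(v,K):=\inf_{w\in K}\|v-w\|_{L^2(D)}$. *)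

(* Defs.v *)
From HB Require Import structures.
From mathcomp Require Import all_boot all_order all_algebra.
From mathcomp Require Import all_classical all_reals all_analysis.

Set Implicit Arguments.
Unset Strict Implicit.
Unset Printing Implicit Defensive.

Import Order.TTheory GRing.Theory Num.Theory.
Import numFieldNormedType.Exports.

Local Open Scope classical_set_scope.
Local Open Scope ring_scope.

Definition disk (R : realType) : set (R * R) :=
  [set x | x.1 ^+ 2 + x.2 ^+ 2 < 1].

Definition closed_disk (R : realType) : set (R * R) :=
  [set x | x.1 ^+ 2 + x.2 ^+ 2 <= 1].

Definition circle (R : realType) : set (R * R) :=
  [set x | x.1 ^+ 2 + x.2 ^+ 2 = 1].

Definition besselJ (R : realType) (n : nat) (s : R) : R :=
  limn (series (fun i : nat =>
    (-1) ^+ i / (i`! * (n + i)`!)%:R * (s / 2) ^+ (n + 2 * i))).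

(* The positive zeros of J_1 form a nonempty set that is closed in R and
   bounded away from 0, so this infimum is the first positive zero of J_1. *)
Definition j11 (R : realType) : R :=
  inf [set s : R | 0 < s /\ besselJ 1 s = 0].

(* A function is C^oo iff all its iterated directional derivatives are
   (Frechet) differentiable at every point. *)
Definition smooth (R : realType) (V : normedModType R) (f : V -> R) : Prop :=
  forall (vs : seq V) (x : V),
    differentiable (foldr (fun v g => 'D_v g) f vs) x.

(* Smoothness up to the boundary: w agrees on R x closed_disk with a smooth
   function on R x R^2. The values of w elsewhere are irrelevant. *)
Definition smooth_on_closed_cylinder (R : realType) (w : R -> R * R -> R) :
    Prop :=
  exists W : R * (R * R) -> R,
    smooth W /\ forall t x, closed_disk x -> W (t, x) = w t x.

(* Partial derivatives in x_1 and x_2. *)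
Definition partial1 (R : realType) (f : R * R -> R) : R * R -> R :=
  'D_((1, 0) : R * R) f.

Definition partial2 (R : realType) (f : R * R -> R) : R * R -> R :=
  'D_((0, 1) : R * R) f.

Definition laplacian (R : realType) (f : R * R -> R) (x : R * R) : R :=
  partial1 (partial1 f) x + partial2 (partial2 f) x.

Definition C2_on_disk (R : realType) (f : R * R -> R) : Prop :=
  forall x, disk x ->
    [/\ differentiable f x,
        forall v : R * R, differentiable ('D_v f) x &
        forall v1 v2 : R * R, {for x, continuous ('D_v1 ('D_v2 f))}].

(* u = G w, in the classical sense: u is C^2 in the disk, continuous up to the
   boundary, and solves the Dirichlet problem. By the maximum principle u is
   unique on the closed disk. *)
Definition inverse_laplacian (R : realType) (w u : R * R -> R) : Prop :=
  [/\ C2_on_disk u,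
      {within @closed_disk R, continuous u},
      forall x, disk x -> - laplacian u x = w x &
      forall x, circle x -> u x = 0].

Definition perp_grad (R : realType) (u : R * R -> R) (x : R * R) : R * R :=
  (partial2 u x, - partial1 u x).

Definition euler_smooth_solution (R : realType) (w : R -> R * R -> R) : Prop :=
  smooth_on_closed_cylinder w /\
  exists u : R -> R * R -> R,
    (forall t, inverse_laplacian (w t) (u t)) /\
    forall t x, disk x ->
      let v := perp_grad (u t) x in
      derive1 (w ^~ x) t
        + (v.1 * partial1 (w t) x + v.2 * partial2 (w t) x) = 0.

Definition norm2 (R : realType) (f : R * R -> R) : \bar R :=
  ('N[ (@lebesgue_measure R \x @lebesgue_measure R) ]_2%:E
     [ (EFin \o f) \_ (@disk R) ])%E.

Definition dist2 (R : realType) (v : R * R -> R) (K : set (R * R -> R)) :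
    \bar R :=
  ereal_inf [set norm2 (fun x => v x - w x) | w in K].

(* The functions whose expression in polar coordinates on the disk is
   A J_0(j r) + B J_1(j r) cos(theta + alpha) for some alpha. Their values
   outside the disk are unconstrained, and norm2 does not see them. *)
Definition bessel_orbit (R : realType) (A B : R) : set (R * R -> R) :=
  [set f | exists alpha : R, forall r theta : R, 0 <= r < 1 ->
     f (r * cos theta, r * sin theta) =
       A * besselJ 0 (j11 R * r)
         + B * besselJ 1 (j11 R * r) * cos (theta + alpha)].

(* Main.v *)
Require Import Defs.
From HB Require Import structures.
From mathcomp Require Import all_boot all_order all_algebra.
From mathcomp Require Import all_classical all_reals all_analysis.
From mathcomp Require Import measurable_realfun.
From mathcomp Require Import ring lra zify.

Set Implicit Arguments.
Unset Strict Implicit.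
Unset Printing Implicit Defensive.

Import Order.TTheory GRing.Theory Num.Theory.
Import numFieldNormedType.Exports.
Local Open Scope classical_set_scope.
Local Open Scope ring_scope.

(** Why the theorem holds.

    Write [j] for the first zero of [J_1]. The functions [J_0 (j r)],
    [J_1 (j r) cos t] and [J_1 (j r) sin t] are eigenfunctions of minus the
    Laplacian for [j ^ 2]. For a vorticity [w] of mean zero, the energy-Casimir
    quadratic form [|w|^2 - j^2 <w, G w>] vanishes on their span, because there
    [G] acts as division by [j ^ 2] up to a constant that the mean kills; and
    it controls the squared distance [rho] to the span, because the span
    exhausts the top eigenvalue of [G] on functions of mean zero ([Q_bounds]).
    A smooth solution conserves the mean [m], the second moment
    [M = int |x|^2 w], the enstrophy [Z] and the energy [E], the second of them
    because the disk is invariant under rotations ([torque_free]). Correcting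
    the form for the mean gives a conserved function of [Z, E, m, M] that lies
    between [margin * rho] and [rho]; hence [rho] at time [t] is at most
    [rho / margin] at time 0.

    It remains to follow the three coordinates in the span.  The coefficient of
    [J_0 (j r)] is pinned up to [O(eps)] by [M], since
    [int r^3 J_0 (j r) dr < 0] ([psi_moment], [moment_bound]). Conservation of
    [Z] then pins the sum of the squares of the other two
    coefficients ([coordinate_stability]). Their phase is free, but moving the
    phase is moving along the orbit ([orbit_phase]). So the radius [y] of these
    two coefficients satisfies [|y^2 - b^2| <= K (eps^2 + (|A| + b) eps)] with
    [b] a fixed multiple of [B] ([flow_stability]): dividing by [b] gives (i)
    and, for [B = 0], the bound on [y^2] gives (ii) after a square root.

    The spectral gap is elementary. In the modes 0 and 1 the trace of the
    radial inverse is [1/8], so what is left besides the eigenvalue [1 / j^2]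
    is at most [1/8 - 1 / j^2] ([gap_mode0], [gap_mode1]), and [j < 4] ([j11P])
    makes this smaller than [1 / j^2]. In the higher modes Wirtinger's
    inequality and a supersolution give [G <= 1/16] ([wirtinger],
    [rest_energy]).

    The stream function is only continuous up to the circle. What replaces
    boundary regularity is that it vanishes linearly there, by comparison with
    a paraboloid ([max_principle]); this is enough for [G] to be symmetric
    ([polar_symmetry]). Time derivatives of the stream function are avoided as
    well: symmetry of [G] and a Lipschitz bound show that over a time [h] the
    conserved quantities change by [h] times their formal rate up to [O(h^2)]
    ([conserved_quadratic]), and the formal rates vanish since the advection
    term is a Jacobian, whose circle averages are radial derivatives
    ([bracket_der]). All of this takes place in polar coordinates; the
    Lebesgue integral over the disk is identified with the polar one at the end
    ([chords_polar], [norm2_polar]). *)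

(** * Derivatives, continuity and integrals in one variable *)

Definition der {R : realType} (x : R) (f : R -> R) (d : R) : Prop :=
  is_derive x (1 : R) f d.

Section calculus.
Context {R : realType}.
Implicit Types (f g : R -> R) (x a b : R).

Lemma der_cst x a : der x (fun=> a) 0.
Proof. exact: is_derive_cst. Qed.

Lemma der_id x : der x (fun y : R => y) 1.
Proof. exact: is_derive_id. Qed.

Lemma derD f g x a b : der x f a -> der x g b ->
  der x (fun y => f y + g y) (a + b).
Proof. by move=> ? ?; exact: is_deriveD. Qed.

Lemma derN f x a : der x f a -> der x (fun y => - f y) (- a).
Proof. by move=> ?; exact: is_deriveN. Qed.

Lemma derB f g x a b : der x f a -> der x g b ->
  der x (fun y => f y - g y) (a - b).
Proof. by move=> ? ?; exact: is_deriveB. Qed.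

Lemma derM f g x a b : der x f a -> der x g b ->
  der x (fun y => f y * g y) (a * g x + f x * b).
Proof.
move=> fa gb; apply: is_derive_eq (is_deriveM fa gb) _.
by rewrite /GRing.scale/= addrC mulrC.
Qed.

Lemma derX f x a n : der x f a ->
  der x (fun y => f y ^+ n) (n%:R * f x ^+ n.-1 * a).
Proof.
move=> fa; case: n => [|n].
  by rewrite !mul0r; exact: der_cst.
rewrite (_ : (fun y => _) = f ^+ n.+1); last by apply/funext => y; rewrite exprfctE.
exact: (is_deriveX n.+1 fa).
Qed.

Lemma der_comp f g x a b : der (g x) f a -> der x g b ->
  der x (fun y => f (g y)) (a * b).
Proof. by move=> ? ?; exact: is_derive1_comp. Qed.

Lemma der_sin f x a : der x f a -> der x (fun y => sin (f y)) (cos (f x) * a).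
Proof. by move=> ?; apply: der_comp => //; exact: is_derive_sin. Qed.

Lemma der_cos f x a : der x f a -> der x (fun y => cos (f y)) (- sin (f x) * a).
Proof. by move=> ?; apply: der_comp => //; exact: is_derive_cos. Qed.

Lemma derV f x a : f x != 0 -> der x f a ->
  der x (fun y => (f y)^-1) (- a / f x ^+ 2).
Proof.
move=> fx0 fa; apply: is_derive_eq (is_deriveV fx0 fa) _.
by rewrite /GRing.scale/= mulNr mulrC -mulNr.
Qed.

Lemma der_eq f x a b : der x f a -> a = b -> der x f b.
Proof. by move=> fa <-. Qed.

Lemma der_cont f x a : der x f a -> {for x, continuous f}.
Proof.
move=> fa; apply: differentiable_continuous; apply/derivable1_diffP.
by case: fa.
Qed.

Lemma der_continuous f f' : (forall x, der x f (f' x)) -> continuous f.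
Proof. by move=> ff' x; exact: der_cont (ff' x). Qed.

Lemma der_uniq f x a b : der x f a -> der x f b -> a = b.
Proof. by move=> [_ <-] [_ <-]. Qed.

Lemma der_near f g x a : (\forall y \near x, f y = g y) -> der x f a -> der x g a.
Proof.
move=> fg fa; apply: (@near_eq_is_derive _ _ _ f g) => //; exact: oner_neq0.
Qed.

Lemma der_ext f g x a : f =1 g -> der x f a -> der x g a.
Proof. by move=> /funext->. Qed.

End calculus.

(** Syntax-directed differentiation: the derivative is an evar, filled in by the
    structure of the function and compared afterwards with [der_eq]. The rules
    on partial applications catch functions that unification has eta-reduced. *)
Ltac dtac := repeat first
  [ eassumption
  | lazymatch goal with
    | |- der _ (fun _ => ?c) _ => exact: der_cst
    | |- der _ (fun y => y) _ => exact: der_id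
    | |- der _ (fun y => (@?f y - @?g y)%R) _ => apply: (@derB _ f g)
    | |- der _ (fun y => (@?f y + @?g y)%R) _ => apply: (@derD _ f g)
    | |- der _ (fun y => (- @?f y)%R) _ => apply: (@derN _ f)
    | |- der _ (fun y => (@?f y * @?g y)%R) _ => apply: (@derM _ f g)
    | |- der _ (fun y => (@?f y ^+ _)%R) _ => apply: (@derX _ f)
    | |- der _ (fun y => sin (@?f y)) _ => apply: (@der_sin _ f)
    | |- der _ (fun y => cos (@?f y)) _ => apply: (@der_cos _ f)
    | |- der _ (GRing.mul ?c) _ => apply: (@derM _ (fun=> c) (fun y => y))
    | |- der _ (Algebra.add ?c) _ => apply: (@derD _ (fun=> c) (fun y => y))
    | |- der _ sin _ => exact: is_derive_sin
    | |- der _ cos _ => exact: is_derive_cos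
    end ].

Section calculus2.
Context {R : realType}.
Implicit Types (f g : R -> R) (x a b : R).

Lemma der_le f f' a b : a <= b -> (forall x, a < x < b -> der x f (f' x)) ->
  {within `[a, b], continuous f} -> (forall x, a < x < b -> 0 <= f' x) ->
  f a <= f b.
Proof.
move=> ab df cf f'0; rewrite -subr_ge0.
move: ab; rewrite le_eqVlt => /predU1P[->|ab]; first by rewrite subrr.
have [|c cab ->] := @MVT R f f' a b ab _ cf.
  by move=> x; rewrite in_itv; exact: df.
by rewrite mulr_ge0 ?f'0// ?subr_ge0 ?(ltW ab).
Qed.

Lemma der_const f f' a b : a <= b -> (forall x, a < x < b -> der x f (f' x)) ->
  {within `[a, b], continuous f} -> (forall x, a < x < b -> f' x = 0) ->
  f a = f b.
Proof.
move=> ab df cf f'0; apply/eqP; rewrite eq_sym -subr_eq0.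
move: ab; rewrite le_eqVlt => /predU1P[->|ab]; first by rewrite subrr.
have [|c cab ->] := @MVT R f f' a b ab _ cf.
  by move=> x; rewrite in_itv; exact: df.
by rewrite f'0 ?mul0r.
Qed.

Lemma der0_const f : (forall x, der x f 0) -> forall x y, f x = f y.
Proof. by move=> f0 x y; exact: is_derive_0_is_cst. Qed.

Lemma segment_integrable f a b : continuous f ->
  (@lebesgue_measure R).-integrable `[a, b] (EFin \o f).
Proof.
move=> cf; apply: continuous_compact_integrable; first exact: segment_compact.
exact: continuous_subspaceT.
Qed.

Lemma primitive_from f a : continuous f ->
  forall x, a < x -> der x (fun y => parameterized_integral (@lebesgue_measure R) a y f) (f x).
Proof.
move=> cf x ax.
have xx1 : x < x + 1 by rewrite ltrDl.
have [] := @continuous_FTC1_closed _ f a x (x + 1) xx1 (@segment_integrable f a (x + 1) cf) ax (cf x).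
move=> d e; split; first exact: d.
by rewrite -derive1E; exact: e.
Qed.

(** The integral from [a] has derivative [f] only to the right of [a], so the base
    point [- |x| - 1] moves with the argument; normalizing by the value at 0
    makes the result independent of the base point. *)
Lemma exists_primitive f : continuous f ->
  exists F : R -> R, forall x, der x F (f x).
Proof.
move=> cf.
pose P a y := parameterized_integral (@lebesgue_measure R) a y f.
have dP a x : a < x -> der x (P a) (f x) by exact: primitive_from.
have PP a b y : a < y -> b < y -> a < 0 -> b < 0 ->
    P a y - P a 0 = P b y - P b 0.
  move=> ay by_ a0 b0.
  suff : P a y - P b y = P a 0 - P b 0 by lra.
  have dPP x : Num.max a b < x -> der x (fun x => P a x - P b x) 0.
    rewrite gt_max => /andP[ax bx].
    by apply: der_eq; [apply: derB; exact: dP|exact: subrr].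
  have cPP x : Num.max a b < x -> {for x, continuous (fun x => P a x - P b x)}.
    by move=> /dPP; exact: der_cont.
  have key c d : Num.max a b < c -> c <= d -> P a c - P b c = P a d - P b d.
    move=> abc cd; apply: (@der_const (fun x => P a x - P b x) (fun=> 0)) => //.
      by move=> x /andP[cx _]; exact/dPP/(lt_trans abc).
    apply: continuous_in_subspaceT => x; rewrite inE/= in_itv/= => /andP[cx _].
    exact/cPP/(lt_le_trans abc).
  have my : Num.max a b < y by rewrite gt_max ay.
  have m0 : Num.max a b < 0 by rewrite gt_max a0.
  by case: (leP y 0) => y0; [exact: key|exact/esym/key/ltW].
exists (fun x => P (- `|x| - 1) x - P (- `|x| - 1) 0) => x.
pose a := - `|x| - 2.
apply: (@der_near _ (fun y => P a y - P a 0)).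
  near=> y; apply: PP.
  - have : `|x - y| < 1 by near: y; exists 1 => //=.
    by rewrite /a; have := ler_norm (-x); rewrite normrN; have := ler_norm (x-y); lra.
  - by have := ler_norm (-y); rewrite normrN; lra.
  - by rewrite /a; have := normr_ge0 x; lra.
  - by have := normr_ge0 y; lra.
rewrite -[f x]subr0; apply: derB; last exact: der_cst.
by apply: dP; rewrite /a; have := ler_norm (-x); rewrite normrN; lra.
Unshelve. all: by end_near. Qed.

End calculus2.

Section continuity.
Context {R : realType} {T : topologicalType}.
Implicit Types (f g : T -> R) (x : T).

Lemma cont_cst x (c : R) : {for x, continuous (fun=> c)}.
Proof. exact: cvg_cst. Qed.

Lemma contD f g x : {for x, continuous f} -> {for x, continuous g} ->
  {for x, continuous (fun y => f y + g y)}.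
Proof. by move=> ? ?; exact: cvgD. Qed.

Lemma contN f x : {for x, continuous f} -> {for x, continuous (fun y => - f y)}.
Proof. by move=> ?; exact: cvgN. Qed.

Lemma contB f g x : {for x, continuous f} -> {for x, continuous g} ->
  {for x, continuous (fun y => f y - g y)}.
Proof. by move=> ? ?; exact: cvgB. Qed.

Lemma contM f g x : {for x, continuous f} -> {for x, continuous g} ->
  {for x, continuous (fun y => f y * g y)}.
Proof. by move=> ? ?; exact: cvgM. Qed.

Lemma contX f x n : {for x, continuous f} ->
  {for x, continuous (fun y => f y ^+ n)}.
Proof.
move=> cf; elim: n => [|n ih]; first exact: cont_cst.
rewrite (_ : (fun y => _) = (fun y => f y * f y ^+ n)); first exact: contM.
by apply/funext => y; rewrite exprS.
Qed.

Lemma cont_norm f x : {for x, continuous f} -> {for x, continuous (fun y => `|f y|)}.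
Proof. by move=> ?; exact: cvg_norm. Qed.

Lemma cont_comp f (h : R -> R) x : {for x, continuous f} ->
  {for f x, continuous h} -> {for x, continuous (fun y => h (f y))}.
Proof. exact: continuous_comp. Qed.

Lemma cont_sin f x : {for x, continuous f} -> {for x, continuous (fun y => sin (f y))}.
Proof. by move=> cf; apply: cont_comp => //; exact: continuous_sin. Qed.

Lemma cont_cos f x : {for x, continuous f} -> {for x, continuous (fun y => cos (f y))}.
Proof. by move=> cf; apply: cont_comp => //; exact: continuous_cos. Qed.

End continuity.

Lemma cont_id {T : topologicalType} (x : T) : {for x, continuous (fun y => y)}.
Proof. exact: cvg_id. Qed.

Lemma cont_fst {T1 T2 : topologicalType} (x : T1 * T2) :
  {for x, continuous (fun y => y.1)}.
Proof. by case: x => ? ?; exact: cvg_fst. Qed.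

Lemma cont_snd {T1 T2 : topologicalType} (x : T1 * T2) :
  {for x, continuous (fun y => y.2)}.
Proof. by case: x => ? ?; exact: cvg_snd. Qed.

Lemma cont_pair {T T1 T2 U : topologicalType} (f : T1 -> T2 -> U) (a : T -> T1)
    (b : T -> T2) (x : T) : {for (a x, b x), continuous (fun p => f p.1 p.2)} ->
  {for x, continuous a} -> {for x, continuous b} ->
  {for x, continuous (fun y => f (a y) (b y))}.
Proof.
move=> cf ca cb; apply: (@continuous_comp _ _ _ (fun y => (a y, b y)) (fun p => f p.1 p.2)) => //.
exact: cvg_pair.
Qed.

(** A bare [intro] on [continuous f] exposes a limit statement; this restores the
    form that [ctac] recognizes. *)
Ltac cintro x :=
  lazymatch goal with |- continuous ?f => intro x; change {for x, continuous f} end.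

Ltac ctac :=
  try lazymatch goal with
  | |- continuous ?f => let x := fresh "x" in intro x; change {for x, continuous f}
  end;
  repeat first
  [ match goal with
    | H : continuous ?f |- {for ?x, continuous ?f} => exact (H x)
    | H : continuous ?f |- {for ?x, continuous (fun y => ?f y)} => exact (H x)
    | H : {for ?x, continuous ?f} |- {for ?x, continuous ?f} => exact H
    | H : {for ?x, continuous ?f} |- {for ?x, continuous (fun y => ?f y)} => exact H
    end
  | lazymatch goal with
    | |- {for _, continuous (fun _ => ?c)} => exact: cont_cst
    | |- {for _, continuous (fun y => y)} => exact: cont_id
    | |- {for _, continuous (fun y => y.1)} => exact: cont_fst
    | |- {for _, continuous (fun y => y.2)} => exact: cont_snd
    | |- {for _, continuous (fun y => (@?f y + @?g y)%R)} => apply: (@contD _ _ f g)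
    | |- {for _, continuous (fun y => (- @?f y)%R)} => apply: (@contN _ _ f)
    | |- {for _, continuous (fun y => (@?f y * @?g y)%R)} => apply: (@contM _ _ f g)
    | |- {for _, continuous (fun y => (@?f y ^+ _)%R)} => apply: (@contX _ _ f)
    | |- {for _, continuous (fun y => sin (@?f y))} => apply: (@cont_sin _ _ f)
    | |- {for _, continuous (fun y => cos (@?f y))} => apply: (@cont_cos _ _ f)
    | |- {for _, continuous (fun y => (`|@?f y|)%R)} => apply: (@cont_norm _ _ f)
    | |- {for _, continuous (GRing.mul ?c)} => apply: (@contM _ _ (fun=> c) (fun y => y))
    | |- {for _, continuous (Algebra.add ?c)} => apply: (@contD _ _ (fun=> c) (fun y => y))
    | |- {for ?x, continuous sin} => exact: (@continuous_sin _ x)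
    | |- {for ?x, continuous cos} => exact: (@continuous_cos _ x)
    end ].

(** A primitive of [f], junk unless [f] has one; all integrals below are
    differences of values of primitives, so that the fundamental theorem of
    calculus is built in. *)
Definition prim {R : realType} (f : R -> R) : R -> R :=
  xget (fun=> 0) [set F | forall x, der x F (f x)].

HB.lock Definition integ (R : realType) (a b : R) (f : R -> R) : R :=
  prim f b - prim f a.
Arguments integ {R}.

Section integral.
Context {R : realType}.
Implicit Types (f g F : R -> R) (x a b c : R).

Lemma integE a b f : integ a b f = prim f b - prim f a.
Proof. by rewrite integ.unlock. Qed.

Lemma prim_der f x : continuous f -> der x (prim f) (f x).
Proof.
move=> /exists_primitive [F dF]; rewrite /prim.
by case: xgetP => [G _ dG|/(_ F)]//; exact: dG.
Qed.

Lemma integ_primitive f F a b : (forall x, der x F (f x)) -> integ a b f = F b - F a.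
Proof.
move=> dF; rewrite integE /prim; case: xgetP => [G _ dG|/(_ F)]//.
have GF x : der x (fun x => G x - F x) 0.
  by rewrite -(subrr (f x)); apply: derB; [exact: dG|exact: dF].
by have := der0_const GF a b; lra.
Qed.

Lemma prim_cont f : continuous f -> continuous (prim f).
Proof. by move=> cf x; exact/der_cont/prim_der. Qed.

Lemma integ_ftc f F a b : a <= b -> continuous f ->
  (forall x, a < x < b -> der x F (f x)) -> {within `[a, b], continuous F} ->
  integ a b f = F b - F a.
Proof.
move=> ab cf dF cF.
have := @der_const R (fun x => prim f x - F x) (fun=> 0) a b ab.
rewrite integE => h; suff: prim f a - F a = prim f b - F b by lra.
apply: h => // [x /dF dFx|].
  by rewrite -(subrr (f x)); apply: derB => //; exact: prim_der.
move=> x; apply: cvgB; last exact: cF.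
by apply: continuous_subspaceT; exact: prim_cont.
Qed.

Lemma integ_der f a x : continuous f -> der x (fun y => integ a y f) (f x).
Proof.
move=> cf; apply: (@der_ext _ (fun y => prim f y - prim f a)) => [y|].
  by rewrite integE.
rewrite -[f x]subr0; apply: derB; first exact: prim_der.
exact: der_cst.
Qed.

Lemma integ_cont f a : continuous f -> continuous (fun y => integ a y f).
Proof. by move=> cf x; exact/der_cont/integ_der. Qed.

Lemma integ_chasles f a b c : integ a b f + integ b c f = integ a c f.
Proof. by rewrite !integE; lra. Qed.

Lemma integ_rev f a b : integ b a f = - integ a b f.
Proof. by rewrite !integE opprB. Qed.

Lemma integ_same f a : integ a a f = 0.
Proof. by rewrite integE subrr. Qed.

Lemma integ_mean f a b : a < b -> continuous f ->
  exists2 c, a < c < b & integ a b f = f c * (b - a).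
Proof.
move=> ab cf; have [x _|//|c cab e] := @MVT R (prim f) f a b ab.
- exact: prim_der.
- by apply: continuous_subspaceT; exact: prim_cont.
- by exists c; [move: cab; rewrite in_itv|rewrite integE].
Qed.

Lemma integD f g a b : continuous f -> continuous g ->
  integ a b (fun x => f x + g x) = integ a b f + integ a b g.
Proof.
move=> cf cg; rewrite (@integ_primitive _ (fun x => prim f x + prim g x)).
  by rewrite !integE; lra.
by move=> x; apply: derD; exact: prim_der.
Qed.

Lemma integZ f a b c : continuous f -> integ a b (fun x => c * f x) = c * integ a b f.
Proof.
move=> cf; rewrite (@integ_primitive _ (fun x => c * prim f x)).
  by rewrite !integE; lra.
move=> x; rewrite -[_ * f x]add0r -[X in X + _](mul0r (prim f x)).
by apply: derM; [exact: der_cst|exact: prim_der].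
Qed.

Lemma integN f a b : continuous f -> integ a b (fun x => - f x) = - integ a b f.
Proof.
move=> cf; rewrite (@integ_primitive _ (fun x => - prim f x)).
  by rewrite !integE; lra.
by move=> x; apply: derN; exact: prim_der.
Qed.

Lemma integB f g a b : continuous f -> continuous g ->
  integ a b (fun x => f x - g x) = integ a b f - integ a b g.
Proof.
move=> cf cg; rewrite (@integ_primitive _ (fun x => prim f x - prim g x)).
  by rewrite !integE; lra.
by move=> x; apply: derB; exact: prim_der.
Qed.

Lemma integ_cst a b c : integ a b (fun=> c) = c * (b - a).
Proof.
rewrite (@integ_primitive _ (fun x => c * x)); first by lra.
by move=> x; apply: der_eq; [apply: derM; [exact: der_cst|exact: der_id]|rewrite mul0r add0r mulr1].
Qed.

Lemma integ_ge0 f a b : a <= b -> continuous f -> (forall x, a < x < b -> 0 <= f x) ->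
  0 <= integ a b f.
Proof.
rewrite le_eqVlt => /predU1P[->|ab] cf f0; first by rewrite integ_same.
have [c cab ->] := integ_mean ab cf.
by rewrite mulr_ge0 ?f0// subr_ge0 ltW.
Qed.

Lemma integ_gt0 f a b : a < b -> continuous f -> (forall x, a < x < b -> 0 < f x) ->
  0 < integ a b f.
Proof.
move=> ab cf f0; have [c cab ->] := integ_mean ab cf.
by rewrite mulr_gt0 ?f0// subr_gt0.
Qed.

Lemma integ_le f g a b : a <= b -> continuous f -> continuous g ->
  (forall x, a < x < b -> f x <= g x) -> integ a b f <= integ a b g.
Proof.
move=> ab cf cg fg; rewrite -subr_ge0 -integB//; apply: integ_ge0 => //.
  by ctac.
by move=> x /fg; rewrite subr_ge0.
Qed.

Lemma eq_integ f g a b : a <= b -> continuous f -> continuous g ->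
  (forall x, a < x < b -> f x = g x) -> integ a b f = integ a b g.
Proof.
move=> ab cf cg fg; apply/eqP; rewrite eq_le; apply/andP.
by split; apply: integ_le => // x /fg ->.
Qed.

Lemma integ_norm_le f a b c : a <= b -> continuous f ->
  (forall x, a < x < b -> `|f x| <= c) -> `|integ a b f| <= c * (b - a).
Proof.
move=> ab cf fc; rewrite ler_norml -mulNr -!integ_cst; apply/andP; split;
  by apply: integ_le => //; try exact: cst_continuous;
    move=> x /fc; rewrite ler_norml => /andP[].
Qed.

Lemma integ_shift f a b c : continuous f ->
  integ a b (fun x => f (x + c)) = integ (a + c) (b + c) f.
Proof.
move=> cf; rewrite (@integ_primitive _ (fun x => prim f (x + c))); first by rewrite integE.
move=> x; rewrite -[f _]mulr1; apply: der_comp; first exact: prim_der.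
by rewrite -[1]addr0; apply: derD; [exact: der_id|exact: der_cst].
Qed.

Lemma integ_opp f a b : continuous f ->
  integ a b (fun x => f (- x)) = integ (- b) (- a) f.
Proof.
move=> cf; rewrite (@integ_primitive _ (fun x => - prim f (- x))).
  by rewrite !integE opprK addrC.
move=> x; apply: der_eq.
  by apply/derN/der_comp; [exact: prim_der|apply: derN; exact: der_id].
by rewrite mulrN mulr1 opprK.
Qed.

Lemma integ_periodic f T a : continuous f -> (forall x, f (x + T) = f x) ->
  integ a (a + T) f = integ 0 T f.
Proof.
move=> cf fT.
have := @integ_chasles f a 0 (a + T); have := @integ_chasles f 0 T (a + T).
rewrite -[integ T _ _](@integ_chasles f T (0 + T)).
have := @integ_shift f 0 a T cf.
rewrite (_ : (fun x => f (x + T)) = f); last by apply/funext.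
by have := @integ_chasles f a 0 a; rewrite !integ_same add0r integ_same; lra.
Qed.

(** The common form of all the Cauchy-Schwarz inequalities below, including
    those against a function that is only piecewise continuous. *)
Lemma discriminant_le (Y X Z : R) : 0 <= Z ->
  (forall s, 0 <= Y - 2 * s * X + s ^+ 2 * Z) -> X ^+ 2 <= Y * Z.
Proof.
move=> Z0 key; move: Z0; rewrite le_eqVlt => /predU1P[Z0|Z0].
  rewrite -Z0 mulr0; move: key; rewrite -Z0 => key.
  have [->|X0] := eqVneq X 0; first by rewrite expr0n.
  have := key ((Y + 1) / (2 * X)).
  rewrite mulr0 addr0 -mulrA [_ / _ * X]mulrAC mulrA (_ : 2 * _ / _ = Y + 1); first by lra.
  by field; rewrite X0.
have := key (X / Z).
rewrite (_ : _ + _ = (Y * Z - X ^+ 2) / Z); last by field; rewrite gt_eqF.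
by rewrite pmulr_lge0 ?invr_gt0// subr_ge0.
Qed.

Lemma cauchy_schwarz f g a b : a <= b -> continuous f -> continuous g ->
  integ a b (fun x => f x * g x) ^+ 2 <=
  integ a b (fun x => f x ^+ 2) * integ a b (fun x => g x ^+ 2).
Proof.
move=> ab cf cg.
have cff : continuous (fun x => f x ^+ 2).
  by ctac.
have cgg : continuous (fun x => g x ^+ 2).
  by ctac.
have cfg : continuous (fun x => f x * g x).
  by ctac.
set X := integ a b (fun x => f x * g x).
set Y := integ a b (fun x => f x ^+ 2).
set Z := integ a b (fun x => g x ^+ 2).
have key s : 0 <= Y - 2 * s * X + s ^+ 2 * Z.
  rewrite /Y /X /Z -!integZ// -integB//; last first.
    by ctac.
  rewrite -integD//; last 2 first.
  - by ctac.
  - by ctac.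
  apply: integ_ge0 => //.
    by ctac.
  move=> x _; rewrite (_ : _ + _ = (f x - s * g x) ^+ 2) ?sqr_ge0//.
  by ring.
have Z0 : 0 <= Z by apply: integ_ge0 => // x _; exact: sqr_ge0.
exact: discriminant_le.
Qed.

Lemma lebesgue_int f a b : a < b -> continuous f ->
  (\int[@lebesgue_measure R]_(x in `[a, b]) (f x)%:E = (integ a b f)%:E)%E.
Proof.
move=> ab cf; rewrite (@continuous_FTC2 R f (prim f) a b ab).
- by rewrite -EFinB integE.
- exact: continuous_subspaceT.
- split => [x _|/=|/=].
  + by case: (@prim_der f x cf).
  + by apply: cvg_at_right_filter; exact: prim_cont.
  + by apply: cvg_at_left_filter; exact: prim_cont.
- by move=> x _; rewrite derive1E; case: (@prim_der f x cf).
Qed.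

End integral.

(** * Integrals depending on a parameter *)

Section parametric.
Context {R : realType}.

(** Compactness of the segment makes continuity at each of its points uniform. *)
Lemma uniform_near (T : topologicalType) (f : T -> R -> R) (p0 : T) (a b : R) :
  (forall y, a <= y <= b -> {for (p0, y), continuous (fun p : T * R => f p.1 p.2)}) ->
  forall e : R, 0 < e -> \forall p \near p0, forall y, a <= y <= b -> `|f p y - f p0 y| < e.
Proof.
move=> cf e e0.
have /compact_near_coveringP h : compact (`[a, b]%classic : set R) by exact: segment_compact.
have := h T (nbhs p0) (fun p y => `|f p y - f p0 y| < e) _.
move=> H; have {H}: \forall p \near nbhs p0, `[a, b]%classic `<=` (fun y => `|f p y - f p0 y| < e).
  apply: H => y; rewrite /= in_itv/= => yab.
  have e20 : 0 < e / 2 by rewrite divr_gt0.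
  have := cf y yab; move=> /cvgrPdist_lt/(_ _ e20) [[A B] [/= nA nB] AB].
  exists (B, A) => //= -[z p] [/= Bz Ap].
  have h1 := AB (p, z) (conj Ap Bz); have h2 := AB (p0, z) (conj (nbhs_singleton nA) Bz).
  rewrite /= in h1 h2.
  have := ler_distD (f p0 y) (f p z) (f p0 z); rewrite distrC in h1; lra.
by apply: filterS => p H y yab; apply: H; rewrite /= in_itv.
Qed.

Lemma der_bound (f : R -> R) (x d : R) :
  (forall e : R, 0 < e -> \forall y \near x, `|f y - f x - d * (y - x)| <= e * `|y - x|) ->
  der x f d.
Proof.
move=> H.
have cv : (fun h => h^-1 *: ((f \o shift x) (h *: (1:R)) - f x)) @ 0^' --> d.
  apply/cvgrPdist_le => e e0.
  have /nbhs0P h0 := H e e0; rewrite near_withinE.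
  apply: filterS h0 => h /= hh hn0.
  rewrite /GRing.scale/= mulr1 [h + x]addrC.
  rewrite (_ : d - _ = - h^-1 * (f (x + h) - f x - d * (x + h - x))); last by field.
  rewrite normrM normrN normfV mulrC ler_pdivrMr ?normr_gt0//.
  by move: hh; rewrite [x + h]addrC addrK.
by split; [apply/cvg_ex; exists d|exact: cvg_lim].
Qed.

(** The form in which conserved quantities are differentiated in time: only an
    increment bound of second order is available for them. *)
Lemma der_bound_sq (f : R -> R) (x d K : R) :
  (\forall y \near x, `|f y - f x - d * (y - x)| <= K * (y - x) ^+ 2) ->
  der x f d.
Proof.
move=> H; apply: der_bound => e e0.
have K0 : 0 < `|K| + 1 by rewrite ltr_wpDl.
near=> y.
have h1 : `|f y - f x - d * (y - x)| <= K * (y - x) ^+ 2 by near: y.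
apply: (le_trans h1).
have h2 : `|x - y| < e / (`|K| + 1).
  by near: y; exists (e / (`|K| + 1)) => //=; rewrite divr_gt0.
rewrite ltr_pdivlMr// in h2.
rewrite -real_normK ?num_real// expr2 mulrA ler_wpM2r//.
apply: le_trans (ltW h2); rewrite distrC mulrC ler_wpM2l//.
by have := ler_norm K; lra.
Unshelve. all: by end_near. Qed.

Lemma integ_param_cont (T : topologicalType) (f : T -> R -> R) (p0 : T) (a b : R) :
  a <= b ->
  (forall y, a <= y <= b -> {for (p0, y), continuous (fun p : T * R => f p.1 p.2)}) ->
  (\forall p \near p0, continuous (f p)) ->
  {for p0, continuous (fun p => integ a b (f p))}.
Proof.
move=> ab cf cp; apply/cvgrPdist_le => e e0.
have ba : 0 < b - a + 1 by lra.
have e1 : 0 < e / (b - a + 1) by rewrite divr_gt0.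
have c0 : continuous (f p0) by exact: nbhs_singleton cp.
near=> p.
have c1 : continuous (f p) by near: p.
rewrite -integB//.
have h : forall y, a <= y <= b -> `|f p y - f p0 y| < e / (b - a + 1).
  by near: p; exact: uniform_near.
apply: le_trans (_ : e / (b - a + 1) * (b - a) <= e).
  apply: integ_norm_le => //; first by ctac.
  by move=> x /andP[ax xb]; rewrite distrC ltW// h// !ltW.
by rewrite mulrAC ler_pdivrMr//; rewrite ler_pM2l//; lra.
Unshelve. all: by end_near. Qed.

(** By the mean value theorem the difference quotient of [f] is a value of [f'],
    which is uniformly close to [f' r0] on the segment. *)
Lemma integ_param_der (f f' : R -> R -> R) (r0 a b : R) : a <= b ->
  (\forall r \near r0, forall y, der r (f ^~ y) (f' r y)) ->
  (\forall r \near r0, continuous (f r)) -> continuous (f' r0) ->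
  (forall y, a <= y <= b -> {for (r0, y), continuous (fun p : R * R => f' p.1 p.2)}) ->
  der r0 (fun r => integ a b (f r)) (integ a b (f' r0)).
Proof.
move=> ab df cf cf'0 cf'; apply: der_bound => e e0.
have ba : 0 < b - a + 1 by lra.
have e1 : 0 < e / (b - a + 1) by rewrite divr_gt0.
have c0 : continuous (f r0) by exact: nbhs_singleton cf.
have [d /= d0 hd] : \forall r \near r0,
    (forall y, der r (f ^~ y) (f' r y)) /\
    forall y, a <= y <= b -> `|f' r y - f' r0 y| < e / (b - a + 1).
  by near=> r; split; near: r => //; exact: (@uniform_near _ f' r0 a b cf' _ e1).
near=> r.
have c1 : continuous (f r) by near: r.
have rd : `|r0 - r| < d by near: r; exists d.
rewrite -integB// mulrC -integZ// -integB; [|by ctac..].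
apply: le_trans (_ : e / (b - a + 1) * `|r - r0| * (b - a) <= _).
  apply: integ_norm_le => //; first by ctac.
  move=> y /andP[/ltW ay /ltW yb]; have yab : a <= y <= b by rewrite ay.
  have near_r s : `|r0 - s| <= `|r0 - r| -> `|r0 - s| < d by move=> /le_lt_trans; apply.
  have [c cr ->] : exists2 c, `|r0 - c| <= `|r0 - r| &
      f r y - f r0 y = f' c y * (r - r0).
    case: (leP r0 r) => rr.
    - have [s|s|c] := @MVT_segment R (f ^~ y) (f' ^~ y) r0 r rr.
      + rewrite in_itv/= => /andP[h1 h2]; apply: (hd s _).1; apply: near_r.
        by rewrite !ler0_norm; lra.
      + apply: continuous_in_subspaceT => {}s; rewrite inE/= in_itv/= => /andP[h1 h2].
        apply: der_cont ((hd s _).1 y); apply: near_r.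
        by rewrite !ler0_norm; lra.
      + rewrite in_itv/= => /andP[h1 h2] ->; exists c => //.
        by rewrite !ler0_norm; lra.
    - have [s|s|c] := @MVT_segment R (f ^~ y) (f' ^~ y) r r0 (ltW rr).
      + rewrite in_itv/= => /andP[h1 h2]; apply: (hd s _).1; apply: near_r.
        by rewrite !ger0_norm; lra.
      + apply: continuous_in_subspaceT => {}s; rewrite inE/= in_itv/= => /andP[h1 h2].
        apply: der_cont ((hd s _).1 y); apply: near_r.
        by rewrite !ger0_norm; lra.
      + rewrite in_itv/= => /andP[h1 h2] h3; exists c; last by rewrite -opprB h3; ring.
        by rewrite !ger0_norm; lra.
  rewrite [X in _ - X]mulrC -mulrBl normrM ler_wpM2r//.
  by apply/ltW/(hd c _).2 => //; exact: near_r.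
rewrite mulrAC ler_wpM2r// mulrAC ler_pdivrMr// ler_pM2l//; lra.
Unshelve. all: by end_near. Qed.

Lemma integ_param_continuous (T : topologicalType) (f : T -> R -> R) (a b : R) :
  continuous (fun p : T * R => f p.1 p.2) -> continuous (fun p => integ a b (f p)).
Proof.
move=> cf.
have cp p : continuous (f p).
  move=> y; change {for y, continuous (fun y => f p y)}.
  apply: (@cont_pair _ _ _ _ f (fun=> p) id); first exact: cf.
    exact: cvg_cst.
  exact: cont_id.
case: (leP a b) => ab p.
  by apply: integ_param_cont => // [y _|]; [exact: cf|exact: nearW].
rewrite (_ : (fun _ => _) = fun p => - integ b a (f p)).
  apply: (@contN _ _ (fun p => integ b a (f p))).
  by apply: integ_param_cont (ltW ab) _ _ => // [y _|]; [exact: cf|exact: nearW].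
by apply/funext => q; rewrite integ_rev.
Qed.

End parametric.

(** * Bessel functions and the first zero of J_1 *)

Section bessel.
Context {R : realType}.
Implicit Types (c : R^nat) (x z s : R).

(* Domination by the exponential series, which is stable under termwise
   derivation: such a series converges and may be differentiated everywhere. *)
Let fdom c := forall i, `|c i| <= (i`!%:R)^-1.

Lemma fdom_diffs c : fdom c -> fdom (pseries_diffs c).
Proof.
move=> dc i; rewrite /pseries_diffs normrM normr_nat.
apply: le_trans (ler_wpM2l _ (dc i.+1)) _ => //.
by rewrite factS natrM invfM mulrA divff ?mul1r.
Qed.

Lemma fdom_cvg c x : fdom c -> cvgn (pseries c x).
Proof.
move=> dc; apply: normed_cvg.
apply: series_le_cvg; last exact: (is_cvg_series_exp_coeff `|x|).
- by move=> n; rewrite normr_ge0.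
- by move=> n; rewrite /exp_coeff/= divr_ge0 ?exprn_ge0.
- move=> n /=; rewrite normrM normrX mulrC /exp_coeff/=.
  by rewrite ler_wpM2l ?exprn_ge0.
Qed.

Lemma fdom_der c x : fdom c ->
  der x (fun z => limn (pseries c z)) (limn (pseries (pseries_diffs c) x)).
Proof.
move=> dc; apply: (@pseries_snd_diffs _ c (`|x| + 1)).
- exact: fdom_cvg.
- exact/fdom_cvg/fdom_diffs.
- exact/fdom_cvg/fdom_diffs/fdom_diffs.
- by rewrite [ltRHS]ger0_norm// ltrDl.
Qed.

Definition bcoef n (i : nat) : R := (- 4^-1) ^+ i / (i`! * (n + i)`!)%:R.

(** [bess n] is the entire function with [J_n s = (s / 2) ^+ n * bess n (s ^+ 2)]. *)
Definition bess n z : R := limn (pseries (bcoef n) z).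

Lemma bcoef_fdom n : fdom (bcoef n).
Proof.
move=> i; rewrite /bcoef normrM normrX normrN !normfV !normr_nat.
rewrite natrM invfM mulrCA mulrC ler_piMl ?invr_ge0//.
have h1 : (4^-1 : R) ^+ i <= 1 by rewrite exprn_ile1// invf_le1// ler1n.
rewrite -[leRHS]mulr1; apply: ler_pM => //; rewrite ?exprn_ge0 ?invr_ge0//.
by rewrite invf_le1// ?ler1n ?ltr0n ?fact_gt0.
Qed.

Lemma bess0_der z : der z (bess 0) (- 4^-1 * bess 1 z).
Proof.
apply: der_eq; first exact/fdom_der/bcoef_fdom.
rewrite /bess -[RHS]/((- 4^-1) *: limn (pseries (bcoef 1) z)).
rewrite -lim_seriesZ; last exact/fdom_cvg/bcoef_fdom.
congr (limn (series _)); apply/funext => i.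
rewrite -[RHS]/(- 4^-1 * (bcoef 1 i * z ^+ i)) mulrA; congr (_ * _); rewrite /pseries_diffs /bcoef add0n add1n exprS.
rewrite !factS !natrM; field.
by rewrite pnatr_eq0 -lt0n fact_gt0/= nat1r pnatr_eq0.
Qed.

Let bcoef' (i : nat) : R := if i is k.+1 then bcoef 1 k else 0.

Lemma zbess1E z : limn (pseries bcoef' z) = z * bess 1 z.
Proof.
apply/cvg_lim => //; rewrite -cvg_shiftS /=.
have c1 : cvgn (pseries (bcoef 1) z) by exact/fdom_cvg/bcoef_fdom.
have : (fun n => z * pseries (bcoef 1) z n) @ \oo --> z * bess 1 z.
  by apply: cvgM; [exact: cvg_cst|exact: c1].
apply: cvg_trans; apply: near_eq_cvg; apply: nearW => n.
rewrite /pseries /series/= big_nat_recl// mul0r add0r mulr_sumr.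
by apply: eq_bigr => i _; rewrite exprS /=; ring.
Qed.

Lemma zbess1_der z : der z (fun z => z * bess 1 z) (bess 0 z).
Proof.
have d' : fdom bcoef'.
  move=> [|i] /=; first by rewrite normr0 invr_ge0.
  rewrite /bcoef normrM normrX normrN !normfV !normr_nat add1n.
  rewrite natrM invfM mulrA ler_piMl ?invr_ge0//.
  rewrite -[leRHS]mulr1; apply: ler_pM => //; rewrite ?exprn_ge0 ?invr_ge0//.
    by rewrite exprn_ile1// invf_le1// ler1n.
  by rewrite invf_le1// ?ler1n ?ltr0n ?fact_gt0.
apply: (@der_ext _ (fun z => limn (pseries bcoef' z))); first exact: zbess1E.
apply: der_eq; first exact: fdom_der.
congr (limn (series _)); apply/funext => i; congr (_ * _).
rewrite /pseries_diffs /= /bcoef add0n add1n factS !natrM; field.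
by rewrite pnatr_eq0 -lt0n fact_gt0/= nat1r pnatr_eq0.
Qed.

Lemma bess_cont n : continuous (bess n).
Proof. by move=> z; apply: der_cont; exact/fdom_der/bcoef_fdom. Qed.

Lemma besselJE n s : besselJ n s = (s / 2) ^+ n * bess n (s ^+ 2).
Proof.
rewrite /besselJ /bess -[RHS]/((s / 2) ^+ n *: limn (pseries (bcoef n) (s ^+ 2))).
rewrite -lim_seriesZ; last exact/fdom_cvg/bcoef_fdom.
congr (limn (series _)); apply/funext => i.
rewrite -[RHS]/((s / 2) ^+ n * (bcoef n i * (s ^+ 2) ^+ i)).
rewrite exprD exprM mulrCA; congr (_ * _); rewrite /bcoef.
rewrite (_ : (s / 2) ^+ 2 = 4^-1 * s ^+ 2); last by field.
by rewrite [in RHS]exprNn exprMn -!mulrA; congr (_ * _); rewrite mulrCA.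
Qed.

Lemma bess1_0 : bess 1 0 = 1.
Proof.
apply/cvg_lim => //; rewrite -cvg_shiftS /=.
apply: cvg_near_cst; apply: nearW => n.
rewrite /pseries /series/= big_nat_recl// expr0 big1 ?addr0; last first.
  by move=> i _; rewrite expr0n/= mulr0.
by rewrite /bcoef expr0 mul1r fact0 mul1n mulr1 invr1.
Qed.

(** [bess 1 16 = J_1 4 / 2]. Five terms of the series give a negative sum, and the
    ratio of consecutive terms is at most 1/10 from the sixth term on, so the
    tail is at most 10/9 of its first term. *)
Lemma bess1_16 : bess 1 16 < 0.
Proof.
pose a i : R := 4 ^+ i / (i`! * (1 + i)`!)%:R.
have aE i : `|bcoef 1 i * 16 ^+ i| = a i.
  rewrite /bcoef normrM normrM normrX normrN !normfV !normr_nat normrX normr_nat.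
  rewrite /a; set F := _%:R^-1.
  have e : (4^-1 : R) ^+ i * 4 ^+ i = 1 by rewrite -exprMn mulVf ?expr1n.
  have -> : (16 : R) ^+ i = 4 ^+ i * 4 ^+ i by rewrite -exprMn -natrM.
  by rewrite mulrAC mulrA e mul1r.
have aS i : a i.+1 = a i * (4 / (i.+1%:R * i.+2%:R)).
  rewrite /a !add1n exprS !factS !natrM; field.
  by rewrite nat1r -natrD add2n !pnatr_eq0 -!lt0n fact_gt0.
have a5 i : (5 <= i)%N -> a i.+1 <= a i / 10.
  move=> i5; rewrite aS.
  have ai0 : 0 <= a i by rewrite -aE.
  apply: ler_wpM2l => //.
  have h1 : (6 : R) <= i.+1%:R by rewrite ler_nat.
  have h2 : (7 : R) <= i.+2%:R by rewrite ler_nat.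
  by rewrite ler_pdivrMr; nra.
have bS i : bcoef 1 i.+1 = bcoef 1 i * (- 4^-1 / (i.+1%:R * i.+2%:R)).
  rewrite /bcoef !add1n exprS !factS !natrM; field.
  by rewrite nat1r -natrD add2n !pnatr_eq0 -!lt0n fact_gt0.
have b0 : bcoef 1 0 = 1 by rewrite /bcoef expr0 fact0 mul1n invr1 mulr1.
have a0 : a 0%N = 1 by rewrite -aE b0 expr0 mulr1 normr1.
pose T n := pseries (bcoef 1) 16 (n + 5)%N : R.
have T0 : T 0%N + 10 / 9 * a 5%N < 0.
  rewrite /T /pseries /series/= !big_nat_recr//= big_nil !aS !bS a0 b0.
  by rewrite !exprS !expr0; lra.
have Tn n : T n + 10 / 9 * a (n + 5)%N <= T 0%N + 10 / 9 * a 5%N.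
  elim: n => // n; apply: le_trans.
  have -> : T n.+1 = T n + bcoef 1 (n + 5) * 16 ^+ (n + 5).
    by rewrite /T /pseries /series/= addSn big_nat_recr.
  have := a5 (n + 5)%N (leq_addl _ _); have := ler_norm (bcoef 1 (n + 5) * 16 ^+ (n + 5)).
  by rewrite aE addSn; lra.
have c1 : cvgn (pseries (bcoef 1) 16) by exact/fdom_cvg/bcoef_fdom.
have cT : T @ \oo --> bess 1 16.
  by rewrite /T (cvg_shiftn 5 (pseries (bcoef 1) 16)); exact: c1.
apply: le_lt_trans T0; rewrite -(cvg_lim _ cT)//.
apply: limr_le; [by apply/cvg_ex; exists (bess 1 16)|apply: nearW => n].
have an0 : 0 <= a (n + 5)%N by rewrite -aE.
by have := Tn n; lra.
Qed.

(** [J_1] is positive near 0 and negative at 4, so it has a zero in between; the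
    infimum of the positive zeros is itself one, by continuity. The bound by 4
    is what makes the spectral gap visible by mere Cauchy-Schwarz. *)
Lemma j11P : [/\ 0 < j11 R, j11 R < 4, bess 1 (j11 R ^+ 2) = 0 &
  forall s, 0 <= s < j11 R -> 0 < bess 1 (s ^+ 2)].
Proof.
pose g s := bess 1 (s ^+ 2).
have cg : continuous g by move=> s; apply: (@cont_comp _ _ (fun s : R => s ^+ 2) (bess 1)); [ctac|exact: bess_cont].
pose S := [set s : R | 0 < s /\ besselJ 1 s = 0].
have SE s : 0 < s -> S s <-> g s = 0.
  move=> s0; rewrite /S /= besselJE expr1; split=> [[_ /eqP]|gs].
    by rewrite mulf_eq0 gt_eqF ?divr_gt0//= => /eqP.
  by split => //; rewrite -/(g s) gs mulr0.
have g0 : g 0 = 1 by rewrite /g expr0n bess1_0.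
have g4 : g 4 < 0 by rewrite /g (_ : 4 ^+ 2 = 16) ?bess1_16// -natrX.
have [c c04 gc] : exists2 c, c \in `[0, 4] & g c = 0.
  apply: IVT => //; first exact: continuous_subspaceT.
  by rewrite g0 ge_min le_max ler01 (ltW g4) orbT.
move: c04; rewrite in_itv/= => /andP[c0 c4].
have c0' : 0 < c.
  by rewrite lt_neqAle c0 andbT eq_sym; apply: contra_eq_neq gc => ->; rewrite g0 oner_neq0.
have c4' : c < 4.
  by rewrite lt_neqAle c4 andbT; apply: contra_eq_neq gc => ->; rewrite lt_eqF.
have Sc : S c by apply/SE.
have hi : has_inf S by split; [exists c|exists 0 => s [/ltW]].
have j4 : j11 R < 4 by apply: le_lt_trans c4'; exact: (ge_inf hi.2).
have j0 : 0 <= j11 R by apply: (lb_le_inf hi.1) => s [/ltW].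
have nz s : 0 <= s < j11 R -> g s <> 0.
  move=> /andP[s0 sj] gs.
  have s0' : 0 < s.
    by rewrite lt_neqAle s0 andbT eq_sym; apply: contra_eq_neq gs => ->; rewrite g0 oner_neq0.
  by move: sj; rewrite ltNge => /negP; apply; apply: (ge_inf hi.2); exact/SE.
have pos s : (forall x, 0 <= x <= s -> g x <> 0) -> 0 <= s -> 0 < g s.
  move=> gx s0; rewrite ltNge; apply/negP => gs.
  have [x] : exists2 x, x \in `[0, s] & g x = 0.
    apply: IVT => //; first exact: continuous_subspaceT.
    by rewrite g0 ge_min le_max ler01 gs orbT.
  by rewrite in_itv/=; exact: gx.
have gpos s : 0 <= s < j11 R -> 0 < g s.
  move=> /andP[s0 sj]; apply: pos => // x /andP[x0 xs].
  by apply: nz; rewrite x0 (le_lt_trans xs).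
have gj : g (j11 R) = 0.
  apply: contrapT => /eqP gj.
  have pj : 0 < g (j11 R).
    apply: pos => // x /andP[x0]; rewrite le_eqVlt => /predU1P[->|xj]; first exact/eqP.
    by apply: nz; rewrite x0.
  have [d /= d0 hd] : \forall x \near j11 R, 0 < g x by exact: (cvgr_gt _ (cg _)).
  have [s Ss sjd] := @inf_adherent _ S d d0 hi.
  have js : j11 R <= s by exact: (ge_inf hi.2).
  have : 0 < g s by apply: hd => /=; rewrite ler0_norm; rewrite -/(j11 R) in sjd; lra.
  by case: (Ss) => s0 _; move/SE : Ss => /(_ s0) ->; rewrite ltxx.
split => //; rewrite lt_neqAle j0 andbT; apply: contra_eq_neq gj => <-.
by rewrite g0 oner_neq0.
Qed.

End bessel.

(* [field] would unfold [pi], so it is made opaque first. *)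
Ltac pifield :=
  match goal with |- context [@pi ?R] =>
    have := lt0r_neq0 (@pi_gt0 R); generalize (@pi R) end;
  let P := fresh "P" in let H := fresh "H" in intros P H; field; rewrite ?H //.

(** * Integration over a period and Wirtinger's inequality *)

Section wirtinger.
Context {R : realType}.
Implicit Types (f p : R -> R) (x y : R).

Lemma sin_ge_cubic x : 0 <= x -> x - x ^+ 3 / 6 <= sin x.
Proof.
move=> x0.
have mono (h h' : R -> R) : h 0 = 0 -> (forall y, der y h (h' y)) ->
    (forall y, 0 <= y -> 0 <= h' y) -> forall y, 0 <= y -> 0 <= h y.
  move=> h0 dh h'0 y y0; rewrite -h0.
  apply: (@der_le R h h' 0 y) => //.
    by apply: continuous_subspaceT; exact: der_continuous dh.
  by move=> z /andP[/ltW z0 _]; exact: h'0.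
have c1 y : 0 <= y -> 0 <= y - sin y.
  apply: (mono (fun y => y - sin y) (fun y => 1 - cos y)).
  - by rewrite sin0 subr0.
  - by move=> z; apply: der_eq; [dtac|rewrite mulr1].
  - by move=> z _; rewrite subr_ge0 cos_le1.
have c2 y : 0 <= y -> 0 <= cos y - 1 + y ^+ 2 / 2.
  apply: (mono (fun y => cos y - 1 + y ^+ 2 / 2) (fun y => y - sin y)) => //.
  - by rewrite cos0 expr0n /=; lra.
  - by move=> z; apply: der_eq; [dtac|rewrite /=; field].
suff : 0 <= sin x - x + x ^+ 3 / 6 by lra.
apply: (mono (fun y => sin y - y + y ^+ 3 / 6) (fun y => cos y - 1 + y ^+ 2 / 2)) => //.
- by rewrite sin0 expr0n /=; lra.
- by move=> z; apply: der_eq; [dtac|rewrite /=; field].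
Qed.

(** If [pi] were larger, the cubic lower bound of the sine at [0.525 < pi / 6]
    would exceed [sin (pi / 6) = 1/2]. The latter is read off from
    [sin (pi / 2) = 1] through the triple angle formula. *)
Lemma pi_le : pi <= 315 / 100 :> R.
Proof.
rewrite leNgt; apply/negP => pi3.
have pi4 := @pihalf_lt2 R.
pose a : R := pi / 6.
have sa : sin a = 1 / 2.
  have s3 : sin (a + a + a) = 1.
    by rewrite (_ : a + a + a = pi / 2) ?sin_pihalf// /a; field.
  have := cos2Dsin2 a.
  move: s3; rewrite !sinD !cosD.
  have a0 : 0 < sin a by apply: sin_gt0_pi; rewrite /a; lra.
  set s := sin a in a0 *; set c := cos a => h1 h2.
  have c2 : c ^+ 2 = 1 - s ^+ 2 by lra.
  have h3 : (s + 1) * (2 * s - 1) ^+ 2 = 0.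
    move: h1; have -> : ((s * c + c * s) * c + (c * c - s * s) * s) =
      3 * s * c ^+ 2 - s ^+ 3 by ring.
    rewrite c2 => h1.
    have -> : (s + 1) * (2 * s - 1) ^+ 2 = 1 - (3 * s * (1 - s ^+ 2) - s ^+ 3) by ring.
    by rewrite h1 subrr.
  move/eqP : h3; rewrite mulf_eq0 expf_eq0/= => /orP[|] /eqP; lra.
have : sin (525 / 1000 : R) <= sin a.
  by apply/ltW; rewrite ltr_sin ?in_itv/= /a; lra.
have := @sin_ge_cubic (525 / 1000); rewrite sa; lra.
Qed.

Definition oint f : R := integ 0 (2 * pi) f.

Lemma twopi_gt0 : 0 < 2 * pi :> R.
Proof. by rewrite mulr_gt0 ?pi_gt0. Qed.

Lemma cos_2pi : cos (2 * pi) = 1 :> R.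
Proof. by rewrite mulr2n mulrDl mul1r cosD cospi sinpi; ring. Qed.

Lemma sin_2pi : sin (2 * pi) = 0 :> R.
Proof. by rewrite mulr2n mulrDl mul1r sinD cospi sinpi; ring. Qed.

Definition per2pi f := forall x, f (x + 2 * pi) = f x.

Lemma ointD f g : continuous f -> continuous g ->
  oint (fun x => f x + g x) = oint f + oint g.
Proof. exact: integD. Qed.

Lemma ointB f g : continuous f -> continuous g ->
  oint (fun x => f x - g x) = oint f - oint g.
Proof. exact: integB. Qed.

Lemma ointN f : continuous f -> oint (fun x => - f x) = - oint f.
Proof. exact: integN. Qed.

Lemma ointZ f c : continuous f -> oint (fun x => c * f x) = c * oint f.
Proof. exact: integZ. Qed.

Lemma oint_cst c : oint (fun=> c) = 2 * pi * c.
Proof. by rewrite /oint integ_cst subr0 mulrC. Qed.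

Lemma oint_le f g : continuous f -> continuous g -> (forall x, f x <= g x) ->
  oint f <= oint g.
Proof. by move=> cf cg fg; apply: integ_le => //; exact/ltW/twopi_gt0. Qed.

Lemma oint_ge0 f : continuous f -> (forall x, 0 <= f x) -> 0 <= oint f.
Proof. by move=> cf f0; apply: integ_ge0 => //; exact/ltW/twopi_gt0. Qed.

Lemma oint_shift f a : continuous f -> per2pi f ->
  oint (fun x => f (x + a)) = oint f.
Proof.
move=> cf pf; rewrite /oint integ_shift// add0r addrC.
exact: integ_periodic.
Qed.

Lemma oint_der f f' : (forall x, der x f (f' x)) -> per2pi f -> oint f' = 0.
Proof.
move=> df pf; rewrite /oint (integ_primitive _ _ df).
by have := pf 0; rewrite add0r => ->; rewrite subrr.
Qed.

Lemma der_periodic f f' : (forall x, der x f (f' x)) -> per2pi f -> per2pi f'.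
Proof.
move=> df pf x; have := df (x + 2 * pi).
have h : der x (fun y => f (y + 2 * pi)) (f' (x + 2 * pi) * 1).
  apply: der_comp; first exact: df.
  by apply: der_eq; [dtac|rewrite addr0].
move=> _; rewrite -[LHS]mulr1; apply: der_uniq h _.
by apply: der_ext (df x) => y; rewrite pf.
Qed.

Lemma oint_parts f f' g g' : (forall x, der x f (f' x)) -> (forall x, der x g (g' x)) ->
  continuous f' -> continuous g' -> per2pi f -> per2pi g ->
  oint (fun x => f' x * g x) = - oint (fun x => f x * g' x).
Proof.
move=> df dg cf' cg' pf pg.
have cf := der_continuous df; have cg := der_continuous dg.
apply/eqP; rewrite -addr_eq0 -integD; [|ctac..].
apply/eqP; apply: (@oint_der (fun x => f x * g x)).
  by move=> x; apply: derM.
by move=> x; rewrite pf pg.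
Qed.

Lemma oint_cos : oint cos = 0 :> R.
Proof.
by rewrite /oint (@integ_primitive _ _ sin) ?sin_2pi ?sin0 ?subrr// => x; exact: is_derive_sin.
Qed.

Lemma oint_sin : oint sin = 0 :> R.
Proof.
rewrite /oint (@integ_primitive _ _ (fun x => - cos x)) ?cos_2pi ?cos0 ?subrr//.
by move=> x; apply: der_eq; [dtac|rewrite ?mulr1 opprK].
Qed.

Lemma oint_cos2 : oint (fun x => cos x ^+ 2) = pi :> R.
Proof.
rewrite /oint (@integ_primitive _ _ (fun x => (x + sin x * cos x) / 2)).
  by rewrite sin_2pi sin0; field.
move=> x; apply: der_eq; [dtac|].
rewrite /= (_ : sin x * (- sin x * 1) = cos x ^+ 2 - (cos x ^+ 2 + sin x ^+ 2)); last by ring.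
by rewrite cos2Dsin2; field.
Qed.

Lemma oint_sin2 : oint (fun x => sin x ^+ 2) = pi :> R.
Proof.
rewrite (_ : (fun x => _) = fun x : R => 1 - cos x ^+ 2); last first.
  by apply/funext => x; rewrite -(cos2Dsin2 x); ring.
rewrite /oint integB ?[X in _ - X = _]oint_cos2; [|by ctac..].
by rewrite integ_cst; ring.
Qed.

Lemma oint_cossin : oint (fun x => cos x * sin x) = 0 :> R.
Proof.
rewrite /oint (@integ_primitive _ _ (fun x => sin x ^+ 2 / 2)).
  by rewrite sin_2pi sin0; ring.
by move=> x; apply: der_eq; [dtac|rewrite /=; field].
Qed.

(** The kernel of the inverse of minus the second derivative on functions without
    Fourier modes 0 and 1. It is the sum of the series of [cos (k s) / (pi k^2)]
    over [k >= 2], so its square integral is [(zeta 4 - 1) / pi]. *)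
Let wk (s : R) : R := (s ^+ 2 - 2 * pi * s) / (4 * pi) + pi / 6 - cos s / pi.

Let wk_norm : oint (fun s => wk s ^+ 2) = pi ^+ 3 / 90 - pi^-1.
Proof.
have pi0 := @pi_gt0 R; have pin0 : pi != 0 :> R by rewrite gt_eqF.
rewrite /oint (@integ_primitive _ _ (fun s =>
   (s ^+ 5 / 5 - pi * s ^+ 4 + 4 * pi ^+ 2 * s ^+ 3 / 3) / (16 * pi ^+ 2)
   + (s ^+ 3 / 3 - pi * s ^+ 2) / 12 + pi ^+ 2 * s / 36
   - 2 / pi * (((s ^+ 2 - 2 * pi * s) / (4 * pi) + pi / 6) * sin s
      + (s - pi) / (2 * pi) * cos s - sin s / (2 * pi))
   + (s + sin s * cos s) / (2 * pi ^+ 2))).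
  by rewrite cos_2pi sin_2pi cos0 sin0; pifield.
move=> s; apply: der_eq; [dtac|].
rewrite /wk /=; have h : sin s ^+ 2 = 1 - cos s ^+ 2 by rewrite -(cos2Dsin2 s); ring.
rewrite (_ : sin s * (- sin s * 1) = - sin s ^+ 2); last by ring.
by rewrite h; pifield.
Qed.

(** The primitive [F] of [f] is minus the integral of [p = f'] against translates of
    [wk], hence bounded by Cauchy-Schwarz, and [int f^2 = - int F p]. The sharp
    constant is 4; bounding [F] uniformly and [pi] by 3.15 leaves 23/10. *)
Lemma wirtinger f p : (forall x, der x f (p x)) -> continuous p -> per2pi f ->
  oint f = 0 -> oint (fun x => f x * cos x) = 0 -> oint (fun x => f x * sin x) = 0 ->
  23 / 10 * oint (fun x => f x ^+ 2) <= oint (fun x => p x ^+ 2).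
Proof.
move=> df cp pf f0 fc fs.
have pi0 := @pi_gt0 R; have pin0 : pi != 0 :> R by rewrite gt_eqF.
have cf := der_continuous df; have pp := der_periodic df pf.
have ccos := @continuous_cos R; have csin := @continuous_sin R.
have tp := @twopi_gt0.
pose F x := prim f x - oint (prim f) / (2 * pi).
have dF x : der x F (f x).
  by rewrite -[f x]subr0; apply: derB; [exact: prim_der|exact: der_cst].
have cF := der_continuous dF.
have pF : per2pi F.
  move=> x; apply/eqP; rewrite -subr_eq0 -(integ_primitive x (x + 2 * pi) dF).
  by rewrite (integ_periodic _ cf pf) -/(oint f) f0.
have F0 : oint F = 0.
  rewrite /oint integB; [|exact: prim_cont|exact: cst_continuous].
  by rewrite integ_cst /oint; pifield.
have ccomp (g : R -> R) a : continuous g -> continuous (fun x => g (a + x)).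
  by move=> cg x; apply: (@cont_comp _ _ (fun x => a + x) g); [ctac|exact: cg].
have Fc a : oint (fun s => F (a + s) * cos s) = 0.
  pose G y := F y * cos (y - a).
  have cG : continuous G by rewrite /G; ctac.
  have pG : per2pi G.
    by move=> x; rewrite /G pF (_ : x + 2 * pi - a = (x - a) + 2 * pi) 1?cosD ?cos_2pi ?sin_2pi; ring.
  rewrite (_ : (fun s => _) = (fun s => G (s + a))); last first.
    by apply/funext => s; rewrite /G [a + s]addrC addrK.
  rewrite oint_shift// /G.
  rewrite (_ : (fun s => _) = (fun s => cos a * (F s * cos s) + sin a * (F s * sin s))); last first.
    by apply/funext => s; rewrite cosB; ring.
  rewrite ointD ?ointZ; [|by ctac..].
  have -> : oint (fun x => F x * cos x) = 0.
    rewrite -[LHS]opprK -(@oint_parts F f sin cos) ?fs ?oppr0//.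
    - by move=> x; exact: is_derive_sin.
    - by move=> x; rewrite sinD cos_2pi sin_2pi; ring.
  have -> : oint (fun x => F x * sin x) = 0.
    rewrite -[LHS]opprK -(@oint_parts F f (fun x => - cos x) sin)//.
    - rewrite (_ : (fun x => _) = (fun x => - (f x * cos x))); last first.
        by apply/funext => x; rewrite mulrN.
      by rewrite ointN ?fc ?oppr0//; ctac.
    - by move=> x; apply: der_eq; [dtac|rewrite mulr1 opprK].
    - by move=> x; rewrite cosD cos_2pi sin_2pi; ring.
  by rewrite !mulr0 addr0.
have cwk : continuous wk by rewrite /wk; ctac.
have rep a : oint (fun s => wk s * p (a + s)) = - F a.
  pose q' s : R := (s - pi) / (2 * pi) + sin s / pi.
  have dwk s : der s wk (q' s).
    by rewrite /wk; apply: der_eq; [dtac|rewrite /q' /=; pifield].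
  have dq' s : der s q' ((2 * pi)^-1 + cos s / pi).
    by rewrite /q'; apply: der_eq; [dtac|rewrite /=; pifield].
  have dcomp (g g' : R -> R) s : (forall x, der x g (g' x)) -> der s (fun x => g (a + x)) (g' (a + s)).
    move=> dg; rewrite -[g' _]mulr1; apply: der_comp => //.
    by change (der s (fun y => a + y) 1); apply: der_eq; [dtac|rewrite add0r].
  pose G s := wk s * f (a + s) - q' s * F (a + s).
  have dG s : der s G (wk s * p (a + s) - ((2 * pi)^-1 + cos s / pi) * F (a + s)).
    apply: der_eq.
      by apply: derB; apply: derM; [exact: dwk|exact: dcomp|exact: dq'|exact: dcomp].
    by rewrite /=; ring.
  have cFa := ccomp F a cF; have cpa := ccomp p a cp.
  have := @integ_primitive R _ _ 0 (2 * pi) dG; rewrite integB; [|ctac..].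
  rewrite -/(oint _) (_ : integ _ _ _ = 0); last first.
    rewrite (_ : (fun x => _) = (fun x => (2 * pi)^-1 * F (a + x) + pi^-1 * (F (a + x) * cos x))); last first.
      by apply/funext => x; ring.
    rewrite -/(oint _) ointD ?ointZ; [|by ctac..].
    have -> : oint (fun x => F (a + x)) = 0.
      by rewrite -F0 -(oint_shift a cF pF); congr oint; apply/funext => x; rewrite addrC.
    by rewrite Fc !mulr0 addr0.
  rewrite subr0 => ->.
  rewrite /G !addr0 pf pF /wk /q' cos_2pi sin_2pi cos0 sin0; pifield.
set Q := oint (fun s => wk s ^+ 2); set P := oint (fun x => p x ^+ 2).
have FQ a : F a ^+ 2 <= Q * P.
  rewrite -[F a]opprK -rep sqrrN.
  have := cauchy_schwarz (ltW tp) cwk (ccomp p a cp).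
  rewrite -!/(oint _) -/Q => /le_trans; apply.
  rewrite (_ : oint _ = P)//.
  under eq_fun do rewrite addrC.
  apply: (@oint_shift (fun x => p x ^+ 2)); first by ctac.
  by move=> x; rewrite pp.
have FF : oint (fun x => F x ^+ 2) <= 2 * pi * Q * P.
  rewrite (_ : 2 * pi * Q * P = integ 0 (2 * pi) (fun=> Q * P)); last by rewrite integ_cst; ring.
  by apply: integ_le; [exact: ltW|ctac|exact: cst_continuous|move=> x _; exact: FQ].
have ff : oint (fun x => f x ^+ 2) = - oint (fun x => F x * p x).
  rewrite -(@oint_parts F f f p)//; congr integ; by apply/funext => x; rewrite expr2.
have P0 : 0 <= P by apply: integ_ge0 (ltW tp) _ _ => [|x _]; [ctac|exact: sqr_ge0].
have f20 : 0 <= oint (fun x => f x ^+ 2).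
  by apply: integ_ge0 (ltW tp) _ _ => [|x _]; [ctac|exact: sqr_ge0].
have CS := cauchy_schwarz (ltW tp) cF cp; rewrite -!/(oint _) -/P in CS.
have key : 2 * pi * Q <= (10 / 23) ^+ 2.
  rewrite /Q wk_norm (_ : 2 * pi * _ = pi ^+ 4 / 45 - 2); last by pifield.
  have := @pi_le => h; have h2 : pi ^+ 2 <= (315 / 100) ^+ 2 :> R by rewrite ler_sqr ?nnegrE; lra.
  have : (pi ^+ 2) ^+ 2 <= ((315 / 100) ^+ 2) ^+ 2 :> R by rewrite ler_sqr ?nnegrE; nra.
  by rewrite -!exprM /=; lra.
have : oint (fun x => f x ^+ 2) ^+ 2 <= (10 / 23 * P) ^+ 2.
  rewrite ff sqrrN (le_trans CS)// exprMn [P ^+ 2]expr2 mulrA ler_wpM2r//.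
  by apply: le_trans FF _; rewrite ler_wpM2r.
rewrite ler_sqr ?nnegrE//; first by lra.
by lra.
Qed.

End wirtinger.

(** * Radial profiles and the spectral gap of modes 0 and 1 *)

Section radial.
Context {R : realType}.
Implicit Types (f g h c w : R -> R) (r s : R) (k : nat).

Lemma cont_at0 f (K : R) : f 0 = 0 -> (forall r, `|r| <= 1 -> `|f r| <= K * `|r|) ->
  {for 0, continuous f}.
Proof.
move=> f0 fK; rewrite /prop_for /continuous_at f0; apply/cvgrPdist_le => e e0.
have K0 : 0 < `|K| + 1 by rewrite ltr_wpDl.
exists (Num.min 1 (e / (`|K| + 1))) => /=.
  by rewrite lt_min ltr01 divr_gt0.
move=> r /=; rewrite sub0r normrN lt_min => /andP[r1 re].
rewrite sub0r normrN; apply: le_trans (fK r (ltW r1)) _.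
rewrite ltr_pdivlMr// in re.
have := ler_norm K; have := normr_ge0 r; nra.
Qed.

Lemma bounded_on f (a b : R) : a <= b -> continuous f ->
  exists2 K, 0 <= K & forall x, a <= x <= b -> `|f x| <= K.
Proof.
move=> ab cf.
have cn : {within `[a, b], continuous (fun x => `|f x|)}.
  by apply: continuous_subspaceT; ctac.
have [x xab hx] := EVT_max ab cn.
by exists `|f x| => // y yab; apply: hx; rewrite in_itv.
Qed.

(** The moment [mom k w] is minus the flux [r ^+ (2 k + 1) (c / r ^+ k)'] of the
    radial factor [c] of the stream function of [w r * cos (k theta)]. *)
Definition mom k g r := integ 0 r (fun s => s ^+ k.+1 * g s).

Lemma momc k g : continuous g -> continuous (fun s => s ^+ k.+1 * g s).
Proof. by move=> cg; ctac. Qed.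

Lemma mom_der k g r : continuous g -> der r (mom k g) (r ^+ k.+1 * g r).
Proof. by move=> cg; exact/integ_der/momc. Qed.

Lemma mom_cont k g : continuous g -> continuous (mom k g).
Proof. by move=> cg r; exact: der_cont (mom_der _ _ cg). Qed.

Lemma mom0 k g : mom k g 0 = 0.
Proof. exact: integ_same. Qed.

Lemma mom_lin k f g a r : continuous f -> continuous g ->
  mom k (fun s => f s + a * g s) r = mom k f r + a * mom k g r.
Proof.
move=> cf cg; rewrite /mom -integZ -?integD; [|by ctac..].
by congr (integ _ _ _); apply/funext => s; ring.
Qed.

Lemma momZ k g a r : continuous g -> mom k (fun s => a * g s) r = a * mom k g r.
Proof.
move=> cg; rewrite /mom -integZ; last by ctac.
by congr (integ _ _ _); apply/funext => s; ring.
Qed.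

Lemma mom_bound k g : continuous g ->
  exists2 K, 0 <= K & forall r, `|r| <= 1 -> `|mom k g r| <= K * `|r| ^+ k.+2.
Proof.
move=> cg; have [K K0 hK] := @bounded_on g (-1) 1 (ltac:(lra)) cg.
exists K => // r r1.
have [c cr ->] : exists2 c, `|c| <= `|r| & mom k g r = c ^+ k.+1 * g c * r.
  have [r0|r0|->] := ltgtP r 0.
  - have [c /andP[c1 c2] e] := integ_mean r0 (@momc k g cg); exists c.
      by rewrite !ltr0_norm; lra.
    by rewrite /mom integ_rev e; ring.
  - have [c /andP[c1 c2] e] := integ_mean r0 (@momc k g cg); exists c.
      by rewrite !gtr0_norm; lra.
    by rewrite /mom e subr0.
  - by exists 0; rewrite ?mulr0 ?mom0.
have gc : `|g c| <= K by apply: hK; rewrite -ler_norml (le_trans cr).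
rewrite !normrM normrX [`|r| ^+ _]exprSr mulrA ler_wpM2r// mulrC.
by apply: ler_pM => //; rewrite lerXn2r ?nnegrE.
Qed.

Let ek k f g r := mom k f r * mom k g r / r ^+ (2 * k).+1.

(** The pairing [<f, G g>] of the radial factors of mode [k]; see
    [rad_sol_energy]. *)
Definition rad_energy k f g := integ 0 1 (ek k f g).

Lemma rad_energy_cont k f g : continuous f -> continuous g -> continuous (ek k f g).
Proof.
move=> cf cg r; change {for r, continuous (ek k f g)}.
have [->|r0] := eqVneq r 0.
  have [K K0 hK] := mom_bound k cf; have [L L0 hL] := mom_bound k cg.
  apply: (@cont_at0 _ (K * L)); first by rewrite /ek mom0 !mul0r.
  move=> s s1; rewrite /ek !normrM normfV normrX.
  have [->|s0] := eqVneq s 0; first by rewrite mom0 normr0 !mul0r mulr0.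
  have sp : 0 < `|s| by rewrite normr_gt0.
  rewrite ler_pdivrMr ?exprn_gt0//.
  apply: le_trans (ler_pM _ _ (hK s s1) (hL s s1)) _ => //.
  rewrite (_ : K * _ * _ = K * L * (`|s| ^+ (k.+2 + k.+2))); last by rewrite exprD; ring.
  rewrite -[leRHS]mulrA -exprS; apply: ler_wpM2l; first exact: mulr_ge0.
  by apply: ler_wiXn2l => //; lia.
rewrite /ek; apply: contM; first by apply: contM; exact: mom_cont.
apply: cvgV; first by rewrite expf_neq0.
by apply: contX; exact: cont_id.
Qed.

Lemma rad_energyC k f g : rad_energy k f g = rad_energy k g f.
Proof. by congr (integ _ _ _); apply/funext => r; rewrite /ek [X in X / _]mulrC. Qed.

Lemma rad_energy_lin k f g h a : continuous f -> continuous g -> continuous h ->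
  rad_energy k (fun s => f s + a * g s) h = rad_energy k f h + a * rad_energy k g h.
Proof.
move=> cf cg ch; rewrite /rad_energy.
have c1 := @rad_energy_cont k f h cf ch; have c2 := @rad_energy_cont k g h cg ch.
rewrite -integZ -?integD; [|by ctac..].
by congr (integ _ _ _); apply/funext => r; rewrite /ek mom_lin//; ring.
Qed.

Lemma rad_energy_ge0 k f : continuous f -> 0 <= rad_energy k f f.
Proof.
move=> cf; apply: integ_ge0 => //; first exact: rad_energy_cont.
by move=> r /andP[r0 _]; rewrite /ek divr_ge0 ?exprn_ge0 ?(ltW r0)// -expr2 sqr_ge0.
Qed.

(** [c] is the radial factor of the stream function of [w r * cos (k t)]: the
    Poisson equation, integrated once. *)
Definition rad_sol k c w := [/\ continuous c, c 1 = 0 &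
  forall r, 0 < r < 1 -> der r (fun s => c s / s ^+ k) (- mom k w r / r ^+ (2 * k).+1)].

(** Integrate by parts: differentiate [mom k g * c / r ^+ k]. *)
Lemma rad_sol_energy k c w g : rad_sol k c w -> continuous w -> continuous g ->
  integ 0 1 (fun r => r * g r * c r) = rad_energy k g w.
Proof.
move=> [cc c1 dc] cw cg.
have crgc : continuous (fun r => r * g r * c r) by ctac.
have cek := @rad_energy_cont k g w cg cw.
apply/eqP; rewrite -subr_eq0 -integB//.
pose F r := mom k g r * (c r / r ^+ k).
have F0 : F 0 = 0 by rewrite /F mom0 mul0r.
rewrite (@integ_ftc _ _ F)//.
- by rewrite F0 /F c1 mul0r mulr0 subrr.
- by ctac.
- move=> r /[dup] r01 /andP[r0 r1]; apply: der_eq.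
    by apply: derM; [exact: mom_der|exact: dc].
  have -> : r ^+ k.+1 * g r * (c r / r ^+ k) = r * g r * c r.
    by rewrite exprS; field; rewrite expf_neq0 ?gt_eqF.
  by rewrite /ek mulNr mulrN mulrA.
- apply: continuous_subspaceT => r; change {for r, continuous F}.
  have [->|r0] := eqVneq r 0; last first.
    rewrite /F; apply: contM; first exact: mom_cont.
    apply: contM; first exact: cc.
    by apply: cvgV; [rewrite expf_neq0|apply: contX; exact: cont_id].
  have [K K0 hK] := mom_bound k cg.
  have [M M0 hM] := @bounded_on c (-1) 1 (ltac:(lra)) cc.
  apply: (@cont_at0 _ (K * M)) => // s s1.
  have [->|s0] := eqVneq s 0; first by rewrite F0 normr0 mulr0.
  have sp : 0 < `|s| by rewrite normr_gt0.
  rewrite /F !normrM normfV normrX mulrA ler_pdivrMr ?exprn_gt0//.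
  apply: le_trans (ler_pM _ _ (hK s s1) (hM s _)) _ => //; first by rewrite -ler_norml.
  rewrite (_ : K * _ * _ = K * M * (`|s| ^+ k.+2)); last by ring.
  rewrite -[leRHS]mulrA -exprS; apply: ler_wpM2l; first exact: mulr_ge0.
  by apply: ler_wiXn2l => //; lia.
Qed.

(** This is [int s (s^k 1_(s <= r) - h)^2 >= 0]. Scaling [h], its discriminant is
    Cauchy-Schwarz for [mom k h r]; taking [h] in a space of dimension two, it
    is Bessel's inequality. *)
Lemma mom_quadratic k h r : continuous h -> 0 <= r <= 1 ->
  0 <= r ^+ (2 * k.+1) / (2 * k.+1)%:R - 2 * mom k h r
       + integ 0 1 (fun s => s * h s ^+ 2).
Proof.
move=> ch /andP[r0 r1].
have cm := @momc k h ch.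
have c2 : continuous (fun s => s * h s ^+ 2) by ctac.
rewrite -(integ_chasles _ 0 r 1).
have -> : r ^+ (2 * k.+1) / (2 * k.+1)%:R = integ 0 r (fun s => s ^+ (2 * k.+1).-1).
  rewrite (@integ_primitive _ _ (fun s => s ^+ (2 * k.+1) / (2 * k.+1)%:R)).
    by rewrite expr0n/= mul0r subr0.
  move=> s; apply: der_eq; [dtac|rewrite mulr1 mulr0 addr0 mulrAC].
  by rewrite divff ?mul1r// pnatr_eq0.
rewrite addrA -integZ// -integB; [|by ctac..].
rewrite -integD; [|by ctac..].
apply: addr_ge0; apply: integ_ge0 => //; [by ctac| |].
  move=> s /andP[s0 _]; rewrite (_ : _ + _ = s * (s ^+ k - h s) ^+ 2).
    by rewrite mulr_ge0 ?sqr_ge0// ltW.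
  rewrite (_ : (2 * k.+1).-1 = (k + k).+1); last by lia.
  by rewrite !exprS exprD; ring.
move=> s /andP[s0 _]; rewrite mulr_ge0 ?sqr_ge0//.
exact: le_trans (ltW s0).
Qed.

Local Notation j := (j11 R).

(** The radial profiles of the eigenspace: [psi r = J_0 (j r)] and
    [phi r = (2 / j) J_1 (j r)]. *)
Definition psi r := bess 0 ((j * r) ^+ 2).
Definition phi r := r * bess 1 ((j * r) ^+ 2).

Lemma j_gt0 : 0 < j. Proof. by case: (@j11P R). Qed.

Lemma j2_gt0 : 0 < j ^+ 2. Proof. by rewrite exprn_gt0// j_gt0. Qed.

Lemma j2_lt16 : j ^+ 2 < 16.
Proof. by have := j_gt0; case: (@j11P R) => _ j4 _ _; nra. Qed.

Lemma phi1 : phi 1 = 0.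
Proof. by rewrite /phi mulr1 mul1r; case: (@j11P R). Qed.

Lemma phi_gt0 r : 0 < r < 1 -> 0 < phi r.
Proof.
move=> /andP[r0 r1]; rewrite mulr_gt0//; case: (@j11P R) => j0 _ _; apply.
by rewrite mulr_ge0 ?(ltW r0) ?(ltW j0)// gtr_pMr.
Qed.

Lemma psi_cont : continuous psi.
Proof.
by move=> r; apply: (@cont_comp _ _ (fun r => (j * r) ^+ 2) (bess 0)); [ctac|exact: bess_cont].
Qed.

Lemma phi_cont : continuous phi.
Proof.
move=> r; rewrite /phi; change {for r, continuous (fun r => r * bess 1 ((j * r) ^+ 2))}.
apply: contM; first exact: cont_id.
by apply: (@cont_comp _ _ (fun r => (j * r) ^+ 2) (bess 1)); [ctac|exact: bess_cont].
Qed.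

Lemma psi_der r : der r psi (- (j ^+ 2 / 2) * phi r).
Proof.
apply: der_eq.
  by apply: der_comp; [exact: bess0_der|dtac].
by rewrite /phi /=; field.
Qed.

Lemma rphi_der r : der r (fun s => s * phi s) (2 * r * psi r).
Proof.
have j0 : j != 0 by rewrite gt_eqF// j_gt0.
apply: (@der_ext _ (fun s => j ^- 2 * ((j * s) ^+ 2 * bess 1 ((j * s) ^+ 2)))).
  by move=> s; rewrite /phi; field.
apply: der_eq.
  apply: derM; first exact: der_cst.
  apply: (@der_comp _ (fun z => z * bess 1 z) (fun s => (j * s) ^+ 2)).
    exact: zbess1_der.
  by dtac.
by rewrite /psi /=; field.
Qed.

Lemma mom_psi r : mom 0 psi r = r * phi r / 2.
Proof.
rewrite /mom (@integ_primitive _ _ (fun s => s * phi s / 2)).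
  by rewrite /phi !mul0r subr0.
move=> s; apply: der_eq; first by apply: derM; [exact: rphi_der|dtac].
by rewrite /=; field.
Qed.

Lemma mom_phi r : mom 1 phi r = 2 / j ^+ 2 * (r * phi r - r ^+ 2 * psi r).
Proof.
have j0 : j != 0 by rewrite gt_eqF// j_gt0.
rewrite /mom (@integ_primitive _ _ (fun s => 2 / j ^+ 2 * (s * phi s - s ^+ 2 * psi s))).
  by rewrite /phi /=; ring.
move=> s; apply: der_eq.
  apply: derM; first exact: der_cst.
  by apply: derB; [exact: rphi_der|apply: derM; [dtac|exact: psi_der]].
by rewrite /=; field.
Qed.

Lemma rad_sol_psi : rad_sol 0 (fun r => (psi r - psi 1) / j ^+ 2) psi.
Proof.
have j0 : j != 0 by rewrite gt_eqF// j_gt0.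
have cpsi := psi_cont; split; [by ctac|by rewrite subrr mul0r|].
move=> r /andP[r0 r1]; apply: (@der_ext _ (fun r => (psi r - psi 1) / j ^+ 2)).
  by move=> s; rewrite expr0 invr1 mulr1.
apply: der_eq; first by apply: derM; [apply: derB; [exact: psi_der|exact: der_cst]|exact: der_cst].
by rewrite mom_psi muln0 expr1 /=; field; rewrite j0 gt_eqF.
Qed.

Lemma rad_sol_phi : rad_sol 1 (fun r => phi r / j ^+ 2) phi.
Proof.
have j0 : j != 0 by rewrite gt_eqF// j_gt0.
have cphi := phi_cont; split; [by ctac|by rewrite phi1 mul0r|].
move=> r /andP[r0 r1]; have rn0 : r != 0 by rewrite gt_eqF.
apply: (@der_near _ (fun s => s * phi s * (j ^+ 2 * s ^+ 2)^-1)).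
  near=> s; have s0 : 0 < s by near: s; exact: lt_nbhsr.
  by rewrite expr1; field; rewrite j0 gt_eqF.
apply: der_eq.
  apply: derM; first exact: rphi_der.
  by apply: derV; [rewrite mulf_neq0 ?expf_neq0|dtac].
by rewrite mom_phi /=; field; rewrite j0 rn0.
Unshelve. all: by end_near. Qed.

Definition phi_norm := integ 0 1 (fun r => r * phi r ^+ 2).
Definition psi_norm := integ 0 1 (fun r => r * psi r ^+ 2).

Lemma phi_norm_gt0 : 0 < phi_norm.
Proof.
have cphi := phi_cont; apply: integ_gt0 => //; first by ctac.
by move=> r /[dup] /phi_gt0 h /andP[r0 _]; rewrite mulr_gt0// exprn_gt0.
Qed.

(** The derivative of [r phi psi] compares the two norms, so that positivity of
    [phi] alone is enough. *)
Lemma psi_norm_gt0 : 0 < psi_norm.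
Proof.
have cphi := phi_cont; have cpsi := psi_cont.
have : integ 0 1 (fun r => 2 * (r * psi r ^+ 2) - j ^+ 2 / 2 * (r * phi r ^+ 2)) = 0.
  rewrite (@integ_primitive _ _ (fun r => r * phi r * psi r)).
    by rewrite phi1 !(mulr0, mul0r) subrr.
  move=> r; apply: der_eq; first by apply: derM; [exact: rphi_der|exact: psi_der].
  by rewrite /=; ring.
rewrite integB ?integZ -?/phi_norm -?/psi_norm; [|by ctac..].
have := mulr_gt0 j2_gt0 phi_norm_gt0; lra.
Qed.

Lemma psi_mean : integ 0 1 (fun r => r * psi r) = 0.
Proof. by have := mom_psi 1; rewrite phi1 mulr0 mul0r /mom; under eq_fun do rewrite expr1. Qed.

(** Integrated by parts, the moment is minus an integral of the positive function
    [phi]. Being nonzero, it lets the second moment of the vorticity determine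
    the coefficient of [psi]. *)
Lemma psi_moment : integ 0 1 (fun r => r ^+ 3 * psi r) < 0.
Proof.
have cphi := phi_cont; have cpsi := psi_cont.
have : integ 0 1 (fun r => r ^+ 3 * psi r + r ^+ 2 * phi r) = 0.
  rewrite (@integ_primitive _ _ (fun r => r ^+ 2 * (r * phi r) / 2)).
    by rewrite phi1 !(mulr0, mul0r) subrr.
  move=> r; apply: der_eq.
    by apply: derM; [apply: derM; [dtac|exact: rphi_der]|exact: der_cst].
  by rewrite /=; field.
rewrite integD; [|by ctac..].
have : 0 < integ 0 1 (fun r => r ^+ 2 * phi r).
  apply: integ_gt0 => //; first by ctac.
  by move=> r /[dup] /phi_gt0 h /andP[r0 _]; rewrite mulr_gt0// exprn_gt0.
by lra.
Qed.

Lemma energy_phi g : continuous g ->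
  rad_energy 1 g phi = integ 0 1 (fun r => r * g r * phi r) / j ^+ 2.
Proof.
move=> cg; have cphi := phi_cont.
rewrite -(rad_sol_energy rad_sol_phi)// [RHS]mulrC -integZ; last by ctac.
by congr (integ _ _ _); apply/funext => r; ring.
Qed.

(** [(psi - psi 1) / j ^ 2] is the stream function of [psi]; the constant [psi 1]
    is invisible to [g] of mean zero. *)
Lemma energy_psi g : continuous g -> integ 0 1 (fun r => r * g r) = 0 ->
  rad_energy 0 g psi = integ 0 1 (fun r => r * g r * psi r) / j ^+ 2.
Proof.
move=> cg g0; have cpsi := psi_cont.
rewrite -(rad_sol_energy rad_sol_psi)//.
transitivity (integ 0 1 (fun r => (j ^+ 2)^-1 * (r * g r * psi r) - psi 1 / j ^+ 2 * (r * g r))).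
  by congr (integ _ _ _); apply/funext => r; ring.
rewrite integB ?integZ; [|by ctac..].
by rewrite g0 mulr0 subr0 mulrC.
Qed.

Definition gap : R := 8^-1 - (j ^+ 2)^-1.

(** The trace of the radial inverse Laplacian on mode 1 is [1/8] and its top
    eigenvalue is [1 / j ^ 2], with eigenfunction [phi], so [1/8 - 1 / j ^ 2]
    bounds what remains. Concretely: Bessel's inequality bounds [mom 1 g r] for
    each [r], and the bound is integrated in [r]. *)
Lemma gap_mode1 g : continuous g -> integ 0 1 (fun r => r * g r * phi r) = 0 ->
  rad_energy 1 g g <= gap * integ 0 1 (fun r => r * g r ^+ 2).
Proof.
move=> cg g0; have cphi := phi_cont.
have N0 := phi_norm_gt0; set N := phi_norm in N0.
set G := integ 0 1 (fun r => r * g r ^+ 2).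
have G0 : 0 <= G.
  apply: integ_ge0 => //; first by ctac.
  by move=> r /andP[r0 _]; rewrite mulr_ge0 ?sqr_ge0// ltW.
have key r : 0 <= r <= 1 ->
    mom 1 g r ^+ 2 <= (r ^+ 4 / 4 - mom 1 phi r ^+ 2 / N) * G.
  move=> r01; apply: discriminant_le => // s.
  set c := mom 1 phi r / N.
  pose h t := c * phi t + s * g t.
  have := @mom_quadratic 1 h r (ltac:(rewrite /h; ctac)) r01.
  have -> : mom 1 h r = c * mom 1 phi r + s * mom 1 g r.
    by rewrite (@mom_lin 1 (fun t => c * phi t) g s r) ?momZ//; ctac.
  have -> : integ 0 1 (fun t => t * h t ^+ 2) = c ^+ 2 * N + s ^+ 2 * G.
    transitivity (c ^+ 2 * N + s ^+ 2 * G + 2 * c * s * integ 0 1 (fun r => r * g r * phi r)).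
      rewrite -!integZ -?integD; [|by ctac..].
      by congr (integ _ _ _); apply/funext => t; rewrite /h; ring.
    by rewrite g0 mulr0 addr0.
  by rewrite /c; congr (0 <= _); rewrite !mulrnA ?mulr1n; field; rewrite gt_eqF.
have -> : gap = 8^-1 - rad_energy 1 phi phi / N.
  rewrite energy_phi// (_ : integ _ _ _ = N) ?mulfV; first by rewrite mulrAC mulfV ?mul1r// gt_eqF.
  by congr (integ _ _ _); apply/funext => t; ring.
have cE := @rad_energy_cont 1 phi phi cphi cphi.
have -> : (8^-1 - rad_energy 1 phi phi / N) * G =
    integ 0 1 (fun r => G / 4 * r - G / N * ek 1 phi phi r).
  rewrite integB ?integZ; [|by ctac..].
  rewrite (@integ_primitive _ (fun x => x) (fun x => x ^+ 2 / 2)).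
    by rewrite -/(rad_energy 1 phi phi) expr0n /=; field; rewrite gt_eqF.
  by move=> x; apply: der_eq; [dtac|rewrite /=; field].
apply: integ_le => //; first exact: rad_energy_cont.
  by ctac.
move=> r /andP[r0 r1]; have h : _ := key r (ltac:(by rewrite !ltW)).
rewrite /ek -!expr2 ler_pdivrMr ?exprn_gt0//.
apply: (le_trans h); rewrite le_eqVlt; apply/orP; left; apply/eqP.
by field; rewrite !gt_eqF.
Qed.

(** As for [gap_mode1], on functions of mean zero, where trace and top eigenvalue
    are the same; [r ^ 2] in the test function is the projection of the
    indicator of [[0, r]] to the constants. *)
Lemma gap_mode0 g : continuous g -> integ 0 1 (fun r => r * g r) = 0 ->
  integ 0 1 (fun r => r * g r * psi r) = 0 ->
  rad_energy 0 g g <= gap * integ 0 1 (fun r => r * g r ^+ 2).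
Proof.
move=> cg gm g0; have cpsi := psi_cont.
have N0 := psi_norm_gt0; set N := psi_norm in N0.
set G := integ 0 1 (fun r => r * g r ^+ 2).
have G0 : 0 <= G.
  apply: integ_ge0 => //; first by ctac.
  by move=> r /andP[r0 _]; rewrite mulr_ge0 ?sqr_ge0// ltW.
have i1 : integ 0 1 (fun x : R => x) = 1 / 2.
  rewrite (@integ_primitive _ (fun x => x) (fun x => x ^+ 2 / 2)).
    by rewrite expr0n /=; field.
  by move=> x; apply: der_eq; [dtac|rewrite /=; field].
have key r : 0 <= r <= 1 ->
    mom 0 g r ^+ 2 <= (r ^+ 2 / 2 - r ^+ 4 / 2 - mom 0 psi r ^+ 2 / N) * G.
  move=> r01; apply: discriminant_le => // s.
  set c := r ^+ 2; set d := mom 0 psi r / N.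
  pose h t := (c + d * psi t) + s * g t.
  have ch : continuous h by rewrite /h; ctac.
  have := @mom_quadratic 0 h r ch r01.
  have -> : mom 0 h r = c * (r ^+ 2 / 2) + d * mom 0 psi r + s * mom 0 g r.
    rewrite (@mom_lin 0 (fun t => c + d * psi t) g s r) //; [|by ctac].
    rewrite (@mom_lin 0 (fun t => c) psi d r)//; [|by ctac].
    congr (_ + _ + _); rewrite /mom (@integ_primitive _ _ (fun x => c * (x ^+ 2 / 2))).
      by rewrite expr0n /=; field.
    by move=> x; apply: der_eq; [dtac|rewrite /=; field].
  have -> : integ 0 1 (fun t => t * h t ^+ 2) = c ^+ 2 * (1 / 2) + d ^+ 2 * N + s ^+ 2 * G.
    transitivity (c ^+ 2 * integ 0 1 (fun r => r) + d ^+ 2 * N + s ^+ 2 * G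
      + 2 * c * s * integ 0 1 (fun r => r * g r)
      + 2 * d * s * integ 0 1 (fun r => r * g r * psi r)
      + 2 * c * d * integ 0 1 (fun r => r * psi r)).
      rewrite -!integZ -?integD; [|by ctac..].
      by congr (integ _ _ _); apply/funext => t; rewrite /h; ring.
    by rewrite i1 gm g0 psi_mean !mulr0 !addr0.
  by rewrite /d /c; congr (0 <= _); rewrite ?mulr1n; field; rewrite gt_eqF.
have -> : gap = 8^-1 - rad_energy 0 psi psi / N.
  rewrite energy_psi ?psi_mean// (_ : integ _ _ _ = N) ?mulfV; first by rewrite mulrAC mulfV ?mul1r// gt_eqF.
  by congr (integ _ _ _); apply/funext => t; ring.
have cE := @rad_energy_cont 0 psi psi cpsi cpsi.
have -> : (8^-1 - rad_energy 0 psi psi / N) * G =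
    integ 0 1 (fun r => G / 2 * (r - r ^+ 3) - G / N * ek 0 psi psi r).
  rewrite integB ?integZ; [|by ctac..].
  rewrite (@integ_primitive _ (fun x => x - x ^+ 3) (fun x => x ^+ 2 / 2 - x ^+ 4 / 4)).
    by rewrite -/(rad_energy 0 psi psi) !expr0n /=; field; rewrite gt_eqF.
  by move=> x; apply: der_eq; [dtac|rewrite /=; field].
apply: integ_le => //; first exact: rad_energy_cont.
  by ctac.
move=> r /andP[r0 r1]; have h : _ := key r (ltac:(by rewrite !ltW)).
rewrite /ek muln0 expr1 -!expr2 ler_pdivrMr//.
apply: (le_trans h); rewrite le_eqVlt; apply/orP; left; apply/eqP.
by field; rewrite !gt_eqF.
Qed.

End radial.

(** * The Dirichlet problem in polar coordinates *)

(** Derivatives are carried as functions, so that a linear operation such as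
    removing a Fourier mode acts on all of them by an explicit formula. *)
Record polar_jet (R : realType) :=
  PolarJet { jv : R -> R -> R; jr : R -> R -> R; jrr : R -> R -> R;
             jt : R -> R -> R; jtt : R -> R -> R }.

Definition cont2_at {R : realType} (f : R -> R -> R) (r t : R) :=
  {for (r, t), continuous (fun p : R * R => f p.1 p.2)}.

Definition cont2 {R : realType} (f : R -> R -> R) :=
  continuous (fun p : R * R => f p.1 p.2).

Ltac cintro2 p :=
  lazymatch goal with |- cont2 ?f =>
    intro p; change {for p, continuous (fun p => f p.1 p.2)}; cbv beta end.

(** The Dirichlet problem [- laplacian u = w], multiplied by [r ^ 2]. The strip
    [-1 < r < 1] has the centre [r = 0] in its interior, so that one may
    differentiate there; [ps_center] says that it is a single point of the disk.
    Near the circle nothing is known of the derivatives, and [ps_bound] is the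
    substitute. *)
Record polar_sol (R : realType) (u : polar_jet R) (w : R -> R -> R) : Prop := PolarSol {
  ps_cont : cont2 (jv u);
  ps_contw : cont2 w;
  ps_r : forall r t, -1 < r < 1 -> der r (jv u ^~ t) (jr u r t);
  ps_rr : forall r t, -1 < r < 1 -> der r (jr u ^~ t) (jrr u r t);
  ps_t : forall r t, -1 < r < 1 -> der t (jv u r) (jt u r t);
  ps_tt : forall r t, -1 < r < 1 -> der t (jt u r) (jtt u r t);
  ps_cr : forall r t, -1 < r < 1 -> cont2_at (jr u) r t;
  ps_crr : forall r t, -1 < r < 1 -> cont2_at (jrr u) r t;
  ps_ct : forall r t, -1 < r < 1 -> cont2_at (jt u) r t;
  ps_ctt : forall r t, -1 < r < 1 -> cont2_at (jtt u) r t;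
  ps_per : forall r, per2pi (jv u r);
  ps_perw : forall r, per2pi (w r);
  ps_eq : forall r t, -1 < r < 1 ->
    r ^+ 2 * jrr u r t + r * jr u r t + jtt u r t = - r ^+ 2 * w r t;
  ps_bound : exists2 M, 0 <= M & forall r t, 0 <= r <= 1 -> `|jv u r t| <= M * (1 - r);
  ps_center : forall t, jv u 0 t = jv u 0 0 }.

Arguments ps_cont {R u w} _.
Arguments ps_contw {R u w} _.
Arguments ps_cr {R u w} _ {r} t _.
Arguments ps_crr {R u w} _ {r} t _.
Arguments ps_ct {R u w} _ {r} t _.
Arguments ps_ctt {R u w} _ {r} t _.

Section polar.
Context {R : realType}.
Implicit Types (u : polar_jet R) (w f g : R -> R -> R) (r t : R).

Lemma cont2_slice f r : (forall t, cont2_at f r t) -> continuous (f r).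
Proof.
move=> cf t; change {for t, continuous (fun t => f r t)}.
by apply: (@cont_pair _ _ _ _ f (fun=> r) id); [exact: cf|ctac..].
Qed.

Lemma cont2_at_of f r t : cont2 f -> cont2_at f r t.
Proof. by move=> cf; exact: (cf (r, t)). Qed.

Arguments cont2_at_of {f} r t _.

Lemma near_strip r : -1 < r < 1 -> \forall s \near r, -1 < s < 1.
Proof.
move=> /andP[r0 r1]; near=> s.
by apply/andP; split; near: s; [exact: lt_nbhsr|exact: lt_nbhsl].
Unshelve. all: by end_near. Qed.

Lemma oint_der_param f f' r : -1 < r < 1 ->
  (forall s, -1 < s < 1 -> forall t, der s (f ^~ t) (f' s t)) ->
  (forall s, -1 < s < 1 -> forall t, cont2_at f s t) ->
  (forall s, -1 < s < 1 -> forall t, cont2_at f' s t) ->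
  der r (fun s => oint (f s)) (oint (f' r)).
Proof.
move=> r1 df cf cf'; apply: integ_param_der; first exact/ltW/twopi_gt0.
- by near=> s => t; apply: df; near: s; exact: near_strip.
- by near=> s; apply: cont2_slice => t; apply: cf; near: s; exact: near_strip.
- by apply: cont2_slice => t; exact: cf'.
- by move=> t _; exact: cf'.
Unshelve. all: by end_near. Qed.

Lemma oint_cont f : cont2 f -> continuous (fun r => oint (f r)).
Proof. by move=> cf; exact: integ_param_continuous. Qed.

Lemma oint_cont_at f r : -1 < r < 1 ->
  (forall s, -1 < s < 1 -> forall t, cont2_at f s t) ->
  {for r, continuous (fun r => oint (f r))}.
Proof.
move=> r1 cf; apply: integ_param_cont; first exact/ltW/twopi_gt0.
- by move=> t _; exact: cf.
- by near=> s; apply: cont2_slice => t; apply: cf; near: s; exact: near_strip.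
Unshelve. all: by end_near. Qed.

Lemma strip_pos r : 0 < r < 1 -> -1 < r < 1.
Proof. by move=> /andP[r0 ->]; rewrite andbT; apply: lt_trans r0; rewrite oppr_lt0. Qed.

(** The boundary argument of both [polar_symmetry] and [rest_energy], applied to
    circle averages of squares of solutions. *)
Lemma no_increase (y y' : R -> R) r0 : r0 < 1 -> continuous y -> y 1 = 0 ->
  (forall r, r0 < r < 1 -> 0 <= y r) ->
  (forall r, r0 < r < 1 -> der r y (y' r)) ->
  (forall r, r0 < r < 1 -> 0 < y' r) -> False.
Proof.
move=> r01 cy y1 y0 dy y'0; pose s := (r0 + 1) / 2.
have s01 : r0 < s < 1 by rewrite /s; lra.
have [|c|/=|c cs e] := @MVT R y y' s 1.
- by case/andP: s01.
- by rewrite in_itv/= => /andP[c1 c2]; apply: dy; rewrite c2 andbT; lra.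
- exact: continuous_subspaceT.
move: cs; rewrite in_itv/= => /andP[c1 c2].
have := y0 s s01; have : 0 < y' c by apply: y'0; rewrite c2 andbT; lra.
by move=> h1 h2; move: e; rewrite y1; nra.
Qed.

Section one_solution.
Variables (u : polar_jet R) (w : R -> R -> R).
Hypothesis uw : polar_sol u w.

Let cu r t : cont2_at (jv u) r t := cont2_at_of r t (ps_cont uw).
Let cw r t : cont2_at w r t := cont2_at_of r t (ps_contw uw).
Arguments cu : clear implicits.
Arguments cw : clear implicits.

Lemma ps_cont_slice r : continuous (jv u r).
Proof. exact: cont2_slice (cu r). Qed.
Lemma ps_contw_slice r : continuous (w r).
Proof. exact: cont2_slice (cw r). Qed.
Lemma ps_cr_slice r : -1 < r < 1 -> continuous (jr u r).
Proof. by move=> r1; apply: cont2_slice => t; exact: (ps_cr uw t r1). Qed.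
Lemma ps_crr_slice r : -1 < r < 1 -> continuous (jrr u r).
Proof. by move=> r1; apply: cont2_slice => t; exact: (ps_crr uw t r1). Qed.
Lemma ps_ct_slice r : -1 < r < 1 -> continuous (jt u r).
Proof. by move=> r1; apply: cont2_slice => t; exact: (ps_ct uw t r1). Qed.
Lemma ps_ctt_slice r : -1 < r < 1 -> continuous (jtt u r).
Proof. by move=> r1; apply: cont2_slice => t; exact: (ps_ctt uw t r1). Qed.

Lemma ps_pert r : -1 < r < 1 -> per2pi (jt u r).
Proof.
move=> r1; apply: (@der_periodic _ (jv u r)); last exact: ps_per uw r.
by move=> t; exact: (ps_t uw).
Qed.

Lemma ps_one t : jv u 1 t = 0.
Proof.
have [M M0 h] := ps_bound uw; apply/eqP; rewrite -normr_le0.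
by apply: le_trans (h 1 t _) _; rewrite ?subrr ?mulr0// ler01 lexx.
Qed.

Definition circ2 r := oint (fun t => jv u r t ^+ 2).
Definition flux2 r := r * oint (fun t => jv u r t * jr u r t).

Lemma circ2_cont : continuous circ2.
Proof.
apply: (@oint_cont (fun r t => jv u r t ^+ 2)) => p.
have h := ps_cont uw p.
change {for p, continuous (fun p : R * R => jv u p.1 p.2 ^+ 2)}.
by ctac.
Qed.

Lemma circ2_ge0 r : 0 <= circ2 r.
Proof. by have h := ps_cont_slice (r := r); apply: oint_ge0 => [|t]; [ctac|exact: sqr_ge0]. Qed.

Lemma circ2_1 : circ2 1 = 0.
Proof.
rewrite /circ2 (_ : (fun t => _) = fun=> 0); first by rewrite oint_cst mulr0.
by apply/funext => t; rewrite ps_one expr0n.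
Qed.

Lemma circ2_der r : 0 < r < 1 -> der r circ2 (2 * flux2 r / r).
Proof.
move=> r01; have r1 := strip_pos r01; have rn0 : r != 0 by case/andP: r01 => ? _; rewrite gt_eqF.
apply: der_eq.
  apply: (@oint_der_param _ (fun r t => 2 * (jv u r t * jr u r t))) => // s s1 t.
  - apply: der_eq; first by apply: derX; exact: (ps_r uw).
    by rewrite /= expr1; ring.
  - have h := cu s t; rewrite /cont2_at; by ctac.
  - have h := cu s t; have h2 := ps_cr uw t s1; rewrite /cont2_at in h2 *; by ctac.
have h := @ps_cont_slice r; have h2 := ps_cr_slice r1.
by rewrite ointZ /flux2; [field|ctac].
Qed.

Lemma flux2_0 : flux2 0 = 0. Proof. exact: mul0r. Qed.

Lemma flux2_cont r : -1 < r < 1 -> {for r, continuous flux2}.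
Proof.
move=> r1; apply: contM; first exact: cont_id.
apply: (@oint_cont_at (fun r t => jv u r t * jr u r t)) => // s s1 t.
have h := cu s t; have h2 := ps_cr uw t s1; rewrite /cont2_at in h2 *; by ctac.
Qed.

Lemma flux2_der r : 0 < r < 1 -> der r flux2
  (r * oint (fun t => jr u r t ^+ 2) + r^-1 * oint (fun t => jt u r t ^+ 2)
   - r * oint (fun t => jv u r t * w r t)).
Proof.
move=> r01; have r1 := strip_pos r01; have rn0 : r != 0 by case/andP: r01 => ? _; rewrite gt_eqF.
have c0 := @ps_cont_slice r; have c1 := ps_cr_slice r1; have c2 := ps_crr_slice r1.
have c3 := ps_ct_slice r1; have c4 := ps_ctt_slice r1; have c5 := @ps_contw_slice r.
apply: der_eq.
  apply: derM; first exact: der_id.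
  apply: (@oint_der_param _ (fun r t => jr u r t ^+ 2 + jv u r t * jrr u r t)) => // s s1 t.
  - apply: der_eq; first by apply: derM; [exact: (ps_r uw)|exact: (ps_rr uw)].
    by rewrite /=; ring.
  - have h := cu s t; have h2 := ps_cr uw t s1; rewrite /cont2_at in h2 *; by ctac.
  - have h := cu s t; have h2 := ps_cr uw t s1; have h3 := ps_crr uw t s1.
    by rewrite /cont2_at in h2 h3 *; ctac.
have parts : oint (fun t => jt u r t ^+ 2) = - oint (fun t => jv u r t * jtt u r t).
  rewrite -(@oint_parts _ (jv u r) (jt u r) (jt u r))//.
  - by move=> t; exact: (ps_t uw).
  - by move=> t; exact: (ps_tt uw).
  - exact: ps_per uw r.
  - exact: ps_pert.
rewrite parts /= mul1r.
have e : oint (fun t => jv u r t * jtt u r t) =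
   - r ^+ 2 * oint (fun t => jv u r t * w r t) - r ^+ 2 * oint (fun t => jv u r t * jrr u r t)
   - r * oint (fun t => jv u r t * jr u r t).
  rewrite -!ointZ -?ointB; [|by ctac..].
  congr oint; apply/funext => t.
  have := ps_eq uw t r1 => h.
  rewrite (_ : jtt u r t = - r ^+ 2 * w r t - r ^+ 2 * jrr u r t - r * jr u r t); first by ring.
  by rewrite -h; ring.
rewrite e ointD; [|by ctac..].
by field.
Qed.

End one_solution.

Lemma ln_blowup (c L : R) : 0 < c -> exists2 r1, r1 < 1 & forall r, r1 < r < 1 -> L < - c * ln (1 - r).
Proof.
move=> c0; exists (1 - expR (- (L + 1) / c)); first by rewrite ltrBlDr ltrDl expR_gt0.
move=> r /andP[h1 h2].
have h3 : 0 < 1 - r by lra.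
have : ln (1 - r) < - (L + 1) / c.
  by rewrite -[ltRHS]expRK ltr_ln ?posrE ?expR_gt0//; lra.
rewrite ltr_pdivlMr// => h; nra.
Qed.

(** Green's second identity: the boundary term [a] has a limit at [r = 1]. As
    both solutions vanish to first order there, a nonzero limit would force the
    circle averages of the squared radial derivatives to grow like
    [1 / (1 - r)], and then the circle averages of the squared solutions to
    increase near 1. *)
Lemma polar_symmetry (u1 u2 : polar_jet R) w1 w2 : polar_sol u1 w1 -> polar_sol u2 w2 ->
  integ 0 1 (fun r => r * oint (fun t => w1 r t * jv u2 r t - w2 r t * jv u1 r t)) = 0.
Proof.
move=> P1 P2.
pose D r := r * oint (fun t => w1 r t * jv u2 r t - w2 r t * jv u1 r t).
have cD : continuous D.
  cintro r; apply: contM; first exact: cont_id.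
  apply: (@oint_cont (fun r t => w1 r t * jv u2 r t - w2 r t * jv u1 r t)) => p.
  have h1 := ps_cont P1 p; have h2 := ps_cont P2 p.
  have h3 := ps_contw P1 p; have h4 := ps_contw P2 p.
  change {for p, continuous (fun p : R * R => w1 p.1 p.2 * jv u2 p.1 p.2 - w2 p.1 p.2 * jv u1 p.1 p.2)}.
  by ctac.
pose a r := r * oint (fun t => jv u1 r t * jr u2 r t - jv u2 r t * jr u1 r t).
have ca s t : -1 < s < 1 ->
    cont2_at (fun r t => jv u1 r t * jr u2 r t - jv u2 r t * jr u1 r t) s t.
  move=> s1; have h1 := cont2_at_of s t (ps_cont P1); have h2 := cont2_at_of s t (ps_cont P2).
  have h3 := ps_cr P1 t s1; have h4 := ps_cr P2 t s1.
  by rewrite /cont2_at in h1 h2 h3 h4 *; ctac.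
have da r : 0 < r < 1 -> der r a (D r).
  move=> r01; have r1 := strip_pos r01; have rn0 : r != 0 by case/andP: r01 => ? _; rewrite gt_eqF.
  have c0 := @ps_cont_slice _ _ P1 r; have c1 := ps_cr_slice P1 r1; have c2 := ps_crr_slice P1 r1.
  have c3 := ps_ct_slice P1 r1; have c4 := ps_ctt_slice P1 r1; have c5 := @ps_contw_slice _ _ P1 r.
  have d0 := @ps_cont_slice _ _ P2 r; have d1 := ps_cr_slice P2 r1; have d2 := ps_crr_slice P2 r1.
  have d3 := ps_ct_slice P2 r1; have d4 := ps_ctt_slice P2 r1; have d5 := @ps_contw_slice _ _ P2 r.
  apply: der_eq.
    apply: derM; first exact: der_id.
    apply: (@oint_der_param _ (fun r t => jv u1 r t * jrr u2 r t - jv u2 r t * jrr u1 r t)) => // [s s1 t|s s1 t|s s1 t].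
    - apply: der_eq.
        by apply: derB; apply: derM; [exact: (ps_r P1)|exact: (ps_rr P2)|exact: (ps_r P2)|exact: (ps_rr P1)].
      by rewrite /=; ring.
    - exact: ca.
    - have h1 := cont2_at_of s t (ps_cont P1); have h2 := cont2_at_of s t (ps_cont P2).
      have h3 := ps_crr P1 t s1; have h4 := ps_crr P2 t s1.
      by rewrite /cont2_at in h1 h2 h3 h4 *; ctac.
  have parts (v1 v2 : polar_jet R) z1 z2 : polar_sol v1 z1 -> polar_sol v2 z2 ->
      oint (fun t => jv v1 r t * jtt v2 r t) = - oint (fun t => jt v1 r t * jt v2 r t).
    move=> V1 V2; rewrite (@oint_parts _ (jv v1 r) (jt v1 r) (jt v2 r) (jtt v2 r)) ?opprK//.
    - by move=> t; exact: (ps_t V1).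
    - by move=> t; exact: (ps_tt V2).
    - exact: (ps_ct_slice V1).
    - exact: (ps_ctt_slice V2).
    - exact: ps_per V1 r.
    - exact: (ps_pert V2).
  have e0 : oint (fun t => jv u1 r t * jtt u2 r t - jv u2 r t * jtt u1 r t) = 0.
    rewrite ointB; [|by ctac..].
    rewrite (parts _ _ _ _ P1 P2) (parts _ _ _ _ P2 P1).
    rewrite (_ : (fun t => jt u2 r t * jt u1 r t) = (fun t => jt u1 r t * jt u2 r t)) ?subrr//.
    by apply/funext => t; rewrite mulrC.
  apply: (mulfI rn0); rewrite /D mul1r /= mulrDr mulrA -!expr2.
  rewrite -[LHS]addr0 -e0 -!ointZ -?ointD; [|by ctac..].
  congr oint; apply/funext => t.
  have h1 := ps_eq P1 t r1; have h2 := ps_eq P2 t r1.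
  transitivity (jv u1 r t * (r ^+ 2 * jrr u2 r t + r * jr u2 r t + jtt u2 r t)
    - jv u2 r t * (r ^+ 2 * jrr u1 r t + r * jr u1 r t + jtt u1 r t)); first by ring.
  by rewrite h1 h2; ring.
have aE r : 0 <= r < 1 -> a r = integ 0 r D.
  move=> /andP[r0 r1]; rewrite (@integ_ftc _ _ a)//.
  - by rewrite [X in _ - X](_ : _ = 0) ?subr0//; exact: mul0r.
  - by move=> s /andP[s0 sr]; apply: da; rewrite s0 (lt_trans sr).
  - apply: continuous_in_subspaceT => s; rewrite inE/= in_itv/= => /andP[s0 sr].
    change {for s, continuous (fun r => r * oint (fun t => jv u1 r t * jr u2 r t - jv u2 r t * jr u1 r t))}.
    apply: contM; first exact: cont_id.
    apply: (oint_cont_at (f := fun r t => jv u1 r t * jr u2 r t - jv u2 r t * jr u1 r t)).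
      by rewrite (le_lt_trans sr r1) andbT (lt_le_trans _ s0)// oppr_lt0.
    by move=> ? ? ?; exact: ca.
apply/eqP/contraT => l0; exfalso.
pose l := `|integ 0 1 D|; have lp : 0 < l by rewrite normr_gt0.
have [M1 M10 hM1] := ps_bound P1; have [M2 M20 hM2] := ps_bound P2.
pose M := M1 + M2 + 1; have Mp : 0 < M by rewrite /M; lra.
have [r0 r01 hr0] : exists2 r0, 1 / 2 <= r0 < 1 & forall r, r0 < r < 1 -> l / 2 <= `|a r|.
  have : {for 1, continuous (fun r => `|integ 0 r D|)}.
    have ci := @integ_cont _ D 0 cD; by ctac.
  move=> /cvgrPdist_lt/(_ (l / 2) (ltac:(lra))) [d /= d0 hd].
  exists (Num.max (1 / 2) (1 - d)); first by rewrite le_max lexx gt_max; lra.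
  move=> r; rewrite gt_max => /andP[/andP[h1 h2] h3].
  rewrite aE; last by lra.
  have := hd r; rewrite /= ger0_norm; last by lra.
  move=> /(_ (ltac:(lra))); rewrite -/l => h.
  have := ler_norm (l - `|integ 0 r D|); lra.
pose X r := oint (fun t => jr u1 r t ^+ 2) + oint (fun t => jr u2 r t ^+ 2).
have hX r : r0 < r < 1 -> l / M / (1 - r) - 4 * pi <= X r.
  move=> /[dup] rr0 /andP[h1 h2]; have rr : 0 < r < 1 by lra.
  have r1 := strip_pos rr.
  have c0 := @ps_cont_slice _ _ P1 r; have c1 := ps_cr_slice P1 r1.
  have d0 := @ps_cont_slice _ _ P2 r; have d1 := ps_cr_slice P2 r1.
  have : `|a r| <= M * (1 - r) * (X r / 2 + 2 * pi).
    rewrite /a normrM gtr0_norm; last by lra.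
    have X0 : 0 <= X r by apply: addr_ge0; apply: oint_ge0 => [|t]; [ctac|exact: sqr_ge0|ctac|exact: sqr_ge0].
    have bp : 0 <= M * (1 - r) * (X r / 2 + 2 * pi).
      have p0 := @pi_ge0 R; apply: mulr_ge0; last by lra.
      by apply: mulr_ge0; lra.
    rewrite -[leRHS]mul1r; apply: ler_pM => //; [by lra|by lra|].
    have -> : M * (1 - r) * (X r / 2 + 2 * pi) =
        oint (fun t => M * (1 - r) * ((jr u1 r t ^+ 2 + jr u2 r t ^+ 2) / 2 + 1)).
      rewrite ointZ; last by ctac.
      rewrite ointD; [|by ctac..].
      rewrite oint_cst mulr1; congr (_ * (_ + _)).
      rewrite (_ : (fun t => _ / 2) = (fun t => 2^-1 * (jr u1 r t ^+ 2 + jr u2 r t ^+ 2))).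
        by rewrite ointZ ?ointD; [rewrite mulrC|by ctac..].
      by apply/funext => t; rewrite mulrC.
    set F := fun t => _; set G := fun t => M * _ * _.
    have cF : continuous F by rewrite /F; ctac.
    have cG : continuous G by rewrite /G; ctac.
    have FG t : `|F t| <= G t.
      rewrite /F /G; apply: le_trans (ler_normB _ _) _; rewrite !normrM.
      have b1 := hM1 r t (ltac:(lra)); have b2 := hM2 r t (ltac:(lra)).
      have s1 : `|jr u2 r t| <= (jr u2 r t ^+ 2 + 1) / 2.
        by rewrite -[jr u2 r t ^+ 2]real_normK ?num_real//; have := sqr_ge0 (`|jr u2 r t| - 1); nra.
      have s2 : `|jr u1 r t| <= (jr u1 r t ^+ 2 + 1) / 2.
        by rewrite -[jr u1 r t ^+ 2]real_normK ?num_real//; have := sqr_ge0 (`|jr u1 r t| - 1); nra.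
      have e1 : `|jv u1 r t| <= M * (1 - r).
        by apply: le_trans b1 _; apply: ler_wpM2r; rewrite /M; lra.
      have e2 : `|jv u2 r t| <= M * (1 - r).
        by apply: le_trans b2 _; apply: ler_wpM2r; rewrite /M; lra.
      apply: le_trans (lerD (ler_pM _ _ e1 s1) (ler_pM _ _ e2 s2)) _ => //.
      by rewrite -mulrDr; apply: ler_wpM2l; [rewrite mulr_ge0; lra|lra].
    rewrite ler_norml -ointN//; apply/andP; split; apply: oint_le => //; [by ctac| |].
      by move=> t; have := FG t; rewrite ler_norml => /andP[].
    by move=> t; have := FG t; rewrite ler_norml => /andP[].
  move/(le_trans (hr0 r rr0)) => h; rewrite -mulrA -invfM mulrC.
  rewrite lerBlDr -ler_pdivlMl ?invr_gt0 ?mulr_gt0 ?invrK; [|lra..].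
  by nra.
pose y r := circ2 u1 r + circ2 u2 r.
pose v r := flux2 u1 r + flux2 u2 r.
pose W r := oint (fun t => jv u1 r t * w1 r t) + oint (fun t => jv u2 r t * w2 r t).
have cW : continuous W.
  have cW1 (v1 : polar_jet R) z : polar_sol v1 z -> continuous (fun r => oint (fun t => jv v1 r t * z r t)).
    move=> V; apply: (@oint_cont (fun r t => jv v1 r t * z r t)) => p.
    have h1 := ps_cont V p; have h2 := ps_contw V p.
    change {for p, continuous (fun p : R * R => jv v1 p.1 p.2 * z p.1 p.2)}.
    by ctac.
  have h1 := cW1 _ _ P1; have h2 := cW1 _ _ P2; by rewrite /W; ctac.
have [K K0 hK] := bounded_on (ltac:(lra) : (0:R) <= 1) cW.
pose c := l / (2 * M); have cp : 0 < c by rewrite divr_gt0 ?mulr_gt0.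
pose C := 4 * pi + K.
have pi0 := @pi_gt0 R.
pose N r := v r + c * ln (1 - r) + C * r.
pose v' r := r * X r + r^-1 * (oint (fun t => jt u1 r t ^+ 2) + oint (fun t => jt u2 r t ^+ 2)) - r * W r.
have dv r : 0 < r < 1 -> der r v (v' r).
  move=> rr; apply: der_eq; first by apply: derD; [exact: flux2_der P1 _ rr|exact: flux2_der P2 _ rr].
  by rewrite /v' /X /W; ring.
have dN r : 0 < r < 1 -> der r N (v' r + c * (- (1 - r)^-1) + C).
  move=> rr; apply: der_eq.
    apply: derD; last by dtac.
    apply: derD; first exact: dv.
    apply: derM; first exact: der_cst.
    apply: der_comp; last by dtac.
    by apply: is_derive1_ln; lra.
  by rewrite /=; ring.
have v'_ge r : r0 < r < 1 -> c / (1 - r) - C <= v' r.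
  move=> rr0; have rr : 0 < r < 1 by lra.
  have r1 := strip_pos rr.
  have c3 := ps_ct_slice P1 r1; have d3 := ps_ct_slice P2 r1.
  have T0 : 0 <= oint (fun t => jt u1 r t ^+ 2) + oint (fun t => jt u2 r t ^+ 2).
    by apply: addr_ge0; apply: oint_ge0 => [|t]; [ctac|exact: sqr_ge0|ctac|exact: sqr_ge0].
  have T1 : 0 <= r^-1 * (oint (fun t => jt u1 r t ^+ 2) + oint (fun t => jt u2 r t ^+ 2)).
    by rewrite mulr_ge0 ?invr_ge0//; lra.
  have WK : `|W r| <= K by apply: hK; lra.
  have rW : r * W r <= K.
    have := ler_norm (W r); have := normr_ge0 (W r); nra.
  have hXr := hX r rr0.
  have e : l / M / (1 - r) = 2 * (c / (1 - r)).
    by rewrite /c; field; rewrite !gt_eqF//; lra.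
  rewrite e in hXr.
  have q0 : 0 <= c / (1 - r) by rewrite divr_ge0; lra.
  rewrite /v' /C; nra.
(* The flux [v] grows like [- c ln (1 - r)], hence becomes positive. *)
have [r1 r11 hr1] : exists2 r1, r1 < 1 & forall r, r1 < r < 1 -> 0 < v r.
  pose s := (r0 + 1) / 2.
  have s01 : r0 < s < 1 by rewrite /s; lra.
  have [q q1 hq] := @ln_blowup c (C - N s + 1) cp.
  exists (Num.max s q); first by rewrite gt_max q1; lra.
  move=> r; rewrite gt_max => /andP[/andP[sr qr] r1].
  have NN : N s <= N r.
    apply: (@der_le _ N (fun r => v' r + c * (- (1 - r)^-1) + C) s r (ltW sr)).
    - by move=> x /andP[x1 x2]; apply: dN; lra.
    - apply: continuous_in_subspaceT => x; rewrite inE/= in_itv/= => /andP[x1 x2].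
      by apply: der_cont (dN x _); lra.
    - by move=> x /andP[x1 x2]; have := v'_ge x (ltac:(lra)); lra.
  have := hq r (ltac:(by rewrite qr)).
  move: NN; rewrite [N r]/N; have : C * r <= C by rewrite ger_pMr /C; lra.
  by lra.
pose r2 := Num.max r1 r0.
apply: (@no_increase y (fun r => 2 * v r / r) r2).
- by rewrite gt_max r11; lra.
- by have h1 := circ2_cont P1; have h2 := circ2_cont P2; rewrite /y; ctac.
- by rewrite /y (circ2_1 P1) (circ2_1 P2) addr0.
- by move=> r _; rewrite addr_ge0 ?(circ2_ge0 P1) ?(circ2_ge0 P2).
- move=> r; rewrite gt_max => /andP[/andP[h1 h2] h3].
  have rr : 0 < r < 1 by lra.
  apply: der_eq; first by apply: derD; [exact: circ2_der P1 _ rr|exact: circ2_der P2 _ rr].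
  by rewrite /v; ring.
- move=> r; rewrite gt_max => /andP[/andP[h1 h2] h3].
  have := hr1 r (ltac:(by rewrite h1)) => h.
  by rewrite divr_gt0 ?mulr_gt0//; lra.
Qed.

(** The Jacobian of [u] and [q] is the divergence of [u] times the rotated gradient
    of [q]; over a circle its angular part integrates to zero. A mixed
    derivative of [q] is only taken in one order, whence the detour through
    [F]. *)
Lemma bracket_der (u ur ut q qr qt qtr : R -> R -> R) r : -1 < r < 1 ->
  (forall r t, -1 < r < 1 -> der r (u ^~ t) (ur r t)) ->
  (forall r t, -1 < r < 1 -> der t (u r) (ut r t)) ->
  (forall r t, -1 < r < 1 -> cont2_at u r t) ->
  (forall r t, -1 < r < 1 -> cont2_at ur r t) ->
  (forall r t, -1 < r < 1 -> cont2_at ut r t) ->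
  (forall r, per2pi (u r)) ->
  (forall r t, -1 < r < 1 -> der r (q ^~ t) (qr r t)) ->
  (forall r t, -1 < r < 1 -> der t (q r) (qt r t)) ->
  (forall r t, -1 < r < 1 -> der r (qt ^~ t) (qtr r t)) ->
  (forall r t, -1 < r < 1 -> cont2_at q r t) ->
  (forall r t, -1 < r < 1 -> cont2_at qr r t) ->
  (forall r t, -1 < r < 1 -> cont2_at qt r t) ->
  (forall r t, -1 < r < 1 -> cont2_at qtr r t) ->
  (forall r, per2pi (q r)) ->
  der r (fun r => oint (fun t => u r t * qt r t))
    (oint (fun t => ur r t * qt r t - ut r t * qr r t)).
Proof.
move=> r1 dur dut cu cur cut pu dqr dqt dqtr cq cqr cqt cqtr pq.
have c0 := cont2_slice (fun t => cu r t r1); have c1 := cont2_slice (fun t => cur r t r1).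
have c2 := cont2_slice (fun t => cut r t r1).
have c3 := cont2_slice (fun t => cqr r t r1); have c4 := cont2_slice (fun t => cqt r t r1).
have c5 := cont2_slice (fun t => cqtr r t r1).
apply: der_eq.
  apply: (@oint_der_param _ (fun r t => ur r t * qt r t + u r t * qtr r t)) => // [s s1 t|s s1 t|s s1 t].
  - by apply: derM; [exact: dur|exact: dqtr].
  - have h1 := cu s t s1; have h2 := cqt s t s1.
    by rewrite /cont2_at in h1 h2 *; ctac.
  - have h1 := cu s t s1; have h2 := cqt s t s1.
    have h3 := cqtr s t s1; have h4 := cur s t s1.
    by rewrite /cont2_at in h1 h2 h3 h4 *; ctac.
rewrite ointD ?ointB; [|by ctac..]; congr (_ + _).
(* Both sides are derivatives at r of the same function F, in which the
   radius varies in q only. *)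
pose F s := oint (fun t => u r t * qt s t).
have dF : der r F (oint (fun t => u r t * qtr r t)).
  apply: (@oint_der_param (fun s t => u r t * qt s t) (fun s t => u r t * qtr s t)) => // [s s1 t|s s1 t|s s1 t].
  - apply: der_eq; first by apply: derM; [exact: der_cst|exact: dqtr].
    by rewrite mul0r add0r.
  - rewrite /cont2_at; apply: contM; last exact: cqt.
    by apply: (@cont_comp _ _ (fun p : R * R => p.2) (u r)); [exact: cont_snd|exact: c0].
  - rewrite /cont2_at; apply: contM; last exact: cqtr.
    by apply: (@cont_comp _ _ (fun p : R * R => p.2) (u r)); [exact: cont_snd|exact: c0].
have dF2 : der r F (oint (fun t => - (ut r t * qr r t))).
  have h : der r (fun s => oint (fun t => - (ut r t * q s t))) (oint (fun t => - (ut r t * qr r t))).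
    apply: (@oint_der_param (fun s t => - (ut r t * q s t)) (fun s t => - (ut r t * qr s t))) => // [s s1 t|s s1 t|s s1 t].
    - apply: der_eq; first by apply: derN; apply: derM; [exact: der_cst|exact: dqr].
      by rewrite mul0r add0r.
    - rewrite /cont2_at; apply: contN; apply: contM; last exact: cq.
      by apply: (@cont_comp _ _ (fun p : R * R => p.2) (ut r)); [exact: cont_snd|exact: c2].
    - rewrite /cont2_at; apply: contN; apply: contM; last exact: cqr.
      by apply: (@cont_comp _ _ (fun p : R * R => p.2) (ut r)); [exact: cont_snd|exact: c2].
  apply: der_near h; near=> s; have s1 : -1 < s < 1 by near: s; exact: near_strip.
  have d1 := cont2_slice (fun t => cqt s t s1); have d2 := cont2_slice (fun t => cq s t s1).
  rewrite ointN; last by ctac.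
  rewrite (@oint_parts _ (u r) (ut r) (q s) (qt s)) ?opprK//.
  - by move=> t; exact: dut.
  - by move=> t; exact: dqt.
by rewrite (der_uniq dF dF2) ointN//; ctac.
Unshelve. all: by end_near. Qed.

End polar.

(** * Fourier modes of the energy *)

(** An angular Fourier mode [af] of frequency [ak], with square norm [anrm]. By
    [a_center] the mode is constant or has mean zero: subtracting it from [u]
    then keeps the value at the centre of the disk independent of the angle.
    The two frequencies in [a_low] are treated case by case where [r ^ (ak - 1)]
    occurs. *)
Record amode (R : realType) := AMode {
  ak : nat; af : R -> R; af' : R -> R; anrm : R;
  a_der : forall t, der t af (af' t);
  a_der' : forall t, der t af' (- (ak ^ 2)%:R * af t);
  a_per : per2pi af;
  a_le1 : forall t, `|af t| <= 1;
  a_nrm : oint (fun t => af t ^+ 2) = anrm;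
  a_nrm0 : 0 < anrm;
  a_center : forall t, oint af * af t = oint af * af 0;
  a_low : (ak <= 1)%N }.

Section modes.
Context {R : realType}.
Implicit Types (u : polar_jet R) (w f g : R -> R -> R) (r t : R) (a b : amode R).

Lemma a_cont a : continuous (af a).
Proof. exact: der_continuous (a_der a). Qed.
Arguments a_cont : clear implicits.

Lemma a_cont' a : continuous (af' a).
Proof. exact: der_continuous (a_der' a). Qed.
Arguments a_cont' : clear implicits.

Lemma a_per' a : per2pi (af' a).
Proof. exact: der_periodic (a_der a) (a_per a). Qed.

Definition mode a f r := oint (fun t => f r t * af a t).

Lemma mode_cont a f : cont2 f -> continuous (mode a f).
Proof.
move=> cf; apply: (@oint_cont _ (fun r t => f r t * af a t)).
cintro2 p; apply: contM; first exact: cf.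
by apply: (@cont_comp _ _ (fun p : R * R => p.2) (af a)); [exact: cont_snd|exact: a_cont].
Qed.
Arguments mode_cont a {f} _.

Lemma mode_cont_at a f r : -1 < r < 1 ->
  (forall s t, -1 < s < 1 -> cont2_at f s t) -> {for r, continuous (mode a f)}.
Proof.
move=> r1 cf; apply: (@oint_cont_at _ (fun r t => f r t * af a t)) => // s s1 t.
rewrite /cont2_at; apply: contM; first exact: cf.
by apply: (@cont_comp _ _ (fun p : R * R => p.2) (af a)); [exact: cont_snd|exact: a_cont].
Qed.

Lemma mode_der a f f' r : -1 < r < 1 ->
  (forall s t, -1 < s < 1 -> der s (f ^~ t) (f' s t)) ->
  (forall s t, -1 < s < 1 -> cont2_at f s t) ->
  (forall s t, -1 < s < 1 -> cont2_at f' s t) ->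
  der r (mode a f) (mode a f' r).
Proof.
move=> r1 df cf cf'.
apply: (@oint_der_param _ (fun r t => f r t * af a t) (fun r t => f' r t * af a t)) => // s s1 t.
- apply: der_eq; first by apply: derM; [exact: df|exact: der_cst].
  by rewrite mulr0 addr0.
- rewrite /cont2_at; apply: contM; first exact: cf.
  by apply: (@cont_comp _ _ (fun p : R * R => p.2) (af a)); [exact: cont_snd|exact: a_cont].
- rewrite /cont2_at; apply: contM; first exact: cf'.
  by apply: (@cont_comp _ _ (fun p : R * R => p.2) (af a)); [exact: cont_snd|exact: a_cont].
Qed.

Section solution.
Variables (u : polar_jet R) (w : R -> R -> R) (a : amode R).
Hypothesis uw : polar_sol u w.

Lemma mode_dr r : -1 < r < 1 -> der r (mode a (jv u)) (mode a (jr u) r).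
Proof.
move=> r1; apply: mode_der => // s t s1; [exact: (ps_r uw)| |exact: (ps_cr uw)].
exact: cont2_at_of s t (ps_cont uw).
Qed.

Lemma mode_drr r : -1 < r < 1 -> der r (mode a (jr u)) (mode a (jrr u) r).
Proof.
by move=> r1; apply: mode_der => // s t s1; [exact: (ps_rr uw)|exact: (ps_cr uw)|exact: (ps_crr uw)].
Qed.

Lemma mode_jtt r : -1 < r < 1 -> mode a (jtt u) r = - (ak a ^ 2)%:R * mode a (jv u) r.
Proof.
move=> r1; rewrite /mode.
have c0 := @ps_cont_slice _ _ _ uw r; have c3 := ps_ct_slice uw r1.
have c4 := ps_ctt_slice uw r1; have ca := a_cont a; have ca' := a_cont' a.
rewrite (@oint_parts _ (jt u r) (jtt u r) (af a) (af' a))//; first last.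
- exact: a_per.
- exact: (ps_pert uw).
- exact: a_der.
- by move=> t; exact: (ps_tt uw).
rewrite (@oint_parts _ (jv u r) (jt u r) (af' a) (fun t => - (ak a ^ 2)%:R * af a t)) ?opprK//; first last.
- exact: a_per'.
- exact: ps_per uw r.
- by ctac.
- exact: a_der'.
- by move=> t; exact: (ps_t uw).
rewrite -ointZ; last by ctac.
by congr oint; apply/funext => t; ring.
Qed.

Lemma mode_ode r : -1 < r < 1 ->
  r ^+ 2 * mode a (jrr u) r + r * mode a (jr u) r - (ak a ^ 2)%:R * mode a (jv u) r =
  - r ^+ 2 * mode a w r.
Proof.
move=> r1; rewrite -mulNr -mode_jtt// /mode.
have c1 := ps_cr_slice uw r1; have c2 := ps_crr_slice uw r1.
have c4 := ps_ctt_slice uw r1; have ca := a_cont a; have c5 := @ps_contw_slice _ _ _ uw r.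
rewrite -!ointZ -?ointD; [|by ctac..].
congr oint; apply/funext => t; rewrite -!mulrA; have := ps_eq uw t r1 => h.
transitivity ((r ^+ 2 * jrr u r t + r * jr u r t + jtt u r t) * af a t); first by ring.
by rewrite h; ring.
Qed.

Lemma mode_one : mode a (jv u) 1 = 0.
Proof.
rewrite /mode (_ : (fun t => _) = fun=> 0) ?oint_cst ?mulr0//.
by apply/funext => t; rewrite (ps_one uw) mul0r.
Qed.

(** The flux [L] of a mode satisfies [L' = - r ^ (k + 1) w], and [L 0 = 0]. *)
Lemma mode_rad_sol : rad_sol (ak a) (mode a (jv u)) (mode a w).
Proof.
have cc := mode_cont a (ps_cont uw); have cw := mode_cont a (ps_contw uw).
split; [exact: cc|exact: mode_one|].
set k := ak a; set c := mode a (jv u); set c' := mode a (jr u).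
have k1 : k = 0%N \/ k = 1%N by move: (a_low a); rewrite -/k; case: k => [|[|]]; auto.
pose L s := s ^+ k.+1 * c' s - k%:R * s ^+ k * c s.
pose L' s := k.+1%:R * s ^+ k * c' s + s ^+ k.+1 * mode a (jrr u) s
  - k%:R * (k%:R * s ^+ k.-1) * c s - k%:R * s ^+ k * c' s.
have dL s : -1 < s < 1 -> der s L (L' s).
  move=> s1; apply: der_eq.
    apply: derB; apply: derM; [dtac|exact: mode_drr|dtac|exact: mode_dr].
  by rewrite /L' /c' /c /id /=; cbv beta; ring.
have key s : 0 < s < 1 -> L' s = - (s ^+ k.+1 * mode a w s).
  move=> s01; have sn0 : s != 0 by case/andP: s01 => ? _; rewrite gt_eqF.
  have := mode_ode (strip_pos s01); rewrite -/c -/c' -/k => e.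
  apply: (mulfI sn0); rewrite mulrN mulrA -exprS.
  transitivity (s ^+ k * (- s ^+ 2 * mode a w s)); last by rewrite !exprS; ring.
  by rewrite -e /L'; case: k1 => ->; rewrite /= ?expr0 ?expr1; ring.
move=> r /[dup] r01 /andP[r0 r1]; have rn0 : r != 0 by rewrite gt_eqF.
have LE : L r = - mom k (mode a w) r.
  have L0 : L 0 = 0.
    by rewrite /L; case: k1 => ->; rewrite !expr0n /=; ring.
  have := @der_const R (fun s => L s + mom k (mode a w) s) (fun s => L' s + s ^+ k.+1 * mode a w s) 0 r (ltW r0).
  rewrite L0 mom0 addr0 => h; apply/eqP; rewrite -addr_eq0 -h ?eqxx//.
  - move=> x /andP[x0 xr]; apply: derD; last exact: mom_der.
    by apply: dL; apply: strip_pos; rewrite x0 (lt_trans xr).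
  - apply: continuous_in_subspaceT => s; rewrite inE/= in_itv/= => /andP[s0 sr].
    apply: (@der_cont _ _ _ (L' s + s ^+ k.+1 * mode a w s)); apply: derD; last exact: mom_der.
    by apply: dL; rewrite (le_lt_trans sr r1) andbT (lt_le_trans _ s0)// oppr_lt0.
  - by move=> x /andP[x0 xr]; rewrite key ?addNr// x0 (lt_trans xr).
apply: der_eq.
  apply: derM; first by apply: mode_dr; exact: strip_pos.
  by apply: derV; [rewrite expf_neq0|dtac].
rewrite -LE /L -/c -/c' /=.
by case: k1 => ->; rewrite /= ?muln0 ?muln1 ?expr0 ?expr1; field.
Qed.

(** The projection that removes the mode; [rm_jet] is what it does to the
    derivatives of a stream function. *)
Definition rm f r t := f r t - mode a f r * af a t / anrm a.

Definition rm_jet : polar_jet R := PolarJet (rm (jv u)) (rm (jr u)) (rm (jrr u))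
  (fun r t => jt u r t - mode a (jv u) r * af' a t / anrm a)
  (fun r t => jtt u r t + (ak a ^ 2)%:R * (mode a (jv u) r * af a t / anrm a)).

Lemma rm_cont f : cont2 f -> cont2 (rm f).
Proof.
move=> cf; cintro2 p; rewrite /rm; apply: contB; first exact: cf.
apply: contM; last exact: cont_cst; apply: contM.
  by apply: (@cont_comp _ _ (fun p : R * R => p.1) (mode a f)); [exact: cont_fst|exact: mode_cont].
by apply: (@cont_comp _ _ (fun p : R * R => p.2) (af a)); [exact: cont_snd|exact: a_cont].
Qed.
Arguments rm_cont {f} _.

Lemma mode_term_cont f (h : R -> R) r t : -1 < r < 1 -> continuous h ->
  (forall s t, -1 < s < 1 -> cont2_at f s t) ->
  cont2_at (fun r t => mode a f r * h t / anrm a) r t.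
Proof.
move=> r1 ch cf; rewrite /cont2_at; apply: contM; last exact: cont_cst.
apply: contM.
  by apply: (@cont_comp _ _ (fun p : R * R => p.1) (mode a f)); [exact: cont_fst|exact: mode_cont_at].
by apply: (@cont_comp _ _ (fun p : R * R => p.2) h); [exact: cont_snd|exact: ch].
Qed.

Lemma rm_cont_at f r t : -1 < r < 1 -> (forall s t, -1 < s < 1 -> cont2_at f s t) ->
  cont2_at (rm f) r t.
Proof.
move=> r1 cf; rewrite /cont2_at /rm; apply: contB; first exact: cf.
by apply: (mode_term_cont (h := af a)) => //; exact: a_cont.
Qed.

Lemma mode_le f r M : continuous (f r) -> (forall t, `|f r t| <= M) ->
  `|mode a f r| <= 2 * pi * M.
Proof.
move=> cf fM; rewrite mulrC -[2 * pi]subr0; apply: integ_norm_le; first exact/ltW/twopi_gt0.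
  by have ca := a_cont a; ctac.
by move=> t _; rewrite normrM -[M]mulr1 ler_pM// a_le1.
Qed.

(** Removing a mode commutes with the Laplacian, and the estimate at the circle survives. *)
Lemma rm_sol : polar_sol rm_jet (rm w).
Proof.
have n0 := a_nrm0 a; have nn0 : anrm a != 0 by rewrite gt_eqF.
have cu s t : -1 < s < 1 -> cont2_at (jv u) s t by move=> _; exact: cont2_at_of s t (ps_cont uw).
split.
- exact: (rm_cont (ps_cont uw)).
- exact: (rm_cont (ps_contw uw)).
- move=> r t r1 /=; apply: der_eq.
    apply: derB; first exact: (ps_r uw).
    by apply: derM; [apply: derM; [exact: mode_dr|exact: der_cst]|exact: der_cst].
  by rewrite /rm; ring.
- move=> r t r1 /=; apply: der_eq.
    apply: derB; first exact: (ps_rr uw).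
    by apply: derM; [apply: derM; [exact: mode_drr|exact: der_cst]|exact: der_cst].
  by rewrite /rm; ring.
- move=> r t r1 /=; apply: der_eq.
    apply: derB; first exact: (ps_t uw).
    by apply: derM; [apply: derM; [exact: der_cst|exact: a_der]|exact: der_cst].
  by rewrite /=; ring.
- move=> r t r1 /=; apply: der_eq.
    apply: derB; first exact: (ps_tt uw).
    by apply: derM; [apply: derM; [exact: der_cst|exact: a_der']|exact: der_cst].
  by rewrite /=; ring.
- by move=> r t r1; apply: rm_cont_at => // s s' s1; exact: (ps_cr uw).
- by move=> r t r1; apply: rm_cont_at => // s s' s1; exact: (ps_crr uw).
- move=> r t r1; rewrite /cont2_at; apply: contB; first exact: (ps_ct uw).
  by apply: (mode_term_cont (h := af' a)) => //; exact: a_cont'.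
- move=> r t r1; rewrite /cont2_at; apply: contD; first exact: (ps_ctt uw).
  apply: contM; first exact: cont_cst.
  by apply: (mode_term_cont (h := af a)) => //; exact: a_cont.
- by move=> r t; rewrite /= /rm (ps_per uw r t) a_per.
- by move=> r t; rewrite /rm (ps_perw uw r t) a_per.
- move=> r t r1; rewrite /= /rm.
  have e1 := ps_eq uw t r1; have e2 := mode_ode r1.
  transitivity ((r ^+ 2 * jrr u r t + r * jr u r t + jtt u r t)
    - (r ^+ 2 * mode a (jrr u) r + r * mode a (jr u) r - (ak a ^ 2)%:R * mode a (jv u) r) * af a t / anrm a).
    by ring.
  by rewrite e1 e2; ring.
- have [M M0 hM] := ps_bound uw.
  have pi0 := @pi_ge0 R.
  exists (M + 2 * pi * M / anrm a).
    by rewrite addr_ge0// divr_ge0 ?(ltW n0)// !mulr_ge0.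
  move=> r t r01; rewrite /= /rm; apply: le_trans (ler_normB _ _) _.
  rewrite [(_ + _) * (1 - r)]mulrDl; apply: lerD; first exact: hM.
  rewrite !normrM normfV (gtr0_norm n0).
  rewrite (_ : 2 * pi * M / anrm a * (1 - r) = 2 * pi * (M * (1 - r)) / anrm a); last by ring.
  rewrite ler_wpM2r ?invr_ge0 ?(ltW n0)//.
  rewrite -[leRHS]mulr1; apply: ler_pM => //; last exact: a_le1.
  apply: mode_le; first exact: (@ps_cont_slice _ _ _ uw r).
  by move=> t'; exact: hM.
- move=> t; rewrite /= /rm (ps_center uw t); congr (_ - _).
  have -> : mode a (jv u) 0 = jv u 0 0 * oint (af a).
    rewrite /mode -ointZ; last exact: a_cont.
    by congr oint; apply/funext => s; rewrite (ps_center uw s).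
  by rewrite -!mulrA; congr (_ * _); rewrite !mulrA a_center.
Qed.

End solution.

Arguments rm_cont a {f} _.

(** The inner product of [L2] of the disk in polar coordinates. *)
Definition pin f g := integ 0 1 (fun r => r * oint (fun t => f r t * g r t)).

Lemma pinC f g : pin f g = pin g f.
Proof.
rewrite /pin; congr (integ _ _ _); apply/funext => r; congr (_ * oint _).
by apply/funext => t; rewrite mulrC.
Qed.

Lemma oint2_cont f g : cont2 f -> cont2 g -> continuous (fun r => oint (fun t => f r t * g r t)).
Proof.
move=> cf cg; apply: (@oint_cont _ (fun r t => f r t * g r t)).
by cintro2 p; apply: contM; [exact: cf|exact: cg].
Qed.

Lemma pin_cont f g : cont2 f -> cont2 g -> continuous (fun r => r * oint (fun t => f r t * g r t)).
Proof. by move=> cf cg; have h := oint2_cont cf cg; ctac. Qed.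

Lemma slice f r : cont2 f -> continuous (f r).
Proof. by move=> cf; apply: cont2_slice => t; exact: cf. Qed.

Lemma oint_expand1 (F A B : R -> R) (p n : R) :
  continuous F -> continuous A -> continuous B ->
  oint (fun t => (F t - p * A t / n) * B t) =
  oint (fun t => F t * B t) - p / n * oint (fun t => A t * B t).
Proof.
move=> cF cA cB; rewrite -ointZ -?ointB; [|by ctac..].
by congr oint; apply/funext => t; ring.
Qed.

Lemma oint_expand (F G A : R -> R) (p q n : R) :
  continuous F -> continuous G -> continuous A ->
  oint (fun t => (F t - p * A t / n) * (G t - q * A t / n)) =
  oint (fun t => F t * G t) - q / n * oint (fun t => F t * A t)
  - p / n * oint (fun t => G t * A t) + p * q / n ^+ 2 * oint (fun t => A t ^+ 2).
Proof.
move=> cF cG cA; rewrite -!ointZ -?ointB -?ointD; [|by ctac..].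
by congr oint; apply/funext => t; rewrite -exprVn; ring.
Qed.

Lemma oint_rm a f g r : cont2 f -> cont2 g ->
  oint (fun t => rm a f r t * rm a g r t) =
  oint (fun t => f r t * g r t) - mode a f r * mode a g r / anrm a.
Proof.
move=> cf cg; have n0 := a_nrm0 a; have nn0 : anrm a != 0 by rewrite gt_eqF.
have cfr := slice (r := r) cf; have cgr := slice (r := r) cg; have ca := a_cont a.
rewrite /rm oint_expand// a_nrm -!/(mode a _ r).
by field.
Qed.

Lemma pin_rm a f g : cont2 f -> cont2 g ->
  pin f g = integ 0 1 (fun r => r * mode a f r * mode a g r) / anrm a + pin (rm a f) (rm a g).
Proof.
move=> cf cg; have c1 := mode_cont a cf; have c2 := mode_cont a cg.
have c3 := pin_cont (rm_cont a cf) (rm_cont a cg).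
rewrite mulrC -integZ -?integD; [|by ctac..].
congr (integ _ _ _); apply/funext => r; rewrite oint_rm//; ring.
Qed.

Lemma mode_rm a b f r : cont2 f -> oint (fun t => af a t * af b t) = 0 ->
  mode b (rm a f) r = mode b f r.
Proof.
move=> cf ab; have cfr := slice (r := r) cf; have ca := a_cont a; have cb := a_cont b.
by rewrite {1}/mode /rm oint_expand1// ab mulr0 subr0.
Qed.

Lemma mode_rm_same a f r : cont2 f -> mode a (rm a f) r = 0.
Proof.
move=> cf; have cfr := slice (r := r) cf; have ca := a_cont a.
have n0 := a_nrm0 a; have nn0 : anrm a != 0 by rewrite gt_eqF.
rewrite {1}/mode /rm oint_expand1// -/(mode a f r).
rewrite (_ : (fun t => af a t * af a t) = (fun t => af a t ^+ 2)); last first.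
  by apply/funext => t; rewrite expr2.
by rewrite a_nrm; field.
Qed.

Definition a_one : amode R.
Proof.
refine (@AMode R 0 (fun=> 1) (fun=> 0) (2 * pi) _ _ _ _ _ _ _ _) => //.
- by move=> t; exact: der_cst.
- by move=> t; apply: der_eq; [exact: der_cst|rewrite expnE/= mul0n oppr0 mul0r].
- by move=> t; rewrite normr1.
- by rewrite (_ : (fun t => _) = fun=> 1) ?oint_cst ?mulr1//; apply/funext => t; rewrite expr1n.
- exact: twopi_gt0.
Defined.

Lemma cos_per2pi : per2pi (@cos R).
Proof. by move=> t; rewrite cosD cos_2pi sin_2pi; ring. Qed.

Lemma sin_per2pi : per2pi (@sin R).
Proof. by move=> t; rewrite sinD cos_2pi sin_2pi; ring. Qed.

Definition a_cos : amode R.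
Proof.
refine (@AMode R 1 cos (fun t => - sin t) pi _ _ _ _ _ _ _ _) => //.
- by move=> t; exact: is_derive_cos.
- by move=> t; apply: der_eq; [apply: derN; exact: is_derive_sin|rewrite mulN1r].
- exact: cos_per2pi.
- by move=> t; rewrite ler_norml cos_geN1 cos_le1.
- exact: oint_cos2.
- exact: pi_gt0.
- by move=> t; rewrite oint_cos !mul0r.
Defined.

Definition a_sin : amode R.
Proof.
refine (@AMode R 1 sin cos pi _ _ _ _ _ _ _ _) => //.
- by move=> t; exact: is_derive_sin.
- by move=> t; apply: der_eq; [exact: is_derive_cos|rewrite mulN1r].
- exact: sin_per2pi.
- by move=> t; rewrite ler_norml sin_geN1 sin_le1.
- exact: oint_sin2.
- exact: pi_gt0.
- by move=> t; rewrite oint_sin !mul0r.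
Defined.

(** The modes of frequency at least 2 behave as if the first Dirichlet eigenvalue
    were at least 16; [h r = r * (1 - r)] is the supersolution behind it, and
    [P r = r h' r / h r] its logarithmic derivative. Completing a square with
    [P], the corrected flux [Z] satisfies [Z' >= k] with [k] the integrand of
    the claim. Were the integral [K 1] positive, the flux would be positive
    near the circle, against [no_increase]. *)
Lemma rest_energy u w : polar_sol u w ->
  (forall r, mode a_one (jv u) r = 0) -> (forall r, mode a_cos (jv u) r = 0) ->
  (forall r, mode a_sin (jv u) r = 0) ->
  16 * pin (jv u) (jv u) <= pin (jv u) w.
Proof.
move=> uw m0 mc ms.
pose uwr r := oint (fun t => jv u r t * w r t).
have cuw : continuous uwr by exact: oint2_cont (ps_cont uw) (ps_contw uw).
have cy := circ2_cont uw.
pose y := circ2 u; pose v := flux2 u.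
have y0 : y 0 = 0.
  have e : jv u 0 0 = 0.
    have := m0 0; rewrite /mode /=.
    under eq_fun do rewrite mulr1 (ps_center uw).
    rewrite oint_cst => /eqP; rewrite mulf_eq0 gt_eqF/=; last exact: twopi_gt0.
    by move=> /eqP.
  rewrite /y /circ2 (_ : (fun t => _) = fun=> 0) ?oint_cst ?mulr0//.
  by apply/funext => t; rewrite (ps_center uw) e expr0n.
pose P r : R := (1 - 2 * r) / (1 - r).
pose Z r := v r - P r * y r.
pose k r := 16 * r * y r - r * uwr r.
have ck : continuous k by rewrite /k; ctac.
pose K r := integ 0 r k.
suff : K 1 <= 0.
  rewrite /K /k integB; [|by ctac..].
  rewrite (_ : (fun x => 16 * x * y x) = (fun x => 16 * (x * y x))); last first.
    by apply/funext => x; rewrite mulrA.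
  rewrite integZ; last by ctac.
  suff -> : integ 0 1 (fun x => x * y x) = pin (jv u) (jv u) by rewrite subr_le0.
  rewrite /pin; congr (integ _ _ _); apply/funext => r; congr (_ * oint _); apply/funext => t; rewrite expr2.
rewrite leNgt; apply/negP => K1.
pose Z' r := r * oint (fun t => jr u r t ^+ 2) + r^-1 * oint (fun t => jt u r t ^+ 2)
   - r * uwr r - (- (1 - r)^-2 * y r + P r * (2 * v r / r)).
have dZ r : 0 < r < 1 -> der r Z (Z' r).
  move=> /[dup] r01 /andP[r0 r1]; apply: der_eq.
    apply: derB; first exact: flux2_der uw _ r01.
    apply: derM; last exact: circ2_der uw _ r01.
    apply: derM; first by dtac.
    apply: derV; first by rewrite subr_eq0 gt_eqF.
    by dtac.
  rewrite /Z' /P /=; congr (_ - _ - (_ * _ + _)).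
  by field; rewrite subr_eq0 gt_eqF.
have Z'k r : 0 < r < 1 -> k r <= Z' r.
  move=> /[dup] r01 /andP[r0 r1]; have rs := strip_pos r01.
  have c0 := @ps_cont_slice _ _ _ uw r; have c1 := ps_cr_slice uw rs; have c3 := ps_ct_slice uw rs.
  have wi : 23 / 10 * y r <= oint (fun t => jt u r t ^+ 2).
    apply: wirtinger => //.
    - by move=> t; exact: (ps_t uw).
    - exact: ps_per uw r.
    - by have := m0 r; rewrite /mode /=; under eq_fun do rewrite mulr1.
    - exact: mc.
    - exact: ms.
  have rad : 2 * P r * (v r / r) - P r ^+ 2 / r * y r <= r * oint (fun t => jr u r t ^+ 2).
    have : 0 <= oint (fun t => (r * jr u r t - P r * jv u r t) ^+ 2).
      by apply: oint_ge0 => [|t]; [ctac|exact: sqr_ge0].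
    have -> : oint (fun t => (r * jr u r t - P r * jv u r t) ^+ 2) =
       r ^+ 2 * oint (fun t => jr u r t ^+ 2) - 2 * P r * v r + P r ^+ 2 * y r.
      rewrite /v /flux2 mulrA /y /circ2 -!ointZ -?ointB -?ointD; [|by ctac..].
      by congr oint; apply/funext => t; ring.
    move=> h; rewrite -(ler_pM2l r0).
    have -> : r * (2 * P r * (v r / r) - P r ^+ 2 / r * y r) = 2 * P r * v r - P r ^+ 2 * y r.
      by field; rewrite gt_eqF.
    by rewrite [leRHS]mulrA -[r * r]expr2; lra.
  have yp : 0 <= y r by exact: circ2_ge0 uw r.
  have alg : 16 * r <= 23 / 10 / r - P r ^+ 2 / r + (1 - r)^-2.
    have -> : 23 / 10 / r - P r ^+ 2 / r + (1 - r)^-2 =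
       (13 / 10 + 17 / 10 * r) / (r * (1 - r)).
      by rewrite /P; field; rewrite subr_eq0 !gt_eqF.
    rewrite ler_pdivlMr; last by rewrite mulr_gt0// subr_gt0.
    (* On [0, 1] the cubic [16 r^3 - 16 r^2 + 17/10 r + 13/10] has its minimum
    near 0.608, and exceeds [16 (r - 0.608)^2 (r + 0.216)]. *)
    have := mulr_ge0 (sqr_ge0 (r - 608 / 1000)) (ltac:(lra) : 0 <= r + 216 / 1000).
    by nra.
  have wi2 : 23 / 10 / r * y r <= r^-1 * oint (fun t => jt u r t ^+ 2).
    by rewrite mulrAC mulrC ler_pM2l// invr_gt0.
  have := ler_wpM2r yp alg.
  by rewrite /k /Z' !(mulrDl, mulNr); lra.
have Z0 : Z 0 = 0 by rewrite /Z /v flux2_0 y0 mulr0 subrr.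
have ZK r : 0 < r < 1 -> K r <= Z r.
  move=> /andP[r0 r1].
  have := @der_le R (fun s => Z s - K s) (fun s => Z' s - k s) 0 r (ltW r0).
  rewrite Z0 /K integ_same subrr => h; rewrite -subr_ge0; apply: h.
  - move=> x /andP[x0 xr]; apply: derB; last exact: integ_der.
    by apply: dZ; rewrite x0 (lt_trans xr).
  - apply: continuous_in_subspaceT => s; rewrite inE/= in_itv/= => /andP[s0 sr].
    have s1 : s < 1 by exact: le_lt_trans r1.
    change {for s, continuous (fun s => Z s - K s)}.
    apply: contB; last exact: integ_cont.
    rewrite /Z; apply: contB.
      by apply: (flux2_cont uw); rewrite s1 andbT (lt_le_trans _ s0)// oppr_lt0.
    apply: contM; last exact: cy.
    rewrite /P; apply: contM; first by ctac.
    by apply: cvgV; [rewrite subr_eq0 gt_eqF|change {for s, continuous (fun s : R => 1 - s)}; ctac].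
  - by move=> x /andP[x0 xr]; rewrite subr_ge0 Z'k// x0 (lt_trans xr).
have [M M0 hM] := ps_bound uw.
have pi0 := @pi_gt0 R.
have yM r : 0 <= r <= 1 -> y r <= 2 * pi * (M ^+ 2 * (1 - r) ^+ 2).
  move=> r01; rewrite -oint_cst; apply: oint_le.
  - by have h := @ps_cont_slice _ _ _ uw r; ctac.
  - exact: cst_continuous.
  - move=> t; rewrite -exprMn -[leLHS]real_normK ?num_real// ler_sqr ?nnegrE//; first exact: hM.
    by rewrite mulr_ge0// subr_ge0; case/andP: r01.
have [d d0 hd] : exists2 d, 0 < d & forall r, 1 - d < r < 1 -> K 1 / 2 < K r.
  have : {for 1, continuous K} by exact: integ_cont.
  move=> /cvgrPdist_lt/(_ (K 1 / 2) (ltac:(lra))) [d /= d0 hd].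
  exists d => // r /andP[h1 h2]; have := hd r; rewrite /= ger0_norm; last by lra.
  by move=> /(_ (ltac:(lra))) h; have := ler_norm (K 1 - K r); lra.
pose e := K 1 / (4 * (2 * pi * M ^+ 2 + 1)).
have q0 : 0 < 2 * pi * M ^+ 2 + 1.
  by have := mulr_ge0 (ltW pi0) (sqr_ge0 M); lra.
have e0 : 0 < e by rewrite divr_gt0 ?mulr_gt0.
apply: (@no_increase R y (fun r => 2 * v r / r) (Num.max (1 / 2) (Num.max (1 - d) (1 - e)))) => //.
- by rewrite !gt_max; lra.
- exact: circ2_1 uw.
- by move=> r _; exact: circ2_ge0 uw r.
- by move=> r; rewrite gt_max => /andP[/andP[h1 _] h2]; apply: (circ2_der uw); lra.
- move=> r; rewrite !gt_max => /andP[/andP[h1 /andP[h2 h3]] h4].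
  rewrite divr_gt0//; last by lra.
  rewrite mulr_gt0//.
  have a1 := hd r (ltac:(lra)); have a2 := ZK r (ltac:(lra)); have a3 := yM r (ltac:(lra)).
  have yp : 0 <= y r by exact: circ2_ge0 uw r.
  have Pb : - (P r * y r) <= 2 * pi * M ^+ 2 * e.
    have -> : - (P r * y r) = (2 * r - 1) * (y r / (1 - r)).
      by rewrite /P; field; rewrite subr_eq0 gt_eqF.
    have s1 : 0 < 1 - r by lra.
    have b1 : y r / (1 - r) <= 2 * pi * M ^+ 2 * (1 - r).
      by rewrite ler_pdivrMr//; apply: le_trans a3 _; rewrite le_eqVlt; apply/orP; left; apply/eqP; ring.
    have b0 : 0 <= y r / (1 - r) by rewrite divr_ge0// ltW.
    have b2 : 2 * pi * M ^+ 2 * (1 - r) <= 2 * pi * M ^+ 2 * e.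
      by apply: ler_wpM2l; [rewrite !mulr_ge0 ?sqr_ge0// ltW|lra].
    by nra.
  have eb : 2 * pi * M ^+ 2 * e <= K 1 / 4.
    rewrite /e mulrA ler_pdivrMr ?mulr_gt0//.
    by have := mulr_ge0 (mulr_ge0 (ltW pi0) (sqr_ge0 M)) (ltW K1); nra.
  by move: a2; rewrite /Z; lra.
Qed.

(** ** Splitting the energy over the modes *)

Definition rm3 f := rm a_sin (rm a_cos (rm a_one f)).

Lemma rm3_cont f : cont2 f -> cont2 (rm3 f).
Proof. by move=> cf; do 3 apply: rm_cont. Qed.

(* Orthogonality of the modes, found in the context by [//] below. *)
Let one_cos : oint (fun t => af a_one t * af a_cos t) = 0.
Proof. by rewrite /=; under eq_fun do rewrite mul1r; exact: oint_cos. Qed.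
Let one_sin : oint (fun t => af a_one t * af a_sin t) = 0.
Proof. by rewrite /=; under eq_fun do rewrite mul1r; exact: oint_sin. Qed.
Let cos_sin : oint (fun t => af a_cos t * af a_sin t) = 0.
Proof. exact: oint_cossin. Qed.
Let cos_one : oint (fun t => af a_cos t * af a_one t) = 0.
Proof. by rewrite /=; under eq_fun do rewrite mulr1; exact: oint_cos. Qed.
Let sin_one : oint (fun t => af a_sin t * af a_one t) = 0.
Proof. by rewrite /=; under eq_fun do rewrite mulr1; exact: oint_sin. Qed.
Let sin_cos : oint (fun t => af a_sin t * af a_cos t) = 0.
Proof. by rewrite -[RHS]cos_sin; congr oint; apply/funext => t; rewrite mulrC. Qed.

Lemma rm3_modes f r : cont2 f ->
  [/\ mode a_one (rm3 f) r = 0, mode a_cos (rm3 f) r = 0 & mode a_sin (rm3 f) r = 0].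
Proof.
move=> cf; have c1 := rm_cont a_one cf; have c2 := rm_cont a_cos c1.
split; rewrite /rm3.
- by rewrite mode_rm// mode_rm// mode_rm_same.
- by rewrite mode_rm// mode_rm_same.
- by rewrite mode_rm_same.
Qed.

Lemma pin_split f g : cont2 f -> cont2 g ->
  pin f g = integ 0 1 (fun r => r * mode a_one f r * mode a_one g r) / (2 * pi)
    + integ 0 1 (fun r => r * mode a_cos f r * mode a_cos g r) / pi
    + integ 0 1 (fun r => r * mode a_sin f r * mode a_sin g r) / pi
    + pin (rm3 f) (rm3 g).
Proof.
move=> cf cg.
have c1 := rm_cont a_one cf; have c2 := rm_cont a_cos c1.
have d1 := rm_cont a_one cg; have d2 := rm_cont a_cos d1.
rewrite (pin_rm a_one cf cg) (pin_rm a_cos c1 d1) (pin_rm a_sin c2 d2) !addrA -/(rm3 f) -/(rm3 g).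
congr (_ / _ + _ / _ + _ / _ + _).
  by congr (integ _ _ _); apply/funext => r; rewrite !mode_rm.
by congr (integ _ _ _); apply/funext => r; rewrite !mode_rm.
Qed.

(** Modes 0 and 1 contribute radial energies. On the rest, [16 |u|^2 <= <w, u>]
    turns into [16 <w, u> <= |w|^2] by Cauchy-Schwarz. *)
Lemma polar_energy u w : polar_sol u w ->
  [/\ pin w (jv u) = rad_energy 0 (mode a_one w) (mode a_one w) / (2 * pi)
    + rad_energy 1 (mode a_cos w) (mode a_cos w) / pi
    + rad_energy 1 (mode a_sin w) (mode a_sin w) / pi + pin (rm3 w) (rm3 (jv u)),
    0 <= pin (rm3 w) (rm3 (jv u)) &
    16 * pin (rm3 w) (rm3 (jv u)) <= pin (rm3 w) (rm3 w)].
Proof.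
move=> uw; have cu := ps_cont uw; have cw := ps_contw uw.
have en (a : amode R) : integ 0 1 (fun r => r * mode a w r * mode a (jv u) r) =
    rad_energy (ak a) (mode a w) (mode a w).
  by apply: rad_sol_energy; [exact: mode_rad_sol|exact: mode_cont|exact: mode_cont].
have P3 := rm_sol a_sin (rm_sol a_cos (rm_sol a_one uw)).
have rest : 16 * pin (rm3 (jv u)) (rm3 (jv u)) <= pin (rm3 w) (rm3 (jv u)).
  have := rest_energy P3; rewrite -[jv _]/(rm3 (jv u)) -/(rm3 w) => h.
  by rewrite pinC; apply: h => r; case: (rm3_modes r cu).
have cru := rm3_cont cu; have crw := rm3_cont cw.
have c1 := pin_cont cru cru; have c2 := pin_cont crw cru; have c3 := pin_cont crw crw.
have U0 : 0 <= pin (rm3 (jv u)) (rm3 (jv u)).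
  apply: integ_ge0 => // r /andP[r0 _]; rewrite mulr_ge0 ?(ltW r0)//.
  by apply: oint_ge0 => [|t]; [have h := slice (r := r) cru; ctac|rewrite -expr2 sqr_ge0].
split.
- by rewrite (pin_split cw cu) !en.
- by apply: le_trans rest; rewrite mulr_ge0.
have : 2 * pin (rm3 w) (rm3 (jv u)) <=
    16 * pin (rm3 (jv u)) (rm3 (jv u)) + 16^-1 * pin (rm3 w) (rm3 w).
  rewrite /pin -!integZ -?integD; [|by ctac..].
  apply: integ_le => //; [by ctac|by ctac|].
  move=> r /andP[r0 _].
  have s1 := slice (r := r) cru; have s2 := slice (r := r) crw.
  rewrite !mulrA ![_ * r]mulrC -!mulrA -mulrDr ler_wpM2l ?(ltW r0)//.
  rewrite -!ointZ -?ointD; [|by ctac..].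
  apply: oint_le; [by ctac|by ctac|] => t.
  rewrite -subr_ge0 (_ : _ - _ = (4 * rm3 (jv u) r t - 4^-1 * rm3 w r t) ^+ 2) ?sqr_ge0//.
  by field.
by lra.
Qed.

End modes.

(** * Coercivity of the energy-Casimir form *)

Section coercivity.
Context {R : realType}.
Implicit Types (u : polar_jet R) (w f g : R -> R -> R) (r t : R).
Local Notation j := (j11 R).
Local Notation N := (@phi_norm R).
Local Notation N0 := (@psi_norm R).

Let cphi := @phi_cont R.
Let cpsi := @psi_cont R.

(** The fraction of [|w|^2] left to the quadratic form where [G <= 1/16]; modes 0
    and 1 leave twice as much, as [j^2 * gap = j^2 / 8 - 1]. *)
Definition margin : R := 1 - j ^+ 2 / 16.

Lemma margin_gt0 : 0 < margin.
Proof. by rewrite /margin subr_gt0 ltr_pdivrMr// mul1r j2_lt16. Qed.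

Section radial_split.
Variable g : R -> R.
Hypothesis cg : continuous g.

Definition coef1 := integ 0 1 (fun r => r * g r * phi r) / N.
Definition res1 r := g r - coef1 * phi r.
Definition coef0 := integ 0 1 (fun r => r * g r * psi r) / N0.
Definition res0 r := g r - coef0 * psi r.

Lemma res1_cont : continuous res1. Proof. by rewrite /res1; ctac. Qed.
Lemma res0_cont : continuous res0. Proof. by rewrite /res0; ctac. Qed.

Lemma res1_orth : integ 0 1 (fun r => r * res1 r * phi r) = 0.
Proof.
have n0 := @phi_norm_gt0 R.
transitivity (integ 0 1 (fun r => r * g r * phi r) - coef1 * N).
  rewrite /phi_norm -integZ -?integB; [|by ctac..].
  by congr (integ _ _ _); apply/funext => r; rewrite /res1; ring.
by rewrite /coef1 divfK ?subrr// gt_eqF.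
Qed.

Lemma res0_orth : integ 0 1 (fun r => r * res0 r * psi r) = 0.
Proof.
have n0 := @psi_norm_gt0 R.
transitivity (integ 0 1 (fun r => r * g r * psi r) - coef0 * N0).
  rewrite /psi_norm -integZ -?integB; [|by ctac..].
  by congr (integ _ _ _); apply/funext => r; rewrite /res0; ring.
by rewrite /coef0 divfK ?subrr// gt_eqF.
Qed.

Lemma split1 b : integ 0 1 (fun r => r * (g r - b * phi r) ^+ 2) =
  (coef1 - b) ^+ 2 * N + integ 0 1 (fun r => r * res1 r ^+ 2).
Proof.
have cr := res1_cont.
transitivity ((coef1 - b) ^+ 2 * N + integ 0 1 (fun r => r * res1 r ^+ 2)
   + 2 * (coef1 - b) * integ 0 1 (fun r => r * res1 r * phi r)).
  rewrite /phi_norm -!integZ -?integD; [|by ctac..].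
  by congr (integ _ _ _); apply/funext => r; rewrite /res1; ring.
by rewrite res1_orth mulr0 addr0.
Qed.

Lemma split0 b : integ 0 1 (fun r => r * (g r - b * psi r) ^+ 2) =
  (coef0 - b) ^+ 2 * N0 + integ 0 1 (fun r => r * res0 r ^+ 2).
Proof.
have cr := res0_cont.
transitivity ((coef0 - b) ^+ 2 * N0 + integ 0 1 (fun r => r * res0 r ^+ 2)
   + 2 * (coef0 - b) * integ 0 1 (fun r => r * res0 r * psi r)).
  rewrite /psi_norm -!integZ -?integD; [|by ctac..].
  by congr (integ _ _ _); apply/funext => r; rewrite /res0; ring.
by rewrite res0_orth mulr0 addr0.
Qed.

Lemma sq_ge0 (f : R -> R) : continuous f -> 0 <= integ 0 1 (fun r => r * f r ^+ 2).
Proof.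
move=> cf; apply: integ_ge0 => //; first by ctac.
by move=> r /andP[r0 _]; rewrite mulr_ge0 ?sqr_ge0// ltW.
Qed.

Lemma gap_bounds (f : R -> R) k : continuous f ->
  rad_energy k f f <= gap * integ 0 1 (fun r => r * f r ^+ 2) ->
  margin * integ 0 1 (fun r => r * f r ^+ 2) <=
    integ 0 1 (fun r => r * f r ^+ 2) - j ^+ 2 * rad_energy k f f <=
    integ 0 1 (fun r => r * f r ^+ 2).
Proof.
move=> cf; have := sq_ge0 cf; set X := integ _ _ _ => X0 h.
have E0 := rad_energy_ge0 k cf; have j0 := @j2_gt0 R; have j16 := @j2_lt16 R.
apply/andP; split; last by rewrite gerBl mulr_ge0// ltW.
have : j ^+ 2 * rad_energy k f f <= j ^+ 2 * (gap * X) by rewrite ler_pM2l.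
have -> : j ^+ 2 * (gap * X) = (j ^+ 2 / 8 - 1) * X.
  by rewrite /gap; field; rewrite gt_eqF// j_gt0.
by rewrite /margin; nra.
Qed.

(** The component along [phi] contributes nothing, because [phi] is an
    eigenfunction; the residue is handled by [gap_mode1]. *)
Lemma quad1_bounds : margin * integ 0 1 (fun r => r * res1 r ^+ 2) <=
  integ 0 1 (fun r => r * g r ^+ 2) - j ^+ 2 * rad_energy 1 g g <=
  integ 0 1 (fun r => r * res1 r ^+ 2).
Proof.
have cr := res1_cont; have j0 := @j2_gt0 R.
have n0 := @phi_norm_gt0 R.
have -> : rad_energy 1 g g = rad_energy 1 res1 res1 + coef1 ^+ 2 * N / j ^+ 2.
  have gE : g = fun s => res1 s + coef1 * phi s by apply/funext => s; rewrite /res1 subrK.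
  rewrite {1}gE (@rad_energy_lin _ 1 res1 phi g coef1)// rad_energyC {1}gE.
  rewrite (@rad_energy_lin _ 1 res1 phi res1 coef1)// [rad_energy _ phi res1]rad_energyC.
  rewrite energy_phi// res1_orth mul0r mulr0 addr0 rad_energyC energy_phi//.
  rewrite -[integ _ _ _](@divfK _ N) ?gt_eqF// -/coef1.
  by rewrite expr2; ring.
have -> : integ 0 1 (fun r => r * g r ^+ 2) = coef1 ^+ 2 * N + integ 0 1 (fun r => r * res1 r ^+ 2).
  have := split1 0; rewrite subr0 => <-.
  by congr (integ _ _ _); apply/funext => r; rewrite mul0r subr0.
have -> (X Y Z : R) : Y + X - j ^+ 2 * (Z + Y / j ^+ 2) = X - j ^+ 2 * Z.
  by field; rewrite gt_eqF// j_gt0.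
by apply: gap_bounds => //; apply: gap_mode1 => //; exact: res1_orth.
Qed.

Lemma quad0_bounds : integ 0 1 (fun r => r * g r) = 0 ->
  margin * integ 0 1 (fun r => r * res0 r ^+ 2) <=
    integ 0 1 (fun r => r * g r ^+ 2) - j ^+ 2 * rad_energy 0 g g <=
    integ 0 1 (fun r => r * res0 r ^+ 2).
Proof.
move=> g0.
have cr := res0_cont; have j0 := @j2_gt0 R.
have n0 := @psi_norm_gt0 R.
have m0 : integ 0 1 (fun r => r * res0 r) = 0.
  transitivity (integ 0 1 (fun r => r * g r) - coef0 * integ 0 1 (fun r => r * psi r)).
    by rewrite -integZ -?integB; [congr (integ _ _ _); apply/funext => r; rewrite /res0; ring|by ctac..].
  by rewrite g0 psi_mean mulr0 subr0.
have -> : rad_energy 0 g g = rad_energy 0 res0 res0 + coef0 ^+ 2 * N0 / j ^+ 2.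
  have gE : g = fun s => res0 s + coef0 * psi s by apply/funext => s; rewrite /res0 subrK.
  rewrite {1}gE (@rad_energy_lin _ 0 res0 psi g coef0)// rad_energyC {1}gE.
  rewrite (@rad_energy_lin _ 0 res0 psi res0 coef0)// [rad_energy _ psi res0]rad_energyC.
  rewrite energy_psi// res0_orth mul0r mulr0 addr0 rad_energyC energy_psi//.
  rewrite -[integ _ _ _](@divfK _ N0) ?gt_eqF// -/coef0.
  by rewrite expr2; ring.
have -> : integ 0 1 (fun r => r * g r ^+ 2) = coef0 ^+ 2 * N0 + integ 0 1 (fun r => r * res0 r ^+ 2).
  have := split0 0; rewrite subr0 => <-.
  by congr (integ _ _ _); apply/funext => r; rewrite mul0r subr0.
have -> (X Y Z : R) : Y + X - j ^+ 2 * (Z + Y / j ^+ 2) = X - j ^+ 2 * Z.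
  by field; rewrite gt_eqF// j_gt0.
by apply: gap_bounds => //; apply: gap_mode0 => //; exact: res0_orth.
Qed.

End radial_split.

Lemma integ_id : integ 0 1 (fun x : R => x) = 1 / 2.
Proof.
rewrite (@integ_primitive _ _ (fun x => x ^+ 2 / 2)); first by rewrite expr0n /=; field.
by move=> x; apply: der_eq; [dtac|rewrite /=; field].
Qed.

Lemma integ_cube : integ 0 1 (fun x : R => x ^+ 3) = 1 / 4.
Proof.
rewrite (@integ_primitive _ _ (fun x => x ^+ 4 / 4)); first by rewrite expr0n /=; field.
by move=> x; apply: der_eq; [dtac|rewrite /=; field].
Qed.

Lemma integ_pow5 : integ 0 1 (fun x : R => x ^+ 5) = 1 / 6.
Proof.
rewrite (@integ_primitive _ _ (fun x => x ^+ 6 / 6)); first by rewrite expr0n /=; field.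
by move=> x; apply: der_eq; [dtac|rewrite /=; field].
Qed.

Lemma rad_sol_one : @rad_sol R 0 (fun r => (1 - r ^+ 2) / 4) (fun=> 1).
Proof.
split; [by ctac|by rewrite expr1n subrr mul0r|].
move=> r /andP[r0 r1]; apply: (@der_ext _ (fun r => (1 - r ^+ 2) / 4)).
  by move=> s; rewrite expr0 invr1 mulr1.
apply: der_eq; first by dtac.
rewrite /mom (@integ_primitive _ _ (fun x => x ^+ 2 / 2)).
  by rewrite expr0n muln0 /=; field; rewrite gt_eqF.
by move=> x; apply: der_eq; [dtac|rewrite /=; field].
Qed.

(** Used to subtract the mean, since [(1 - r^2) / 4] is the stream function of 1. *)
Lemma energy_one (g : R -> R) : continuous g ->
  rad_energy 0 g (fun=> 1) = (integ 0 1 (fun r => r * g r) - integ 0 1 (fun r => r ^+ 3 * g r)) / 4.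
Proof.
move=> cg; rewrite -(rad_sol_energy rad_sol_one)//; last exact: cst_continuous.
rewrite -integB; [|by ctac..]; rewrite mulrC -integZ; last by ctac.
by congr (integ _ _ _); apply/funext => r; ring.
Qed.

Section functionals.
Variable w : R -> R -> R.
Hypothesis cw : cont2 w.

Definition pmean := integ 0 1 (fun r => r * mode a_one w r).
Definition pmom3 := integ 0 1 (fun r => r ^+ 3 * mode a_one w r).
Definition g0 r := mode a_one w r - 2 * pmean.
Definition pcoef := coef0 g0.
Definition ccoef := coef1 (mode a_cos w).
Definition scoef := coef1 (mode a_sin w).

(** The squared distance of the mean-zero part of [w] to the eigenspace. *)
Definition rho := integ 0 1 (fun r => r * res0 g0 r ^+ 2) / (2 * pi)
  + integ 0 1 (fun r => r * res1 (mode a_cos w) r ^+ 2) / pi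
  + integ 0 1 (fun r => r * res1 (mode a_sin w) r ^+ 2) / pi
  + pin (rm3 w) (rm3 w).

Let c1 : continuous (mode a_one w). Proof. exact: mode_cont. Qed.
Let c2 : continuous (mode a_cos w). Proof. exact: mode_cont. Qed.
Let c3 : continuous (mode a_sin w). Proof. exact: mode_cont. Qed.
Let cg0 : continuous g0. Proof. have h := c1; rewrite /g0; ctac. Qed.

Lemma g0_mean : integ 0 1 (fun r => r * g0 r) = 0.
Proof.
transitivity (pmean - 2 * pmean * integ 0 1 (fun r => r)); last by rewrite integ_id; field.
rewrite {1}/pmean -integZ -?integB; [|by ctac..].
by congr (integ _ _ _); apply/funext => r; rewrite /g0; ring.
Qed.

Lemma g0_mom3 : integ 0 1 (fun r => r ^+ 3 * g0 r) = pmom3 - pmean / 2.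
Proof.
transitivity (pmom3 - 2 * pmean * integ 0 1 (fun r => r ^+ 3)); last by rewrite integ_cube; field.
rewrite /pmom3 -integZ -?integB; [|by ctac..].
by congr (integ _ _ _); apply/funext => r; rewrite /g0; ring.
Qed.

Lemma pin_ge0 f : cont2 f -> 0 <= pin f f.
Proof.
move=> cf; apply: integ_ge0 => //; first exact: pin_cont.
move=> r /andP[r0 _]; rewrite mulr_ge0 ?(ltW r0)//.
by apply: oint_ge0 => [|t]; [have h := slice (r := r) cf; ctac|rewrite -expr2 sqr_ge0].
Qed.

Lemma rho_terms : [/\ 0 <= integ 0 1 (fun r => r * res0 g0 r ^+ 2),
  0 <= integ 0 1 (fun r => r * res1 (mode a_cos w) r ^+ 2),
  0 <= integ 0 1 (fun r => r * res1 (mode a_sin w) r ^+ 2) &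
  0 <= pin (rm3 w) (rm3 w)].
Proof.
split.
- by apply/sq_ge0/res0_cont; exact: cg0.
- by apply/sq_ge0/res1_cont; exact: c2.
- by apply/sq_ge0/res1_cont; exact: c3.
- by apply: pin_ge0; exact: rm3_cont.
Qed.

Lemma rho_ge0 : 0 <= rho.
Proof.
have [h1 h2 h3 h4] := rho_terms; have pi0 := @pi_ge0 R.
by rewrite /rho !addr_ge0// divr_ge0// mulr_ge0.
Qed.

(** The left side is the third moment of the radial residue, hence controlled by
    the residue itself. *)
Lemma moment_bound :
  (pmom3 - pmean / 2 - pcoef * integ 0 1 (fun r => r ^+ 3 * psi r)) ^+ 2 <= 2 * rho.
Proof.
have [h1 h2 h3 h4] := rho_terms; have pi0 := @pi_gt0 R.
have cr : continuous (res0 g0) by apply: res0_cont; exact: cg0.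
set X := integ 0 1 (fun r => r * res0 g0 r ^+ 2) in h1.
have -> : pmom3 - pmean / 2 - pcoef * integ 0 1 (fun r => r ^+ 3 * psi r) =
   integ 0 1 (fun r => r ^+ 3 * res0 g0 r).
  rewrite -g0_mom3 -integZ -?integB; [|by ctac..].
  by congr (integ _ _ _); apply/funext => r; rewrite /res0 /pcoef; ring.
have : integ 0 1 (fun r => r ^+ 3 * res0 g0 r) ^+ 2 <= 1 / 6 * X.
  apply: discriminant_le => // s.
  rewrite -integ_pow5 /X -!integZ -?integB -?integD; [|by ctac..].
  apply: integ_ge0 => //; first by ctac.
  move=> r /andP[r0 _]; rewrite (_ : _ + _ = r * (r ^+ 2 - s * res0 g0 r) ^+ 2).
    by rewrite mulr_ge0 ?sqr_ge0// ltW.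
  by ring.
move=> h; apply: (le_trans h).
have hX : X / (2 * pi) <= rho.
  by rewrite /rho -/X -!addrA lerDl !addr_ge0// divr_ge0// ltW.
have : 1 / 6 * X <= 2 * (X / (2 * pi)).
  have -> : 2 * (X / (2 * pi)) = X / pi by pifield.
  have p4 : pi <= 6 :> R by have := @pi_le R; lra.
  rewrite mul1r mulrC; apply: ler_wpM2l => //.
  by rewrite lef_pV2 ?posrE.
by lra.
Qed.

(** The form [Z - j^2 E] of the mean-zero part, as a function of the conserved
    quantities of [w] itself; the last two terms remove the contribution of the
    mean. *)
Definition Qf (Z E m M : R) :=
  Z - j ^+ 2 * E - m ^+ 2 / pi - j ^+ 2 * (m * (M - m / 2) - m ^+ 2 / 4) / (2 * pi).

Lemma mode_sq_split : integ 0 1 (fun r => r * mode a_one w r * mode a_one w r) =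
  integ 0 1 (fun r => r * g0 r ^+ 2) + 2 * pmean ^+ 2.
Proof.
transitivity (integ 0 1 (fun r => r * g0 r ^+ 2) + 4 * pmean ^+ 2 * integ 0 1 (fun r => r)
   + 4 * pmean * integ 0 1 (fun r => r * g0 r)); last first.
  by rewrite g0_mean integ_id; field.
have [m mE] : exists m, m = pmean by exists pmean.
have cg := cg0; rewrite -mE -!integZ -?integD; [|by ctac..].
by congr (integ _ _ _); apply/funext => r; rewrite /g0 -mE; ring.
Qed.

Lemma mode_energy_split : rad_energy 0 (mode a_one w) (mode a_one w) =
  rad_energy 0 g0 g0 - pmean * (pmom3 - pmean / 2) + pmean ^+ 2 / 4.
Proof.
have c0 : continuous (fun _ : R => 1 : R) by ctac.
have gE : mode a_one w = fun s => g0 s + 2 * pmean * 1 by apply/funext => s; rewrite /g0; ring.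
have e1 := energy_one cg0; rewrite g0_mean g0_mom3 in e1.
have e2 := energy_one c0.
have e3 : rad_energy 0 (fun=> 1) (fun=> 1 : R) = 1 / 16.
  rewrite e2 (_ : (fun r => r * 1) = (fun r : R => r)); last by apply/funext => r; rewrite mulr1.
  rewrite (_ : (fun r => r ^+ 3 * 1) = (fun r : R => r ^+ 3)); last by apply/funext => r; rewrite mulr1.
  by rewrite integ_id integ_cube; field.
have cm : continuous (mode a_one w) by [].
rewrite {1}gE (@rad_energy_lin _ 0 g0 (fun=> 1) (mode a_one w) (2 * pmean))//.
rewrite rad_energyC {1}gE (@rad_energy_lin _ 0 g0 (fun=> 1) g0 (2 * pmean))//.
rewrite [rad_energy _ _ (mode a_one w)]rad_energyC {1}gE (@rad_energy_lin _ 0 g0 (fun=> 1) (fun=> 1) (2 * pmean))//.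
by rewrite [rad_energy 0 (fun=> 1) g0]rad_energyC e1 e3; field.
Qed.

(** The quadratic form [|w|^2 - j^2 <w, G w>] of the mean-zero part of [w]
    vanishes on the eigenspace and is coercive on its complement. Both follow
    mode by mode. *)
Lemma Q_bounds u : polar_sol u w ->
  margin * rho <= Qf (pin w w) (pin w (jv u)) pmean pmom3 <= rho.
Proof.
move=> uw; have [h1 h2 h3 h4] := rho_terms; have pi0 := @pi_gt0 R.
have [eE e0 e16] := polar_energy uw.
have b0 := quad0_bounds cg0 g0_mean.
have bc := quad1_bounds c2; have bs := quad1_bounds c3.
have sqE (a : amode R) : integ 0 1 (fun r => r * mode a w r * mode a w r) =
   integ 0 1 (fun r => r * mode a w r ^+ 2).
  by congr (integ _ _ _); apply/funext => r; ring.
rewrite /= in b0 bc bs.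
rewrite /Qf eE (pin_split cw cw) mode_sq_split mode_energy_split !sqE /rho.
move: b0 bc bs h1 h2 h3 h4 e0 e16.
set X0 := integ 0 1 (fun r => r * res0 g0 r ^+ 2).
set Xc := integ 0 1 (fun r => r * res1 (mode a_cos w) r ^+ 2).
set Xs := integ 0 1 (fun r => r * res1 (mode a_sin w) r ^+ 2).
set Y0 := integ 0 1 (fun r => r * g0 r ^+ 2).
set Yc := integ 0 1 (fun r => r * mode a_cos w r ^+ 2).
set Ys := integ 0 1 (fun r => r * mode a_sin w r ^+ 2).
set E0 := rad_energy 0 g0 g0.
set Ec := rad_energy 1 (mode a_cos w) _; set Es := rad_energy 1 (mode a_sin w) _.
set X := pin (rm3 w) (rm3 w); set E := pin (rm3 w) _.
move=> /andP[b0 b0'] /andP[bc bc'] /andP[bs bs'] h1 h2 h3 h4 e0 e16.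
have j0 := @j2_gt0 R.
have Xb : margin * X <= X - j ^+ 2 * E.
  have : j ^+ 2 * (16 * E) <= j ^+ 2 * X by rewrite ler_pM2l.
  by rewrite /margin; lra.
have Xb' : X - j ^+ 2 * E <= X by rewrite gerBl mulr_ge0// ltW.
set m := pmean; set M := pmom3.
have -> : (Y0 + 2 * m ^+ 2) / (2 * pi) + Yc / pi + Ys / pi + X
   - j ^+ 2 * ((E0 - m * (M - m / 2) + m ^+ 2 / 4) / (2 * pi) + Ec / pi + Es / pi + E)
   - m ^+ 2 / pi - j ^+ 2 * (m * (M - m / 2) - m ^+ 2 / 4) / (2 * pi) =
   (Y0 - j ^+ 2 * E0) / (2 * pi) + (Yc - j ^+ 2 * Ec) / pi + (Ys - j ^+ 2 * Es) / pi
   + (X - j ^+ 2 * E).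
  by pifield.
have p1 : 0 < (2 * pi)^-1 :> R by rewrite invr_gt0 mulr_gt0.
have p2 : 0 < pi^-1 :> R by rewrite invr_gt0.
apply/andP; split.
  have sc c x y : 0 < c -> margin * x <= y -> margin * (x * c) <= y * c.
    by move=> c0 h; rewrite mulrA ler_wpM2r// ltW.
  rewrite 3!(mulrDr margin); apply: lerD => //; apply: lerD; last exact: sc.
  by apply: lerD; exact: sc.
by rewrite !lerD// ler_wpM2r// ltW.
Qed.

(** Eigenfunctions written with the Cartesian components of amplitude and phase,
    in which the orbit is a circle. *)
Definition eigf (A b1 b2 : R) r t := A * psi r + phi r * (b1 * cos t + b2 * sin t).

Lemma eigf_cont A b1 b2 : cont2 (eigf A b1 b2).
Proof.
cintro2 p; rewrite /eigf.
have h1 : {for p, continuous (fun p : R * R => psi p.1)}.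
  by apply: (@cont_comp _ _ (fun p : R * R => p.1)); [exact: cont_fst|exact: cpsi].
have h2 : {for p, continuous (fun p : R * R => phi p.1)}.
  by apply: (@cont_comp _ _ (fun p : R * R => p.1)); [exact: cont_fst|exact: cphi].
by ctac.
Qed.

Definition dev A b1 b2 r t := w r t - eigf A b1 b2 r t.

(** Pythagoras: mean, three coordinates in the eigenspace, and the distance to it. *)
Lemma pin_dist A b1 b2 : pin (dev A b1 b2) (dev A b1 b2) = pmean ^+ 2 / pi + (pcoef - 2 * pi * A) ^+ 2 * N0 / (2 * pi)
   + ((ccoef - pi * b1) ^+ 2 + (scoef - pi * b2) ^+ 2) * N / pi + rho.
Proof.
set d := dev A b1 b2.
have ce := @eigf_cont A b1 b2.
have cd : cont2 d by cintro2 p; apply: contB; [exact: cw|exact: ce].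
have pi0 := @pi_gt0 R; have pin0 : pi != 0 :> R by rewrite gt_eqF.
have ccos := @continuous_cos R; have csin := @continuous_sin R.
have cwr r : continuous (w r) by exact: slice.
have lin (a : amode R) (o c s : R) r :
   oint (af a) = o -> oint (fun t => cos t * af a t) = c -> oint (fun t => sin t * af a t) = s ->
   mode a d r = mode a w r - (A * psi r * o + phi r * (b1 * c + b2 * s)).
  move=> <- <- <-; have ca := @a_cont _ a; have h := cwr r.
  rewrite /mode /d /dev /eigf.
  transitivity (oint (fun t => w r t * af a t) - (A * psi r * oint (af a)
     + phi r * b1 * oint (fun t => cos t * af a t) + phi r * b2 * oint (fun t => sin t * af a t))); last by ring.
  rewrite -!ointZ -?ointD -?ointB; [|by ctac..].
  by congr oint; apply/funext => t; ring.
have m1 r : mode a_one d r = mode a_one w r - 2 * pi * A * psi r.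
  rewrite (@lin a_one (2 * pi) 0 0)//=; first by ring.
  - by rewrite oint_cst mulr1.
  - by under eq_fun do rewrite mulr1; exact: oint_cos.
  - by under eq_fun do rewrite mulr1; exact: oint_sin.
have m2 r : mode a_cos d r = mode a_cos w r - pi * b1 * phi r.
  rewrite (@lin a_cos 0 pi 0)//=; first by ring.
  - exact: oint_cos.
  - by under eq_fun do rewrite -expr2; exact: oint_cos2.
  - by under eq_fun do rewrite mulrC; exact: oint_cossin.
have m3 r : mode a_sin d r = mode a_sin w r - pi * b2 * phi r.
  rewrite (@lin a_sin 0 0 pi)//=; first by ring.
  - exact: oint_sin.
  - exact: oint_cossin.
  - by under eq_fun do rewrite -expr2; exact: oint_sin2.
have e1 : integ 0 1 (fun r => r * mode a_one d r * mode a_one d r) =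
   2 * pmean ^+ 2 + ((pcoef - 2 * pi * A) ^+ 2 * N0 + integ 0 1 (fun r => r * res0 g0 r ^+ 2)).
  rewrite -split0//.
  transitivity (4 * pmean ^+ 2 * integ 0 1 (fun r => r)
     + integ 0 1 (fun r => r * (g0 r - 2 * pi * A * psi r) ^+ 2)
     + 4 * pmean * (integ 0 1 (fun r => r * g0 r) - 2 * pi * A * integ 0 1 (fun r => r * psi r))).
    have [m mE] : exists m, m = pmean by exists pmean.
    have cg := cg0; rewrite -mE -!integZ -?integB -?integZ -?integD; [|by ctac..].
    by congr (integ _ _ _); apply/funext => r; rewrite m1 /g0 -mE; ring.
  by rewrite g0_mean psi_mean integ_id; field.
have e2 : integ 0 1 (fun r => r * mode a_cos d r * mode a_cos d r) =
   (ccoef - pi * b1) ^+ 2 * N + integ 0 1 (fun r => r * res1 (mode a_cos w) r ^+ 2).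
  by rewrite -split1//; congr (integ _ _ _); apply/funext => r; rewrite m2; ring.
have e3 : integ 0 1 (fun r => r * mode a_sin d r * mode a_sin d r) =
   (scoef - pi * b2) ^+ 2 * N + integ 0 1 (fun r => r * res1 (mode a_sin w) r ^+ 2).
  by rewrite -split1//; congr (integ _ _ _); apply/funext => r; rewrite m3; ring.
have e4 : rm3 d = rm3 w.
  have E (f : R -> R -> R) r t : cont2 f -> rm3 f r t = f r t - mode a_one f r / (2 * pi)
      - mode a_cos f r * cos t / pi - mode a_sin f r * sin t / pi.
    move=> cf; have cf1 := @rm_cont _ a_one _ cf; have cf2 := @rm_cont _ a_cos _ cf1.
    rewrite /rm3 {1}/rm {1}/rm {1}/rm.
    have oc : oint (fun t => af a_one t * af a_cos t) = 0 :> R.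
      by rewrite /=; under eq_fun do rewrite mul1r; exact: oint_cos.
    have os : oint (fun t => af a_one t * af a_sin t) = 0 :> R.
      by rewrite /=; under eq_fun do rewrite mul1r; exact: oint_sin.
    have cs : oint (fun t => af a_cos t * af a_sin t) = 0 :> R by exact: oint_cossin.
    have -> : mode a_cos (rm a_one f) r = mode a_cos f r by rewrite mode_rm.
    have -> : mode a_sin (rm a_cos (rm a_one f)) r = mode a_sin f r by rewrite !mode_rm.
    by rewrite /= mulr1.
  apply/funext => r; apply/funext => t; rewrite !E// m1 m2 m3 /d /dev /eigf.
  by pifield.
by rewrite (pin_split cd cd) e1 e2 e3 e4 /rho; pifield.
Qed.

End functionals.
End coercivity.

(** * Chain rule and maximum principle in the plane *)

Section curves.
Context {R : realType}.

(** All polar derivatives below are obtained from this rule. *)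
Lemma der_curve (V : normedModType R) (F : V -> R) (c : R -> V) (s : R) c' :
  is_derive s 1 c c' -> differentiable F (c s) -> der s (fun s => F (c s)) ('D_c' F (c s)).
Proof.
move=> [dc <-] dF; have dc' : differentiable c s by apply/derivable1_diffP.
have dFc : differentiable (F \o c) s by exact: differentiable_comp.
split; first by apply/derivable1_diffP.
by rewrite !deriveE// diff_comp.
Qed.

Lemma is_derive_pair (V1 V2 : normedModType R) (a : R -> V1) (b : R -> V2) (s : R) a' b' :
  is_derive s 1 a a' -> is_derive s 1 b b' ->
  is_derive s 1 (fun s => (a s, b s)) (a', b').
Proof.
move=> [da <-] [db <-].
have da' : differentiable a s by apply/derivable1_diffP.
have db' : differentiable b s by apply/derivable1_diffP.
have dab : differentiable (fun s => (a s, b s)) s by exact: differentiable_pair.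
split; first by apply/derivable1_diffP.
by rewrite !deriveE// diff_pair.
Qed.

Definition e1 : R * R := (1, 0).
Definition e2 : R * R := (0, 1).

Lemma dir_split (F : R * R -> R) x a b : differentiable F x ->
  'D_(a, b) F x = a * 'D_e1 F x + b * 'D_e2 F x.
Proof.
move=> dF; rewrite !deriveE// -[in RHS]linearZ/= -[X in _ + X]linearZ/= -linearD/=.
by congr ('d F x _); rewrite /e1 /e2 [RHS]/GRing.add /=; congr pair; rewrite /= /GRing.scale /=; ring.
Qed.

Lemma der_plane (F : R * R -> R) (a b : R -> R) s a' b' :
  der s a a' -> der s b b' -> differentiable F (a s, b s) ->
  der s (fun s => F (a s, b s)) (a' * 'D_e1 F (a s, b s) + b' * 'D_e2 F (a s, b s)).
Proof.
by move=> da db dF; rewrite -dir_split//; apply: (@der_curve _ F (fun s => (a s, b s))) => //; exact: is_derive_pair.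
Qed.

Definition k0 : R * (R * R) := (1, (0, 0)).
Definition k1 : R * (R * R) := (0, (1, 0)).
Definition k2 : R * (R * R) := (0, (0, 1)).

Lemma dir_split3 (F : R * (R * R) -> R) x a b c : differentiable F x ->
  'D_(a, (b, c)) F x = a * 'D_k0 F x + b * 'D_k1 F x + c * 'D_k2 F x.
Proof.
move=> dF; rewrite !deriveE// -[X in _ = X + _ + _]linearZ/= -[X in _ = _ + X + _]linearZ/=.
rewrite -[X in _ = _ + X]linearZ/= -linearD/= -linearD/=.
congr ('d F x _); rewrite /k0 /k1 /k2 ![in RHS]/GRing.add /=.
by congr (_, (_, _)); rewrite /= /GRing.scale /=; ring.
Qed.

Lemma der_space (F : R * (R * R) -> R) (a b c : R -> R) s a' b' c' :
  der s a a' -> der s b b' -> der s c c' -> differentiable F (a s, (b s, c s)) ->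
  der s (fun s => F (a s, (b s, c s)))
    (a' * 'D_k0 F (a s, (b s, c s)) + b' * 'D_k1 F (a s, (b s, c s)) + c' * 'D_k2 F (a s, (b s, c s))).
Proof.
move=> da db dc dF; rewrite -dir_split3//; apply: (@der_curve _ F (fun s => (a s, (b s, c s)))) => //.
by apply: is_derive_pair => //; exact: is_derive_pair.
Qed.

Lemma der_bound_near (f : R -> R) x d e : der x f d -> 0 < e ->
  \forall y \near x, `|f y - f x - d * (y - x)| <= e * `|y - x|.
Proof.
move=> [df dE] e0.
have /cvgrPdist_le/(_ e e0) : (fun h => h^-1 *: ((f \o shift x) (h *: (1:R)) - f x)) @ 0^' --> d.
  by rewrite -dE; exact: df.
rewrite near_withinE => H; apply/nbhs0P; apply: filterS H => h H.
have [->|h0] := eqVneq h 0; first by rewrite addr0 !subrr mulr0 subrr normr0 mulr0.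
have := H h0; rewrite /GRing.scale/= mulr1 [h + x]addrC => {}H.
rewrite (_ : _ - _ = - h * (d - h^-1 * (f (x + h) - f x))); last by field.
by rewrite normrM normrN [x + h]addrC addrK mulrC ler_wpM2r// addrC.
Qed.

Lemma second_derivative_test (g g' : R -> R) x d e : 0 < e ->
  (forall s, x - e < s < x + e -> der s g (g' s)) -> der x g' d ->
  (forall s, x - e < s < x + e -> g s <= g x) -> d <= 0.
Proof.
move=> e0 dg dg' mx; rewrite leNgt; apply/negP => d0.
have g'0 : g' x = 0.
  have xe : x - e < x < x + e by lra.
  apply: der_uniq (dg x xe) _; apply: (@derive1_at_max _ g (x - e) (x + e) x); rewrite ?in_itv//=.
  - lra.
  - by move=> s; rewrite in_itv/= => /dg[].
have d2 : 0 < d / 2 by rewrite divr_gt0.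
have /nbhs_ballP[r /= r0 hr] := der_bound_near dg' d2.
pose y := x + Num.min r e / 2.
have me : 0 < Num.min r e by rewrite lt_min r0 e0.
have [mr me'] : Num.min r e <= r /\ Num.min r e <= e by rewrite !ge_min !lexx orbT.
have [c cxy gc] : exists2 c, x < c < y & g y - g x = g' c * (y - x).
  have xy : x < y by rewrite ltrDl divr_gt0.
  have [||c] := @MVT R g g' x y xy.
  - by move=> s; rewrite in_itv/= => /andP[s1 s2]; apply: dg; rewrite /y in s2; lra.
  - apply: continuous_in_subspaceT => s; rewrite inE/= in_itv/= => /andP[s1 s2].
    by apply: der_cont (dg s _); rewrite /y in s2; lra.
  - by rewrite in_itv /=; exists c.
have /andP[c1 c2] := cxy; rewrite /y in c2.
have := hr c; rewrite /ball/= distrC gtr0_norm ?subr_gt0// => /(_ (ltac:(lra))).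
rewrite g'0 subr0 => h.
have g'c : 0 < g' c by move: h; rewrite ler_norml => /andP[h _]; nra.
have := mx y (ltac:(rewrite /y; lra)).
have : 0 < g' c * (y - x) by rewrite mulr_gt0// /y; lra.
by rewrite -gc; lra.
Qed.

Lemma closed_disk_compact : compact (@closed_disk R).
Proof.
have c1 : closed (@closed_disk R).
  apply: (preimage_closed (f := fun x : R * R => x.1 ^+ 2 + x.2 ^+ 2) _ (@closed_le R 1)).
  move=> x _; have h1 := @cont_fst R R x; have h2 := @cont_snd R R x.
  by change {for x, continuous (fun x : R * R => x.1 ^+ 2 + x.2 ^+ 2)}; ctac.
have c2 : compact (`[-1, 1]%classic `*` `[-1, 1]%classic : set (R * R)).
  by apply: compact_setX; exact: segment_compact.
apply: (subclosed_compact c1 c2) => -[x y]; rewrite /closed_disk/= !in_itv/= -!ler_norml => h.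
have := sqr_ge0 x; have := sqr_ge0 y => y0 x0.
by split; rewrite -(@expr_le1 _ 2)// real_normK ?num_real//; lra.
Qed.

Lemma disk_line (c v : R * R) : disk c -> exists2 e, 0 < e & forall s : R, - e < s < e -> disk (c + s *: v).
Proof.
move=> dc.
have cl : {for 0, continuous (fun s : R => (c.1 + s * v.1) ^+ 2 + (c.2 + s * v.2) ^+ 2)}.
  by ctac.
have : \forall s \near (0:R), (c.1 + s * v.1) ^+ 2 + (c.2 + s * v.2) ^+ 2 < 1.
  by apply: (cvgr_lt _ cl); rewrite !mul0r !addr0.
move=> /nbhs_ballP[e /= e0 he]; exists e => // s hs.
by apply: he; rewrite /ball/= sub0r normrN ltr_norml.
Qed.

Lemma line_der (c v : R * R) (s : R) : is_derive s 1 (fun s => c + s *: v) v.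
Proof.
case: v => v1 v2; change (is_derive s 1 (fun s => (c.1 + s * v1, c.2 + s * v2)) (v1, v2)).
by apply: is_derive_pair; apply: der_eq; [dtac|rewrite /=; ring|dtac|rewrite /=; ring].
Qed.

(** At an interior maximum of [u1 - u2 + (M / 4 + e) |x|^2] the second derivatives
    are nonpositive, whereas the Laplacian is at least [4 e]. So the maximum is
    on the circle; then [e] tends to 0. The factor [1 - |x|^2] is the rate at
    which stream functions vanish at the circle. *)
Lemma max_principle (u1 u2 w1 w2 : R * R -> R) M :
  inverse_laplacian w1 u1 -> inverse_laplacian w2 u2 ->
  (forall x, disk x -> w1 x - w2 x <= M) ->
  forall x, closed_disk x -> u1 x - u2 x <= M * (1 - (x.1 ^+ 2 + x.2 ^+ 2)) / 4.
Proof.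
move=> [s1 c1 eq1 b1] [s2 c2 eq2 b2] hM x cx.
apply/ler_addgt0Pl => e ep.
pose q (x : R * R) := (M / 4 + e) * (x.1 ^+ 2 + x.2 ^+ 2) - M / 4.
pose h (x : R * R) := u1 x - u2 x + q x.
have cq : continuous q.
  move=> y; have h1 := @cont_fst R R y; have h2 := @cont_snd R R y.
  by change {for y, continuous (fun x : R * R => (M / 4 + e) * (x.1 ^+ 2 + x.2 ^+ 2) - M / 4)}; ctac.
have ch : {within @closed_disk R, continuous h}.
  move=> y; apply: cvgD; first by apply: cvgB; [exact: c1|exact: c2].
  exact: (continuous_subspaceT cq).
have [|c cc mc] := compact_EVT_max _ closed_disk_compact ch; first by exists x.
have {}mc y : closed_disk y -> h y <= h c by move=> cy; apply: mc; rewrite inE.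
move: cc; rewrite inE /closed_disk/= le_eqVlt => /orP[/eqP cc|dc].
  have := mc x cx; rewrite /h /q (b1 c cc) (b2 c cc) cc.
  have : 0 <= e * (x.1 ^+ 2 + x.2 ^+ 2) by rewrite mulr_ge0 ?addr_ge0 ?sqr_ge0// ltW.
  by lra.
exfalso.
have D2 v : 'D_v ('D_v u1) c - 'D_v ('D_v u2) c + 2 * (M / 4 + e) * (v.1 ^+ 2 + v.2 ^+ 2) <= 0.
  have [d d0 hd] := disk_line v dc.
  pose l s := c + s *: v.
  have l0 : l 0 = c by rewrite /l scale0r addr0.
  pose k := M / 4 + e.
  have dq s : der s (fun s => q (l s)) (2 * k * ((c.1 + s * v.1) * v.1 + (c.2 + s * v.2) * v.2)).
    apply: (@der_ext _ (fun s => k * ((c.1 + s * v.1) ^+ 2 + (c.2 + s * v.2) ^+ 2) - M / 4)) => //.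
    by apply: der_eq; [dtac|rewrite /=; ring].
  apply: (@second_derivative_test (fun s => h (l s)) (fun s => 'D_v u1 (l s) - 'D_v u2 (l s) +
     2 * k * ((c.1 + s * v.1) * v.1 + (c.2 + s * v.2) * v.2)) 0 _ d d0).
  - move=> s; rewrite sub0r add0r => sd; have ds := hd s sd.
    apply: derD; last exact: dq.
    by apply: derB; apply: der_curve; [exact: line_der|have [] := s1 _ ds|exact: line_der|have [] := s2 _ ds].
  - apply: der_eq.
      apply: derD; last by dtac.
      apply: derB.
        apply: (@der_curve _ ('D_v u1) l 0 v); first exact: line_der.
        by rewrite l0; have [_ h1 _] := s1 _ dc; exact: h1.
      apply: (@der_curve _ ('D_v u2) l 0 v); first exact: line_der.
      by rewrite l0; have [_ h1 _] := s2 _ dc; exact: h1.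
    rewrite l0 /k /=; move: ('D_v ('D_v u1) c) ('D_v ('D_v u2) c) (v.1) (v.2) => A B a b.
    by ring.
  - move=> s; rewrite sub0r add0r => sd; rewrite l0; apply: mc.
    by have := hd s sd; rewrite /disk /closed_disk /=; exact: ltW.
have := D2 e1; have := D2 e2; have := hM c dc.
have := eq1 c dc; have := eq2 c dc; rewrite /laplacian /partial1 /partial2 /e1 /e2 /=.
move: ('D_(1, 0) ('D_(1, 0) u1) c) ('D_(0, 1) ('D_(0, 1) u1) c) ('D_(1, 0) ('D_(1, 0) u2) c)
  ('D_(0, 1) ('D_(0, 1) u2) c) (w1 c) (w2 c) => A1 A2 B1 B2 z1 z2.
by rewrite expr0n expr1n /=; lra.
Qed.

End curves.

(** * From Cartesian to polar coordinates *)

Section to_polar.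
Context {R : realType}.
Implicit Types (u w : R * R -> R) (r t : R).

Definition pt r t : R * R := (r * cos t, r * sin t).

Lemma pt_sq r t : (pt r t).1 ^+ 2 + (pt r t).2 ^+ 2 = r ^+ 2.
Proof. by rewrite /pt /= !exprMn -mulrDr cos2Dsin2 mulr1. Qed.

Lemma pt_disk r t : -1 < r < 1 -> disk (pt r t).
Proof.
move=> h; rewrite /disk /= pt_sq -real_normK ?num_real// expr_lt1 ?normr_ge0//.
by rewrite ltr_norml.
Qed.

Lemma pt_closed_disk r t : -1 <= r <= 1 -> closed_disk (pt r t).
Proof.
move=> h; rewrite /closed_disk /= pt_sq -real_normK ?num_real// expr_le1 ?normr_ge0//.
by rewrite ler_norml.
Qed.

Lemma pt_per r t : pt r (t + 2 * pi) = pt r t.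
Proof. by have h1 := @cos_per2pi R t; have h2 := @sin_per2pi R t; rewrite /pt h1 h2. Qed.

(** A stream function is given on the closed disk and vanishes on the circle, so
    this extension is continuous on the plane. *)
Definition ext u (x : R * R) := if x.1 ^+ 2 + x.2 ^+ 2 <= 1 then u x else 0.

Lemma cont_sqnorm : continuous (fun x : R * R => x.1 ^+ 2 + x.2 ^+ 2).
Proof.
move=> x; have h1 := @cont_fst R R x; have h2 := @cont_snd R R x.
by change {for x, continuous (fun x : R * R => x.1 ^+ 2 + x.2 ^+ 2)}; ctac.
Qed.

Lemma ext_cont u : {within @closed_disk R, continuous u} ->
  (forall x, circle x -> u x = 0) -> continuous (ext u).
Proof.
move=> cu u0; apply/continuous_subspace_setT.
have -> : setT = @closed_disk R `|` [set x | 1 <= x.1 ^+ 2 + x.2 ^+ 2].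
  apply/esym/seteqP; split => // x _ /=; rewrite /closed_disk /=.
  by case: (leP (x.1 ^+ 2 + x.2 ^+ 2) 1) => h; [left|right; exact: ltW].
apply: withinU_continuous.
- by apply: (preimage_closed (f := fun x : R * R => x.1 ^+ 2 + x.2 ^+ 2) _ (@closed_le R 1)) => x _; exact: cont_sqnorm.
- by apply: (preimage_closed (f := fun x : R * R => x.1 ^+ 2 + x.2 ^+ 2) _ (@closed_ge R 1)) => x _; exact: cont_sqnorm.
- apply: (@subspace_eq_continuous _ _ _ u) => //.
  by move=> x; rewrite inE => cx; rewrite /from_subspace /ext; move: cx; rewrite /closed_disk/= => ->.
- apply: (@subspace_eq_continuous _ _ _ (fun=> 0)).
    move=> x; rewrite inE/= => h; rewrite /from_subspace /ext; case: ifP => // h'.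
    by apply/esym/u0/eqP; rewrite eq_le h h'.
  by apply: continuous_subspaceT; exact: cst_continuous.
Qed.

Lemma cont_pt_at (F : R * R -> R) r t : {for pt r t, continuous F} ->
  cont2_at (fun r t => F (pt r t)) r t.
Proof.
move=> cF; rewrite /cont2_at.
have h1 := @cont_fst R R (r, t); have h2 := @cont_snd R R (r, t).
apply: (@cont_pair _ _ _ _ (fun x y => F (x, y)) (fun p : R * R => p.1 * cos p.2) (fun p : R * R => p.1 * sin p.2)).
- by rewrite /prop_for /continuous_at /=; move: cF; rewrite (_ : (fun p => F (p.1, p.2)) = F)//; apply/funext => -[].
- by ctac.
- by ctac.
Qed.

Lemma cont_pt (F : R * R -> R) : continuous F -> cont2 (fun r t => F (pt r t)).
Proof. by move=> cF [r t]; apply: cont_pt_at; exact: cF. Qed.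

(** The gradient as a pair of functions, so that slices of a function of time and
    position can be given theirs directly. *)
Definition has_grad (F F1 F2 : R * R -> R) x :=
  [/\ differentiable F x, 'D_e1 F x = F1 x & 'D_e2 F x = F2 x].

Lemma der_pt_r F F1 F2 r t : has_grad F F1 F2 (pt r t) ->
  der r (fun r => F (pt r t)) (cos t * F1 (pt r t) + sin t * F2 (pt r t)).
Proof.
move=> [dF <- <-]; apply: (@der_plane _ F (fun r => r * cos t) (fun r => r * sin t)) => //.
- by apply: der_eq; [dtac|rewrite /=; ring].
- by apply: der_eq; [dtac|rewrite /=; ring].
Qed.

Lemma der_pt_t F F1 F2 r t : has_grad F F1 F2 (pt r t) ->
  der t (fun t => F (pt r t)) (r * (- sin t * F1 (pt r t) + cos t * F2 (pt r t))).
Proof.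
move=> [dF <- <-]; apply: der_eq.
  apply: (@der_plane _ F (fun t => r * cos t) (fun t => r * sin t) _ (- r * sin t) (r * cos t)) => //.
  - by apply: der_eq; [dtac|rewrite /=; ring].
  - by apply: der_eq; [dtac|rewrite /=; ring].
by rewrite -/(pt r t); generalize ('D_e1 F (pt r t)) ('D_e2 F (pt r t)) => a b; ring.
Qed.

Lemma ext_disk u x : disk x -> ext u x = u x.
Proof. by rewrite /ext /disk /= => /ltW ->. Qed.

Lemma inverse_laplacian0 : inverse_laplacian (fun=> 0) (fun _ : R * R => 0 : R).
Proof.
have d0 v : 'D_v (fun _ : R * R => 0 : R) = fun=> 0 by apply/funext => x; exact: derive_cst.
have dd v v' : 'D_v ('D_v' (fun _ : R * R => 0 : R)) = fun=> 0 by rewrite d0 d0.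
split => //.
- move=> x _; split => [|v|v1 v2]; [exact: differentiable_cst|rewrite d0|rewrite dd].
    exact: differentiable_cst.
  exact: cst_continuous.
- by apply: continuous_subspaceT; exact: cst_continuous.
- move=> x _; apply/eqP; rewrite oppr_eq0; apply/eqP; rewrite -[RHS]addr0; congr (_ + _).
    exact: (congr1 (@^~ x) (dd (1, 0) (1, 0))).
  exact: (congr1 (@^~ x) (dd (0, 1) (0, 1))).
Qed.

Lemma inverse_laplacian_bound u w M : inverse_laplacian w u ->
  (forall x, disk x -> `|w x| <= M) ->
  forall x, closed_disk x -> `|u x| <= M * (1 - (x.1 ^+ 2 + x.2 ^+ 2)) / 4.
Proof.
move=> h hM x cx; have h0 := inverse_laplacian0.
have i1 := max_principle h h0 _ cx; have i2 := max_principle h0 h _ cx.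
rewrite ler_norml; apply/andP; split.
- rewrite lerNl -[leLHS]add0r; apply: i2 => y dy; rewrite sub0r.
  by apply: le_trans (ler_norm _) _; rewrite normrN; exact: hM.
- rewrite -[leLHS]subr0; apply: i1 => y dy; rewrite subr0.
  by apply: le_trans (ler_norm _) _; exact: hM.
Qed.

Section jet.
Variables u D1 D2 D11 D12 D21 D22 : R * R -> R.

Definition jet_of : polar_jet R := PolarJet
  (fun r t => ext u (pt r t))
  (fun r t => cos t * D1 (pt r t) + sin t * D2 (pt r t))
  (fun r t => cos t * (cos t * D11 (pt r t) + sin t * D12 (pt r t)) +
     sin t * (cos t * D21 (pt r t) + sin t * D22 (pt r t)))
  (fun r t => r * (- sin t * D1 (pt r t) + cos t * D2 (pt r t)))
  (fun r t => r * (- cos t * D1 (pt r t) - sin t * D2 (pt r t)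
     - sin t * (r * (- sin t * D11 (pt r t) + cos t * D12 (pt r t)))
     + cos t * (r * (- sin t * D21 (pt r t) + cos t * D22 (pt r t))))).

Lemma jet_sol w (f : R -> R -> R) M : inverse_laplacian w u ->
  (forall x, disk x -> `|w x| <= M) -> cont2 f -> (forall r, per2pi (f r)) ->
  (forall r t, -1 < r < 1 -> f r t = w (pt r t)) ->
  (forall x, disk x -> [/\ has_grad u D1 D2 x, has_grad D1 D11 D12 x & has_grad D2 D21 D22 x]) ->
  (forall x, disk x -> [/\ {for x, continuous D11}, {for x, continuous D12},
     {for x, continuous D21} & {for x, continuous D22}]) ->
  (forall x, disk x -> laplacian u x = D11 x + D22 x) -> polar_sol jet_of f.
Proof.
move=> h hM cf pf fw gr cD2 lap; have [_ cu eqn bd] := h.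
have ce := ext_cont cu bd.
have cD r t : -1 < r < 1 -> cont2_at (fun r t => D1 (pt r t)) r t /\
   cont2_at (fun r t => D2 (pt r t)) r t.
  by move=> r1; have [_ [k1 _ _] [k2 _ _]] := gr _ (pt_disk t r1); split;
    apply: cont_pt_at; exact: differentiable_continuous.
have cDD r t : -1 < r < 1 -> [/\ cont2_at (fun r t => D11 (pt r t)) r t,
   cont2_at (fun r t => D12 (pt r t)) r t, cont2_at (fun r t => D21 (pt r t)) r t &
   cont2_at (fun r t => D22 (pt r t)) r t].
  by move=> r1; have [k1 k2 k3 k4] := cD2 _ (pt_disk t r1); split; exact: cont_pt_at.
have near_ext_r r t : -1 < r < 1 -> \forall s \near r, u (pt s t) = ext u (pt s t).
  move=> r1; near=> s; rewrite ext_disk//; apply: pt_disk; near: s; exact: near_strip.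
have c1 (r t : R) : {for (r, t), continuous (fun p : R * R => p.1)} by exact: cont_fst.
have c2 (r t : R) : {for (r, t), continuous (fun p : R * R => p.2)} by exact: cont_snd.
have M0 : 0 <= M by apply: le_trans (hM (0, 0) _) => //; rewrite /disk /= expr0n addr0 ltr01.
split => //=.
- exact: cont_pt.
- move=> r t r1; have [k0 k1 k2] := gr _ (pt_disk t r1).
  by apply: der_near (near_ext_r r t r1) _; exact: der_pt_r.
- move=> r t r1; have [k0 k1 k2] := gr _ (pt_disk t r1).
  apply: der_eq.
    by apply: derD; (apply: derM; first exact: der_cst); [exact: der_pt_r k1|exact: der_pt_r k2].
  by rewrite !mul0r !add0r.
- move=> r t r1; have [k0 k1 k2] := gr _ (pt_disk t r1).
  apply: (@der_ext _ (fun t => u (pt r t))); first by move=> s; rewrite ext_disk//; exact: pt_disk.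
  exact: der_pt_t.
- move=> r t r1; have [k0 k1 k2] := gr _ (pt_disk t r1).
  apply: der_eq.
    apply: derM; first exact: der_cst.
    apply: derD; (apply: derM; first by dtac); [exact: der_pt_t k1|exact: der_pt_t k2].
  by rewrite /=; ring.
- move=> r t r1; have [k1 k2] := cD r t r1; have l2 := c2 r t.
  by rewrite /cont2_at in k1 k2 *; ctac.
- move=> r t r1; have l2 := c2 r t; have [k1 k2 k3 k4] := cDD r t r1.
  by rewrite /cont2_at in k1 k2 k3 k4 *; ctac.
- move=> r t r1; have [k1 k2] := cD r t r1; have l1 := c1 r t; have l2 := c2 r t.
  by rewrite /cont2_at in k1 k2 *; ctac.
- move=> r t r1; have [m1 m2] := cD r t r1; have l1 := c1 r t; have l2 := c2 r t.
  have [k1 k2 k3 k4] := cDD r t r1.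
  by rewrite /cont2_at in m1 m2 k1 k2 k3 k4 *; ctac.
- by move=> r t; rewrite pt_per.
- move=> r t r1; have := eqn _ (pt_disk t r1); rewrite -fw// => <-.
  rewrite lap; last exact: pt_disk.
  have cs := @cos2Dsin2 R t.
  transitivity (r ^+ 2 * (D11 (pt r t) + D22 (pt r t)) * (cos t ^+ 2 + sin t ^+ 2)); first by ring.
  by rewrite cs; ring.
- exists M => // r t /andP[r0 r1].
  have cd : closed_disk (pt r t) by apply: pt_closed_disk; rewrite r1 (le_trans _ r0)// lerN10.
  rewrite /ext; have := cd; rewrite /closed_disk /= => ->.
  apply: le_trans (inverse_laplacian_bound h hM cd) _; rewrite pt_sq.
  have : 0 <= M * (1 - r) by rewrite mulr_ge0// subr_ge0.
  have -> : M * (1 - r ^+ 2) / 4 = M * (1 - r) * ((1 + r) / 4) by field.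
  by move=> k; rewrite ler_piMr//; lra.
- by move=> t; rewrite /pt !mul0r.
Unshelve. all: by end_near. Qed.

End jet.

Definition polar_of u := jet_of u ('D_e1 u) ('D_e2 u) ('D_e1 ('D_e1 u)) ('D_e2 ('D_e1 u))
  ('D_e1 ('D_e2 u)) ('D_e2 ('D_e2 u)).

Lemma polar_of_sol u w (f : R -> R -> R) M : inverse_laplacian w u ->
  (forall x, disk x -> `|w x| <= M) -> cont2 f -> (forall r, per2pi (f r)) ->
  (forall r t, -1 < r < 1 -> f r t = w (pt r t)) -> polar_sol (polar_of u) f.
Proof.
move=> h hM cf pf fw; have [d2 _ _ _] := h.
apply: (@jet_sol _ _ _ _ _ _ _ w f M h hM cf pf fw) => x dx.
- by have [k1 k2 _] := d2 _ dx; split; split => //; exact: k2.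
- by have [_ _ k] := d2 _ dx; split; exact: k.
- by [].
Qed.

End to_polar.

(** * Conservation laws *)

(** The regularity of a stream function: derivatives inside the disk only. That of
    a vorticity, smooth up to the circle, is [polar_scalar]. *)
Record polar_c1 (R : realType) (u ur ut : R -> R -> R) : Prop := PolarC1 {
  c1_cont : cont2 u;
  c1_r : forall r t, -1 < r < 1 -> der r (u ^~ t) (ur r t);
  c1_t : forall r t, -1 < r < 1 -> der t (u r) (ut r t);
  c1_cr : forall r t, -1 < r < 1 -> cont2_at ur r t;
  c1_ct : forall r t, -1 < r < 1 -> cont2_at ut r t;
  c1_per : forall r, per2pi (u r) }.

Arguments c1_cont {R u ur ut} _.
Arguments c1_cr {R u ur ut} _ {r} t _.
Arguments c1_ct {R u ur ut} _ {r} t _.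

(** [sc_center] holds for functions of the point of the plane, as polar
    coordinates are constant on [r = 0]. *)
Record polar_scalar (R : realType) (q qr qt qtr : R -> R -> R) : Prop := PolarScalar {
  sc_cont : cont2 q;
  sc_contr : cont2 qr;
  sc_contt : cont2 qt;
  sc_conttr : cont2 qtr;
  sc_r : forall r t, der r (q ^~ t) (qr r t);
  sc_t : forall r t, der t (q r) (qt r t);
  sc_tr : forall r t, der r (qt ^~ t) (qtr r t);
  sc_per : forall r, per2pi (q r);
  sc_center : forall t, qt 0 t = 0 }.

Arguments sc_cont {R q qr qt qtr} _.
Arguments sc_contr {R q qr qt qtr} _.
Arguments sc_contt {R q qr qt qtr} _.
Arguments sc_conttr {R q qr qt qtr} _.

Lemma cont_fst_fst {T1 T2 T3 : topologicalType} (x : T1 * T2 * T3) :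
  {for x, continuous (fun p : T1 * T2 * T3 => p.1.1)}.
Proof. by apply: (@continuous_comp _ _ _ fst fst); exact: cont_fst. Qed.

Lemma cont_fst_snd {T1 T2 T3 : topologicalType} (x : T1 * T2 * T3) :
  {for x, continuous (fun p : T1 * T2 * T3 => p.1.2)}.
Proof. by apply: (@continuous_comp _ _ _ fst snd); [exact: cont_fst|exact: cont_snd]. Qed.

Section conservation.
Context {R : realType}.
Implicit Types (f g h q w : R -> R -> R) (r t : R).

Lemma pinDl f g h : cont2 f -> cont2 g -> cont2 h ->
  pin (fun r t => f r t + g r t) h = pin f h + pin g h.
Proof.
move=> cf cg ch; rewrite /pin -integD; [|exact: pin_cont..].
congr (integ _ _ _); apply/funext => r.
have h1 := slice (r := r) cf; have h2 := slice (r := r) cg; have h3 := slice (r := r) ch.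
rewrite -mulrDr -ointD; [|by ctac..].
by congr (_ * oint _); apply/funext => t; rewrite mulrDl.
Qed.

Lemma pinZl f h a : cont2 f -> cont2 h ->
  pin (fun r t => a * f r t) h = a * pin f h.
Proof.
move=> cf ch; rewrite /pin -integZ; last exact: pin_cont.
congr (integ _ _ _); apply/funext => r.
have h1 := slice (r := r) cf; have h3 := slice (r := r) ch.
rewrite [RHS]mulrCA; congr (_ * _); rewrite -ointZ; last by ctac.
by congr oint; apply/funext => t; rewrite mulrA.
Qed.

Lemma pinBl f g h : cont2 f -> cont2 g -> cont2 h ->
  pin (fun r t => f r t - g r t) h = pin f h - pin g h.
Proof.
move=> cf cg ch; rewrite -[- pin g h]mulN1r -pinZl// -pinDl//; last first.
  by cintro2 p; have h1 := cg p; ctac.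
by congr pin; apply/funext => r; apply/funext => t; rewrite mulN1r.
Qed.

Lemma pinBr f g h : cont2 f -> cont2 g -> cont2 h ->
  pin h (fun r t => f r t - g r t) = pin h f - pin h g.
Proof. by move=> cf cg ch; rewrite pinC pinBl// ![pin _ h]pinC. Qed.

Lemma pin_le f g a b : cont2 f -> cont2 g ->
  (forall r t, 0 <= r <= 1 -> `|f r t| <= a) ->
  (forall r t, 0 <= r <= 1 -> `|g r t| <= b) -> `|pin f g| <= 2 * pi * (a * b).
Proof.
move=> cf cg fa gb; rewrite -[leRHS]mulr1 -[X in _ * X](subr0 (1:R)).
apply: integ_norm_le => //; first exact: pin_cont.
move=> r /andP[r0 r1]; rewrite normrM gtr0_norm// -[leRHS]mul1r.
have h1 := slice (r := r) cf; have h2 := slice (r := r) cg.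
apply: ler_pM => //; [exact: ltW|exact: ltW|].
rewrite mulrC -[X in _ * X](subr0 (2 * pi)).
apply: integ_norm_le; [exact/ltW/twopi_gt0|by ctac|].
have rr : 0 <= r <= 1 by rewrite !ltW.
by move=> t _; rewrite normrM ler_pM ?normr_ge0// ?fa ?gb.
Qed.

Lemma symmetric_pin (u1 u2 : polar_jet R) w1 w2 : polar_sol u1 w1 -> polar_sol u2 w2 ->
  pin w1 (jv u2) = pin w2 (jv u1).
Proof.
move=> P1 P2; have c1 := ps_cont P1; have c2 := ps_cont P2.
have c3 := ps_contw P1; have c4 := ps_contw P2.
apply/eqP; rewrite -subr_eq0 /pin -integB; [|exact: pin_cont..].
rewrite -[X in _ == X](polar_symmetry P1 P2); apply/eqP.
congr (integ _ _ _); apply/funext => r.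
have h1 := slice (r := r) c1; have h2 := slice (r := r) c2.
have h3 := slice (r := r) c3; have h4 := slice (r := r) c4.
by rewrite -mulrBr -ointB//; ctac.
Qed.

Section flux.
Variables (u ur ut q qr qt qtr g : R -> R -> R).
Hypotheses (hu : polar_c1 u ur ut) (hq : polar_scalar q qr qt qtr) (cg : cont2 g).
Hypothesis jac : forall r t, 0 < r < 1 -> r * g r t = ur r t * qt r t - ut r t * qr r t.

(** The flow of [q] across the circle of radius [r]; the centre contributes nothing
    by [sc_center]. *)
Lemma flux_integral r : 0 <= r <= 1 ->
  integ 0 r (fun s => s * oint (g s)) = oint (fun t => u r t * qt r t).
Proof.
move=> /andP[r0 r1].
have cB : continuous (fun r => oint (fun t => u r t * qt r t)).
  exact: oint2_cont (c1_cont hu) (sc_contt hq).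
have co : continuous (fun r => oint (g r)) by exact: oint_cont.
rewrite (@integ_ftc _ _ (fun r => oint (fun t => u r t * qt r t)))//.
- rewrite [X in _ - X](_ : _ = 0) ?subr0//.
  rewrite (_ : (fun t => _) = fun=> 0); first by rewrite oint_cst mulr0.
  by apply/funext => t; rewrite (sc_center hq) mulr0.
- by ctac.
- move=> s /andP[s0 sr]; have s01 : 0 < s < 1 by rewrite s0 (lt_le_trans sr).
  have s1 := strip_pos s01.
  apply: der_eq.
    apply: (@bracket_der _ u ur ut q qr qt qtr s s1) => *.
    - exact: (c1_r hu).
    - exact: (c1_t hu).
    - exact: cont2_at_of (c1_cont hu).
    - exact: (c1_cr hu).
    - exact: (c1_ct hu).
    - exact: (c1_per hu).
    - exact: (sc_r hq).
    - exact: (sc_t hq).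
    - exact: (sc_tr hq).
    - exact: cont2_at_of (sc_cont hq).
    - exact: cont2_at_of (sc_contr hq).
    - exact: cont2_at_of (sc_contt hq).
    - exact: cont2_at_of (sc_conttr hq).
    - exact: (sc_per hq).
  rewrite -ointZ; last exact: slice.
  by congr oint; apply/funext => t; rewrite jac.
- by apply: continuous_subspaceT; exact: cB.
Qed.

Lemma flux_total : (forall t, u 1 t = 0) -> integ 0 1 (fun s => s * oint (g s)) = 0.
Proof.
move=> u1; rewrite flux_integral ?ler01 ?lexx//.
rewrite (_ : (fun t => _) = fun=> 0); first by rewrite oint_cst mulr0.
by apply/funext => t; rewrite u1 mul0r.
Qed.

End flux.

Definition rot_jet (u : polar_jet R) a := PolarJet
  (fun r t => jv u r (t + a)) (fun r t => jr u r (t + a)) (fun r t => jrr u r (t + a))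
  (fun r t => jt u r (t + a)) (fun r t => jtt u r (t + a)).

Lemma cont2_at_rot f a r t : cont2_at f r (t + a) -> cont2_at (fun r t => f r (t + a)) r t.
Proof.
move=> cf; have h1 := @cont_fst R R (r, t); have h2 := @cont_snd R R (r, t).
rewrite /cont2_at.
by apply: (@cont_pair _ _ _ _ f (fun p : R * R => p.1) (fun p : R * R => p.2 + a)); [exact: cf|ctac..].
Qed.

Lemma cont2_rot f a : cont2 f -> cont2 (fun r t => f r (t + a)).
Proof. by move=> cf [r t]; apply: cont2_at_rot; exact: cf. Qed.

Lemma der_rot (f : R -> R) d a t : der (t + a) f d -> der t (fun t => f (t + a)) d.
Proof.
move=> h; apply: der_eq; first by apply: der_comp; [exact: h|dtac].
by rewrite /= addr0 mulr1.
Qed.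

Lemma rot_sol (u : polar_jet R) w a : polar_sol u w ->
  polar_sol (rot_jet u a) (fun r t => w r (t + a)).
Proof.
move=> h; split => /=.
- exact: cont2_rot (ps_cont h).
- exact: cont2_rot (ps_contw h).
- by move=> r t r1; exact: (ps_r h).
- by move=> r t r1; exact: (ps_rr h).
- by move=> r t r1; apply: der_rot; exact: (ps_t h).
- by move=> r t r1; apply: der_rot; exact: (ps_tt h).
- by move=> r t r1; apply: cont2_at_rot; exact: (ps_cr h).
- by move=> r t r1; apply: cont2_at_rot; exact: (ps_crr h).
- by move=> r t r1; apply: cont2_at_rot; exact: (ps_ct h).
- by move=> r t r1; apply: cont2_at_rot; exact: (ps_ctt h).
- by move=> r t; rewrite addrAC (ps_per h).
- by move=> r t; rewrite addrAC (ps_perw h).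
- by move=> r t r1; exact: (ps_eq h).
- by have [M M0 hM] := ps_bound h; exists M => // r t r1; exact: hM.
- by move=> t; rewrite (ps_center h) [RHS](ps_center h).
Qed.

(** By rotation invariance and symmetry of [G], [a |-> <u, w (. + a)>] is even, so
    its derivative at 0 vanishes: the torque of the flow is zero. *)
Lemma torque_free (u : polar_jet R) w wr wt wtr : polar_sol u w -> polar_scalar w wr wt wtr ->
  pin (jv u) wt = 0.
Proof.
move=> h hw; have cu := ps_cont h; have cw := ps_contw h; have cwt := sc_contt hw.
pose F a := pin (jv u) (fun r t => w r (t + a)).
have even a : F (- a) = F a.
  have := symmetric_pin h (rot_sol a h) => /=.
  rewrite [RHS]pinC -/(F a) => <-; rewrite /F /pin.
  congr (integ _ _ _); apply/funext => r; congr (_ * _).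
  have h1 := slice (r := r) cu; have h2 := slice (r := r) cw.
  rewrite -(@oint_shift _ (fun t => jv u r t * w r (t - a)) a).
  - by congr oint; apply/funext => t; rewrite addrK mulrC.
  - have h3 := slice (r := r) (cont2_rot (a := - a) cw); by ctac.
  - by move=> t; rewrite (ps_per h) addrAC (ps_perw h).
have c3 (g : R -> R -> R) : cont2 g ->
    continuous (fun p : (R * R) * R => jv u p.1.2 p.2 * g p.1.2 (p.2 + p.1.1)).
  move=> cg [[a r] t].
  have k1 := @cont_snd _ _ ((a, r), t); have k2 := @cont_fst _ _ ((a, r), t).
  have k3 : {for ((a, r), t), continuous (fun p : (R * R) * R => p.1.1)}.
    exact: cont_fst_fst.
  have k4 : {for ((a, r), t), continuous (fun p : (R * R) * R => p.1.2)}.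
    exact: cont_fst_snd.
  have k5 : {for ((a, r), t), continuous (fun p : (R * R) * R => jv u p.1.2 p.2)}.
    by apply: (@cont_pair _ _ _ _ (jv u) (fun p : (R * R) * R => p.1.2) (fun p => p.2)) => //; exact: cu.
  have k6 : {for ((a, r), t), continuous (fun p : (R * R) * R => g p.1.2 (p.2 + p.1.1))}.
    by apply: (@cont_pair _ _ _ _ g (fun p : (R * R) * R => p.1.2) (fun p => p.2 + p.1.1)) => //; [exact: cg|ctac].
  by change {for ((a, r), t), continuous (fun p : (R * R) * R => jv u p.1.2 p.2 * g p.1.2 (p.2 + p.1.1))}; ctac.
pose G (g : R -> R -> R) a r := r * oint (fun t => jv u r t * g r (t + a)).
have cG g : cont2 g -> cont2 (G g).
  move=> cg p; have k := @integ_param_continuous R _ (fun p t => jv u p.2 t * g p.2 (t + p.1)) 0 (2 * pi) (c3 g cg).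
  have k1 := @cont_snd R R p.
  by change {for p, continuous (fun p : R * R => p.2 * oint (fun t => jv u p.2 t * g p.2 (t + p.1)))}; rewrite /oint; ctac.
have dG a r : der a (G w ^~ r) (G wt a r).
  apply: der_eq.
    apply: derM; first exact: der_cst.
    apply: (@integ_param_der _ (fun a t => jv u r t * w r (t + a)) (fun a t => jv u r t * wt r (t + a))).
    - exact/ltW/twopi_gt0.
    - near=> b => t; apply: der_eq.
        apply: derM; first exact: der_cst.
        by apply: der_comp; [exact: (sc_t hw)|dtac].
      by rewrite /=; ring.
    - near=> b; have h1 := slice (r := r) cu; have h2 := slice (r := r) (cont2_rot (a := b) cw); by ctac.
    - have h1 := slice (r := r) cu; have h2 := slice (r := r) (cont2_rot (a := a) cwt); by ctac.
    - move=> t _; have h1 := slice (r := r) cu; have h2 := slice (r := r) cwt.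
      have k1 := @cont_fst R R (a, t); have k2 := @cont_snd R R (a, t).
      apply: contM.
        by apply: (@cont_comp _ _ (fun p : R * R => p.2) (jv u r)); [exact: k2|exact: h1].
      by apply: (@cont_comp _ _ (fun p : R * R => p.2 + p.1) (wt r)); [ctac|exact: h2].
  by rewrite mul0r add0r.
have dF : der 0 F (integ 0 1 (G wt 0)).
  apply: (@integ_param_der _ (G w) (G wt)) => //.
  - by near=> b => r; exact: dG.
  - by near=> b; exact: slice (cG w cw).
  - exact: slice (cG wt cwt).
  - by move=> r _; exact: cG.
have FE : integ 0 1 (G wt 0) = pin (jv u) wt.
  congr (integ _ _ _); apply/funext => r; congr (_ * oint _); apply/funext => t.
  by rewrite addr0.
have dF' : der 0 F (- integ 0 1 (G wt 0)).
  apply: (@der_ext _ (fun a => F (- a))); first exact: even.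
  rewrite -mulrN1; apply: (@der_comp _ F (fun a => - a)); first by rewrite oppr0.
  exact: derN (der_id 0).
have := der_uniq dF dF'; rewrite FE; lra.
Unshelve. all: by end_near. Qed.

Section static.
Variables (u : polar_jet R) (w wr wt wtr wd : R -> R -> R).
Hypotheses (h : polar_sol u w) (hw : polar_scalar w wr wt wtr) (cwd : cont2 wd).
Hypothesis eqn : forall r t, 0 < r < 1 -> r * wd r t = jr u r t * wt r t - jt u r t * wr r t.

Let hu : polar_c1 (jv u) (jr u) (jt u).
Proof.
split.
- exact: ps_cont h.
- exact: ps_r h.
- exact: ps_t h.
- by move=> r t; exact: (ps_cr h).
- by move=> r t; exact: (ps_ct h).
- exact: ps_per h.
Qed.

Lemma rate_mean : pin wd (fun _ _ => 1) = 0.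
Proof.
rewrite -[RHS](flux_total hu hw cwd eqn (ps_one h)); congr (integ _ _ _).
by apply/funext => r; congr (_ * oint _); apply/funext => t; rewrite mulr1.
Qed.

Lemma rate_enstrophy : pin wd w = 0.
Proof.
have cw := sc_cont hw; have c1 := sc_contr hw; have c2 := sc_contt hw; have c3 := sc_conttr hw.
have hq : polar_scalar (fun r t => w r t ^+ 2 / 2) (fun r t => w r t * wr r t)
    (fun r t => w r t * wt r t) (fun r t => wr r t * wt r t + w r t * wtr r t).
  split.
  - by cintro2 p; have k := cw p; ctac.
  - by cintro2 p; have k := cw p; have k1 := c1 p; ctac.
  - by cintro2 p; have k := cw p; have k1 := c2 p; ctac.
  - by cintro2 p; have k := cw p; have k1 := c1 p; have k2 := c2 p; have k3 := c3 p; ctac.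
  - move=> r t; apply: der_eq; first by apply: derM; [apply: derX; exact: (sc_r hw)|exact: der_cst].
    by rewrite /=; field.
  - move=> r t; apply: der_eq; first by apply: derM; [apply: derX; exact: (sc_t hw)|exact: der_cst].
    by rewrite /=; field.
  - by move=> r t; apply: derM; [exact: (sc_r hw)|exact: (sc_tr hw)].
  - by move=> r t; rewrite (sc_per hw).
  - by move=> t; rewrite (sc_center hw) mulr0.
have cg : cont2 (fun r t => wd r t * w r t) by cintro2 p; have k := cw p; have k1 := @cwd p; ctac.
apply: (flux_total hu hq cg _ (ps_one h)) => r t r1.
by rewrite mulrA eqn//; ring.
Qed.

Lemma rate_energy : pin wd (jv u) = 0.
Proof.
have cu := ps_cont h.
have hU : polar_c1 (fun r t => jv u r t ^+ 2 / 2) (fun r t => jv u r t * jr u r t)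
    (fun r t => jv u r t * jt u r t).
  split.
  - by cintro2 p; have k := cu p; ctac.
  - move=> r t r1; apply: der_eq; first by apply: derM; [apply: derX; exact: (ps_r h)|exact: der_cst].
    by rewrite /=; field.
  - move=> r t r1; apply: der_eq; first by apply: derM; [apply: derX; exact: (ps_t h)|exact: der_cst].
    by rewrite /=; field.
  - move=> r t r1; have k1 := @cont2_at_of _ _ r t cu; have k2 := ps_cr h t r1.
    by rewrite /cont2_at in k1 k2 *; ctac.
  - move=> r t r1; have k1 := @cont2_at_of _ _ r t cu; have k2 := ps_ct h t r1.
    by rewrite /cont2_at in k1 k2 *; ctac.
  - by move=> r t; rewrite (ps_per h).
have cg : cont2 (fun r t => wd r t * jv u r t) by cintro2 p; have k := cu p; have k1 := @cwd p; ctac.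
apply: (flux_total hU hw cg).
  by move=> r t r1; rewrite mulrA eqn//; ring.
by move=> t; rewrite (ps_one h) expr0n mul0r.
Qed.

(** With [B s] the rate of change of the mass inside radius [s], the rate of the
    second moment is [- 2 int s B s], a multiple of the torque. *)
Lemma rate_mom3 : pin wd (fun r _ => r ^+ 2) = 0.
Proof.
pose B s := integ 0 s (fun s => s * oint (wd s)).
have co : continuous (fun r => oint (wd r)) by exact: oint_cont.
have cs : continuous (fun s : R => s * oint (wd s)) by ctac.
have dB s : der s B (s * oint (wd s)) by exact: (@integ_der _ (fun s => s * oint (wd s))).
have cB : continuous B by exact: der_continuous dB.
have B1 : B 1 = 0 by exact: flux_total hu hw cwd eqn (ps_one h).
have IB : integ 0 1 (fun s => s * B s) = 0.
  rewrite -[RHS](torque_free h hw) /pin; apply: eq_integ => //; first by ctac.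
    exact: pin_cont (ps_cont h) (sc_contt hw).
  by move=> r /andP[r0 r1]; rewrite /B (flux_integral hu hw cwd eqn)// !ltW.
transitivity (integ 0 1 (fun s => s ^+ 2 * (s * oint (wd s)))).
  congr (integ _ _ _); apply/funext => r; rewrite mulrCA; congr (_ * _).
  rewrite -ointZ; last exact: slice.
  by congr oint; apply/funext => t; rewrite mulrC.
have : integ 0 1 (fun s => s ^+ 2 * (s * oint (wd s)) + 2 * (s * B s)) = 0.
  rewrite (@integ_primitive _ _ (fun s => s ^+ 2 * B s)); first by rewrite B1 mulr0 expr0n mul0r subr0.
  move=> s; apply: der_eq; first by apply: derM; [dtac|exact: dB].
  by rewrite /=; ring.
by rewrite integD ?integZ ?IB ?mulr0 ?addr0//; ctac.
Qed.

End static.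

Section dynamics.
Variables (f : R -> R -> R -> R) (v : R -> polar_jet R) (fr ft ftr fd : R -> R -> R -> R).
Hypothesis sol : forall s, polar_sol (v s) (f s).
Hypothesis reg : forall s, polar_scalar (f s) (fr s) (ft s) (ftr s).
Hypothesis cfd : forall s, cont2 (fd s).
Hypothesis eqn : forall s r t, 0 < r < 1 ->
  r * fd s r t = jr (v s) r t * ft s r t - jt (v s) r t * fr s r t.
Hypothesis bound : forall s, exists2 K, 0 <= K & forall r t, 0 <= r <= 1 -> `|f s r t| <= K.
Hypothesis taylor : forall s, exists2 K, 0 <= K & forall y, `|y - s| <= 1 -> forall r t, 0 <= r <= 1 ->
  `|f y r t - f s r t - (y - s) * fd s r t| <= K * (y - s) ^+ 2.
Hypothesis lip : forall s, exists2 K, 0 <= K & forall y, `|y - s| <= 1 -> forall r t, 0 <= r <= 1 ->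
  `|f y r t - f s r t| <= K * `|y - s|.
Hypothesis lipv : forall s, exists2 K, 0 <= K & forall y, `|y - s| <= 1 -> forall r t, 0 <= r <= 1 ->
  `|jv (v y) r t - jv (v s) r t| <= K * `|y - s|.

Let cf s : cont2 (f s). Proof. exact: ps_contw (sol s). Qed.
Let cv s : cont2 (jv (v s)). Proof. exact: ps_cont (sol s). Qed.

Let cB g h : cont2 g -> cont2 h -> cont2 (fun r t => g r t - h r t).
Proof. by move=> cg ch; cintro2 p; have k1 := cg p; have k2 := ch p; ctac. Qed.
Let cZ g a : cont2 g -> cont2 (fun r t => a * g r t).
Proof. by move=> cg; cintro2 p; have k1 := cg p; ctac. Qed.

Let near1 (s : R) : \forall y \near s, `|y - s| <= 1.
Proof. by near=> y; rewrite distrC; apply/ltW; near: y; exists 1 => /=. Unshelve. all: by end_near. Qed.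

Lemma first_order s g b : cont2 g -> (forall r t, 0 <= r <= 1 -> `|g r t| <= b) ->
  exists2 K, 0 <= K & forall y, `|y - s| <= 1 ->
    `|pin (f y) g - pin (f s) g - (y - s) * pin (fd s) g| <= K * (y - s) ^+ 2.
Proof.
move=> cg gb; have [K K0 hK] := taylor s.
have b0 : 0 <= b by apply: le_trans (gb 0 0 _); rewrite ?lexx ?ler01.
exists (2 * pi * (K * b)) => [|y ys]; first by rewrite !mulr_ge0 ?pi_ge0.
rewrite -pinZl// -pinBl// -pinBl//; [|exact: cB|exact: cZ].
apply: le_trans (pin_le (a := K * (y - s) ^+ 2) _ cg _ gb) _.
- by apply: cB; [exact: cB|exact: cZ].
- by move=> r t r1; exact: hK.
- by rewrite le_eqVlt; apply/orP; left; apply/eqP; ring.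
Qed.

Lemma conserved_linear g b : cont2 g -> (forall r t, 0 <= r <= 1 -> `|g r t| <= b) ->
  (forall s, pin (fd s) g = 0) -> forall s, pin (f s) g = pin (f 0) g.
Proof.
move=> cg gb h0 s; apply: (@der0_const _ (fun s => pin (f s) g)) => {}s.
have [K K0 hK] := first_order s cg gb.
apply: (@der_bound_sq _ _ _ _ K); near=> y.
have ys : `|y - s| <= 1 by near: y; exact: near1.
by have := hK y ys; rewrite h0 mulr0 mul0r.
Unshelve. all: by end_near. Qed.

Lemma conserved_mean s : pin (f s) (fun _ _ => 1) = pin (f 0) (fun _ _ => 1).
Proof.
apply: (@conserved_linear _ 1).
- by cintro2 p; ctac.
- by move=> *; rewrite normr1.
- by move=> s'; exact: rate_mean (sol s') (reg s') (@cfd s') (@eqn s').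
Qed.

Lemma conserved_mom3 s : pin (f s) (fun r _ => r ^+ 2) = pin (f 0) (fun r _ => r ^+ 2).
Proof.
apply: (@conserved_linear _ 1).
- by cintro2 p; have k := @cont_fst R R p; ctac.
- by move=> r _ /andP[r0 r1]; rewrite ger0_norm ?sqr_ge0// expr_le1.
- by move=> s'; exact: rate_mom3 (sol s') (reg s') (@cfd s') (@eqn s').
Qed.

(** Enstrophy and energy both have this shape, with [V] the vorticity and the
    stream function. Symmetry replaces the increment of [V] by that of [f], so
    that [<f, V>] has increment [2 <f', V>] to first order; the error is the
    product of the increments of [f] and [V]. *)
Lemma conserved_quadratic (V : R -> R -> R -> R) :
  (forall s, cont2 (V s)) ->
  (forall s, exists2 K, 0 <= K & forall r t, 0 <= r <= 1 -> `|V s r t| <= K) ->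
  (forall s, exists2 K, 0 <= K & forall y, `|y - s| <= 1 -> forall r t, 0 <= r <= 1 ->
    `|V y r t - V s r t| <= K * `|y - s|) ->
  (forall s y, pin (f s) (V y) = pin (f y) (V s)) ->
  (forall s, pin (fd s) (V s) = 0) -> forall s, pin (f s) (V s) = pin (f 0) (V 0).
Proof.
move=> cV bV lV sV h0 s; apply: (@der0_const _ (fun s => pin (f s) (V s))) => {}s.
have [b b0 hb] := bV s; have [K K0 hK] := first_order s (cV s) hb.
have [L L0 hL] := lip s; have [L' L'0 hL'] := lV s.
apply: (@der_bound_sq _ _ _ _ (2 * K + 2 * pi * (L * L'))); near=> y.
have ys : `|y - s| <= 1 by near: y; exact: near1.
have := hK y ys; rewrite h0 mulr0 subr0 mul0r subr0 => k1.
have := pin_le (cB (@cf y) (@cf s)) (cB (@cV y) (@cV s)) (hL y ys) (hL' y ys).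
rewrite (pinBr (@cV y) (@cV s) (cB (@cf y) (@cf s))) (pinBl (@cf y) (@cf s) (@cV y)).
rewrite (pinBl (@cf y) (@cf s) (@cV s)) (sV s y).
have -> : 2 * pi * (L * `|y - s| * (L' * `|y - s|)) = 2 * pi * (L * L') * (y - s) ^+ 2.
  by rewrite -[(y - s) ^+ 2]real_normK ?num_real//; ring.
move=> k2.
have -> : pin (f y) (V y) - pin (f s) (V s) =
  2 * (pin (f y) (V s) - pin (f s) (V s)) +
  (pin (f y) (V y) - pin (f y) (V s) - (pin (f y) (V s) - pin (f s) (V s))) by ring.
apply: le_trans (ler_normD _ _) _; rewrite [leRHS]mulrDl; apply: lerD; last first.
  by apply: le_trans k2; rewrite le_eqVlt; apply/orP; left; apply/eqP; congr (`|_|); ring.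
by rewrite normrM ger0_norm// -mulrA ler_pM2l.
Unshelve. all: by end_near. Qed.

Lemma conserved_enstrophy s : pin (f s) (f s) = pin (f 0) (f 0).
Proof.
apply: (@conserved_quadratic f) => //.
- by move=> ? ?; exact: pinC.
- by move=> s'; exact: rate_enstrophy (sol s') (reg s') (@cfd s') (@eqn s').
Qed.

Lemma conserved_energy s : pin (f s) (jv (v s)) = pin (f 0) (jv (v 0)).
Proof.
apply: (@conserved_quadratic (fun s => jv (v s))) => //.
- move=> s'; have [M M0 hM] := ps_bound (sol s'); exists M => // r t r1.
  by apply: le_trans (hM r t r1) _; have := r1; nra.
- by move=> s1 s2; exact: symmetric_pin (sol s1) (sol s2).
- by move=> s'; exact: rate_energy (sol s') (reg s') (@cfd s') (@eqn s').
Qed.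

End dynamics.
End conservation.

(** * Smooth solutions of the Euler equation in polar form *)

Section euler_flow.
Context {R : realType}.
Implicit Types (r t s : R) (x : R * R).

Definition has_grad3 (F F0 F1 F2 : R * (R * R) -> R) :=
  forall p, [/\ differentiable F p, 'D_k0 F p = F0 p, 'D_k1 F p = F1 p & 'D_k2 F p = F2 p].

Lemma grad3_der F F0 F1 F2 (a b c : R -> R) (s a' b' c' : R) : has_grad3 F F0 F1 F2 ->
  der s a a' -> der s b b' -> der s c c' ->
  der s (fun s => F (a s, (b s, c s)))
    (a' * F0 (a s, (b s, c s)) + b' * F1 (a s, (b s, c s)) + c' * F2 (a s, (b s, c s))).
Proof. by move=> h da db dc; have [d <- <- <-] := h (a s, (b s, c s)); exact: der_space. Qed.

Lemma grad3_cont F F0 F1 F2 : has_grad3 F F0 F1 F2 -> continuous F.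
Proof. by move=> h p; have [d _ _ _] := h p; exact: differentiable_continuous. Qed.

Lemma slice3_cont (F : R * (R * R) -> R) s : continuous F -> continuous (fun x => F (s, x)).
Proof.
move=> cF x; apply: (@continuous_comp _ _ _ (fun x : R * R => (s, x)) F); last exact: cF.
have h1 : (fun _ : R * R => s) @ x --> s by exact: cvg_cst.
have h2 : (fun y : R * R => y) @ x --> x by exact: cvg_id.
exact: (cvg_pair h1 h2).
Qed.

Lemma slice3_polar_cont (F : R * (R * R) -> R) s : continuous F -> cont2 (fun r t => F (s, pt r t)).
Proof. by move=> cF; apply: (@cont_pt _ (fun x => F (s, x))); exact: slice3_cont. Qed.

Lemma grad3_der_r F F0 F1 F2 s r t : has_grad3 F F0 F1 F2 ->
  der r (fun r => F (s, pt r t)) (cos t * F1 (s, pt r t) + sin t * F2 (s, pt r t)).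
Proof.
move=> h; apply: der_eq.
  apply: (@grad3_der _ _ _ _ (fun=> s) (fun r => r * cos t) (fun r => r * sin t) _ 0 (cos t) (sin t) h).
  - exact: der_cst.
  - by apply: der_eq; [dtac|rewrite /=; ring].
  - by apply: der_eq; [dtac|rewrite /=; ring].
by rewrite mul0r add0r.
Qed.

Lemma grad3_der_t F F0 F1 F2 s r t : has_grad3 F F0 F1 F2 ->
  der t (fun t => F (s, pt r t)) (r * (- sin t * F1 (s, pt r t) + cos t * F2 (s, pt r t))).
Proof.
move=> h; apply: der_eq.
  apply: (@grad3_der _ _ _ _ (fun=> s) (fun t => r * cos t) (fun t => r * sin t) _ 0 (- r * sin t) (r * cos t) h).
  - exact: der_cst.
  - by apply: der_eq; [dtac|rewrite /=; ring].
  - by apply: der_eq; [dtac|rewrite /=; ring].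
by rewrite -/(pt r t); ring.
Qed.

Lemma grad3_der_s F F0 F1 F2 s x : has_grad3 F F0 F1 F2 -> der s (fun s => F (s, x)) (F0 (s, x)).
Proof.
case: x => a b h; apply: der_eq.
  by apply: (@grad3_der _ _ _ _ id (fun=> a) (fun=> b) _ 1 0 0 h); [exact: der_id|exact: der_cst|exact: der_cst].
by rewrite /= !mul0r !addr0 mul1r.
Qed.

Lemma grad3_slice F F0 F1 F2 s x : has_grad3 F F0 F1 F2 ->
  has_grad (fun x => F (s, x)) (fun x => F1 (s, x)) (fun x => F2 (s, x)) x.
Proof.
move=> h; have [d _ E1 E2] := h (s, x).
have e (v : R * R) : 'D_v (fun x => F (s, x)) x = 'D_(0, v) F (s, x).
  apply: (congr1 (fun f : R -> R => lim (f @ 0^'))); apply/funext => y /=.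
  by congr (_ *: (F (_, _) - _)); rewrite /= scaler0 add0r.
split; [|exact: etrans (e e1) E1|exact: etrans (e e2) E2].
apply: (@differentiable_comp _ _ _ _ (fun x : R * R => (s, x)) F) => //.
Qed.

Lemma bounded_cylinder (F : R * (R * R) -> R) s : continuous F -> exists2 K, 0 <= K &
  forall y x, `|y - s| <= 1 -> closed_disk x -> `|F (y, x)| <= K.
Proof.
move=> cF.
have cA : compact (`[s - 1, s + 1]%classic `*` @closed_disk R : set (R * (R * R))).
  by apply: compact_setX; [exact: segment_compact|exact: closed_disk_compact].
have cN : {within (`[s - 1, s + 1]%classic `*` @closed_disk R : set (R * (R * R))), continuous (fun p => `|F p|)}.
  by apply: continuous_subspaceT => p; apply: (@continuous_comp _ _ _ F (fun y : R => `|y|)); [exact: cF|exact: norm_continuous].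
have [|c _ hc] := compact_EVT_max _ cA cN.
  exists (s, (0, 0)); split => /=; first by rewrite in_itv /=; lra.
  by rewrite /closed_disk /= expr0n addr0 ler01.
exists `|F c| => // y x ys cx; apply: (hc (y, x)); rewrite inE; split => //=.
by rewrite in_itv/= -ler_distlC distrC.
Qed.

Lemma lipschitz_bound (g g' : R -> R) s y K : (forall z, der z g (g' z)) ->
  (forall z, `|z - s| <= `|y - s| -> `|g' z| <= K) -> `|g y - g s| <= K * `|y - s|.
Proof.
move=> dg hK; have cg := der_continuous dg.
have [ys|sy|->] := ltgtP y s; last by rewrite !subrr normr0 mulr0.
- have [||c] := @MVT R g g' y s ys; [by move=> *; exact: dg|exact: continuous_subspaceT|].
  rewrite in_itv/= => /andP[c1 c2] e; rewrite distrC e normrM [`|s - y|]distrC ler_wpM2r//.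
  by apply: hK; rewrite !ltr0_norm ?subr_lt0//; lra.
- have [||c] := @MVT R g g' s y sy; [by move=> *; exact: dg|exact: continuous_subspaceT|].
  rewrite in_itv/= => /andP[c1 c2] e; rewrite e normrM ler_wpM2r//.
  by apply: hK; rewrite !gtr0_norm ?subr_gt0//; lra.
Qed.

Lemma taylor_bound (g g' g'' : R -> R) s y K : (forall z, der z g (g' z)) ->
  (forall z, der z g' (g'' z)) -> (forall z, `|z - s| <= `|y - s| -> `|g'' z| <= K) ->
  `|g y - g s - (y - s) * g' s| <= K * (y - s) ^+ 2.
Proof.
move=> dg dg' hK.
have := @lipschitz_bound (fun z => g z - z * g' s) (fun z => g' z - g' s) s y (K * `|y - s|).
have -> : g y - y * g' s - (g s - s * g' s) = g y - g s - (y - s) * g' s by ring.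
rewrite -mulrA -expr2 real_normK ?num_real//; apply.
- move=> z; apply: derB => //; apply: der_eq; first by apply: derM; [exact: der_id|exact: der_cst].
  by rewrite /=; ring.
- move=> z zs; apply: le_trans (lipschitz_bound dg' _) _; last first.
    apply: ler_wpM2l zs; apply: le_trans (hK s _); first exact: normr_ge0.
    by rewrite subrr normr0.
  by move=> z' z's; apply: hK; exact: le_trans zs.
Qed.

Section flow.
Variables (w u : R -> R * R -> R).
Variables (W W0 W1 W2 W00 W01 W02 W10 W11 W12 W20 W21 W22 : R * (R * R) -> R).
Hypotheses (gW : has_grad3 W W0 W1 W2) (gW0 : has_grad3 W0 W00 W01 W02).
Hypotheses (gW1 : has_grad3 W1 W10 W11 W12) (gW2 : has_grad3 W2 W20 W21 W22).
Hypotheses (cW00 : continuous W00) (cW11 : continuous W11) (cW12 : continuous W12).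
Hypotheses (cW21 : continuous W21) (cW22 : continuous W22).
Hypothesis wW : forall t x, closed_disk x -> W (t, x) = w t x.
Hypothesis hu : forall t, inverse_laplacian (w t) (u t).
Hypothesis euler : forall t x, disk x ->
  W0 (t, x) = 'D_e1 (u t) x * W2 (t, x) - 'D_e2 (u t) x * W1 (t, x).

Let cW := grad3_cont gW.
Let cW0 := grad3_cont gW0.
Let cW1 := grad3_cont gW1.
Let cW2 := grad3_cont gW2.

Definition fl_f s r t := W (s, pt r t).
Definition fl_fd s r t := W0 (s, pt r t).
Definition fl_fr s r t := cos t * W1 (s, pt r t) + sin t * W2 (s, pt r t).
Definition fl_ft s r t := r * (- sin t * W1 (s, pt r t) + cos t * W2 (s, pt r t)).
Definition fl_ftr s r t := (- sin t * W1 (s, pt r t) + cos t * W2 (s, pt r t)) +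
  r * (- sin t * (cos t * W11 (s, pt r t) + sin t * W12 (s, pt r t)) +
       cos t * (cos t * W21 (s, pt r t) + sin t * W22 (s, pt r t))).

Lemma fl_cont s : cont2 (fl_f s). Proof. exact: slice3_polar_cont cW. Qed.

Lemma fl_per s r : per2pi (fl_f s r).
Proof. by move=> t; rewrite /fl_f pt_per. Qed.

Lemma disk_closed x : disk x -> closed_disk x.
Proof. by rewrite /disk /closed_disk /=; exact: ltW. Qed.

Lemma fl_w s r t : -1 < r < 1 -> fl_f s r t = w s (pt r t).
Proof. by move=> r1; apply: wW; apply: disk_closed; exact: pt_disk. Qed.

Lemma pt_closed r t : 0 <= r <= 1 -> closed_disk (pt r t).
Proof. by move=> r1; apply: pt_closed_disk; lra. Qed.

Lemma fl_sol s : polar_sol (polar_of (u s)) (fl_f s).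
Proof.
have [K K0 hK] := bounded_cylinder s cW.
apply: (polar_of_sol (hu s) (M := K)).
- by move=> x /disk_closed dx; rewrite -wW//; apply: hK => //; rewrite subrr normr0.
- exact: fl_cont.
- exact: fl_per.
- exact: fl_w.
Qed.

Lemma fl_reg s : polar_scalar (fl_f s) (fl_fr s) (fl_ft s) (fl_ftr s).
Proof.
have k1 := @slice3_polar_cont _ s cW1; have k2 := @slice3_polar_cont _ s cW2.
have k11 := @slice3_polar_cont _ s cW11; have k12 := @slice3_polar_cont _ s cW12.
have k21 := @slice3_polar_cont _ s cW21; have k22 := @slice3_polar_cont _ s cW22.
split.
- exact: fl_cont.
- cintro2 p; have l1 := k1 p; have l2 := k2 p; have p2 := @cont_snd R R p.
  by rewrite /fl_fr; ctac.
- cintro2 p; have l1 := k1 p; have l2 := k2 p; have p2 := @cont_snd R R p; have p1 := @cont_fst R R p.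
  by rewrite /fl_ft; ctac.
- cintro2 p; have l1 := k1 p; have l2 := k2 p; have p2 := @cont_snd R R p; have p1 := @cont_fst R R p.
  have l3 := k11 p; have l4 := k12 p; have l5 := k21 p; have l6 := k22 p.
  by rewrite /fl_ftr; ctac.
- by move=> r t; exact: grad3_der_r gW.
- by move=> r t; exact: grad3_der_t gW.
- move=> r t; apply: der_eq.
    apply: derM; first exact: der_id.
    by apply: derD; apply: derM; [exact: der_cst|exact: grad3_der_r gW1|exact: der_cst|exact: grad3_der_r gW2].
  by rewrite /fl_ftr /=; ring.
- exact: fl_per.
- by move=> t; rewrite /fl_ft mul0r.
Qed.

Lemma fl_eqn s r t : 0 < r < 1 -> r * fl_fd s r t =
  jr (polar_of (u s)) r t * fl_ft s r t - jt (polar_of (u s)) r t * fl_fr s r t.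
Proof.
move=> r1; rewrite /fl_fd euler; last by apply: pt_disk; exact: strip_pos.
rewrite /fl_ft /fl_fr /=.
generalize ('D_e1 (u s) (pt r t)) ('D_e2 (u s) (pt r t)) (W1 (s, pt r t)) (W2 (s, pt r t)) => a b c d.
have cs := @cos2Dsin2 R t.
transitivity (r * (a * d - b * c) * (cos t ^+ 2 + sin t ^+ 2)); last by ring.
by rewrite cs mulr1.
Qed.

Lemma fl_bound s : exists2 K, 0 <= K & forall r t, 0 <= r <= 1 -> `|fl_f s r t| <= K.
Proof.
have [K K0 hK] := bounded_cylinder s cW; exists K => // r t r1.
by apply: hK; [rewrite subrr normr0|exact: pt_closed].
Qed.

Lemma fl_taylor s : exists2 K, 0 <= K & forall y, `|y - s| <= 1 -> forall r t, 0 <= r <= 1 ->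
  `|fl_f y r t - fl_f s r t - (y - s) * fl_fd s r t| <= K * (y - s) ^+ 2.
Proof.
have [K K0 hK] := bounded_cylinder s cW00; exists K => // y ys r t r1.
apply: (@taylor_bound (fun z => W (z, pt r t)) (fun z => W0 (z, pt r t)) (fun z => W00 (z, pt r t))).
- by move=> z; exact: grad3_der_s gW.
- by move=> z; exact: grad3_der_s gW0.
- by move=> z zs; apply: hK; [exact: le_trans ys|exact: pt_closed].
Qed.

Lemma lip_W s : exists2 K, 0 <= K & forall y, `|y - s| <= 1 -> forall x, closed_disk x ->
  `|W (y, x) - W (s, x)| <= K * `|y - s|.
Proof.
have [K K0 hK] := bounded_cylinder s cW0; exists K => // y ys x cx.
apply: (@lipschitz_bound (fun z => W (z, x)) (fun z => W0 (z, x))).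
- by move=> z; exact: grad3_der_s gW.
- by move=> z zs; apply: hK => //; exact: le_trans ys.
Qed.

Lemma fl_lip s : exists2 K, 0 <= K & forall y, `|y - s| <= 1 -> forall r t, 0 <= r <= 1 ->
  `|fl_f y r t - fl_f s r t| <= K * `|y - s|.
Proof.
have [K K0 hK] := lip_W s; exists K => // y ys r t r1.
by apply: hK => //; exact: pt_closed.
Qed.

(** The stream function is Lipschitz in time because the maximum principle
    compares two of them by their vorticities. *)
Lemma fl_lipv s : exists2 K, 0 <= K & forall y, `|y - s| <= 1 -> forall r t, 0 <= r <= 1 ->
  `|jv (polar_of (u y)) r t - jv (polar_of (u s)) r t| <= K * `|y - s|.
Proof.
have [K K0 hK] := lip_W s; exists K => // y ys r t r1 /=.
have cd := pt_closed t r1; have cd' := cd; rewrite /closed_disk/= in cd'; rewrite /ext cd'.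
set k := K * `|y - s|; have k0 : 0 <= k by rewrite mulr_ge0.
have wk x : disk x -> `|w y x - w s x| <= k.
  by move=> /disk_closed dx; rewrite -!wW//; exact: hK.
have i1 : u y (pt r t) - u s (pt r t) <= k.
  apply: le_trans (max_principle (hu y) (hu s) (M := k) _ cd) _.
    by move=> x dx; apply: le_trans (wk x dx); exact: ler_norm.
  by rewrite pt_sq; have := sqr_ge0 r; nra.
have i2 : u s (pt r t) - u y (pt r t) <= k.
  apply: le_trans (max_principle (hu s) (hu y) (M := k) _ cd) _.
    by move=> x dx; apply: le_trans (wk x dx); rewrite distrC; exact: ler_norm.
  by rewrite pt_sq; have := sqr_ge0 r; nra.
by rewrite ler_norml i1 andbT lerNl opprB.
Qed.

Lemma fl_conserved s :
  [/\ pin (fl_f s) (fun _ _ => 1) = pin (fl_f 0) (fun _ _ => 1),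
      pin (fl_f s) (fun r _ => r ^+ 2) = pin (fl_f 0) (fun r _ => r ^+ 2),
      pin (fl_f s) (fl_f s) = pin (fl_f 0) (fl_f 0) &
      pin (fl_f s) (jv (polar_of (u s))) = pin (fl_f 0) (jv (polar_of (u 0)))].
Proof.
have cfd s' : cont2 (fl_fd s') by exact: slice3_polar_cont cW0.
split.
- exact: (conserved_mean fl_sol fl_reg cfd fl_eqn fl_taylor).
- exact: (conserved_mom3 fl_sol fl_reg cfd fl_eqn fl_taylor).
- exact: (conserved_enstrophy fl_sol fl_reg cfd fl_eqn fl_bound fl_taylor fl_lip).
- exact: (@conserved_energy _ fl_f (fun s => polar_of (u s)) _ _ _ _ fl_sol fl_reg cfd fl_eqn fl_taylor fl_lip fl_lipv).
Qed.

End flow.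

(** [G] has gradient [(G1, G2)] in the form of the chain rule along curves, which
    is stable under products and compositions without Frechet derivatives. *)
Definition chain_rule (G G1 G2 : R * R -> R) := forall (a b : R -> R) (s a' b' : R),
  der s a a' -> der s b b' ->
  der s (fun s => G (a s, b s)) (a' * G1 (a s, b s) + b' * G2 (a s, b s)).

Definition c1_plane (G : R * R -> R) := exists G1 G2 : R * R -> R,
  [/\ chain_rule G G1 G2, continuous G, continuous G1 & continuous G2].

Lemma grad_chain_rule (G G1 G2 : R * R -> R) : (forall x, has_grad G G1 G2 x) ->
  chain_rule G G1 G2 /\ continuous G.
Proof.
move=> h; split => [a b s a' b' da db|x].
  by have [d <- <-] := h (a s, b s); exact: der_plane.
by have [d _ _] := h x; exact: differentiable_continuous.
Qed.

Lemma smooth_grad3 (W : R * (R * R) -> R) vs : smooth W ->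
  has_grad3 (foldr (fun v g => 'D_v g) W vs) (foldr (fun v g => 'D_v g) W (k0 :: vs))
    (foldr (fun v g => 'D_v g) W (k1 :: vs)) (foldr (fun v g => 'D_v g) W (k2 :: vs)).
Proof. by move=> h p; split => //; exact: h. Qed.

Lemma smooth_cont (W : R * (R * R) -> R) vs : smooth W ->
  continuous (foldr (fun v g => 'D_v g) W vs).
Proof. by move=> h p; apply: differentiable_continuous; exact: h. Qed.

Lemma disk_near x : disk x -> \forall y \near x, disk y.
Proof. by move=> dx; apply: (cvgr_lt _ (@cont_sqnorm R x)). Qed.

(** [F] extends the solution to the whole plane, so that its polar expression is
    defined for all [(r, a)], also with [r < 0] or [1 < r]. *)
Lemma euler_conserved (w : R -> R * R -> R) : euler_smooth_solution w ->
  exists (F : R -> R * R -> R) (v : R -> polar_jet R),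
  (forall t, [/\ c1_plane (F t), forall x, closed_disk x -> F t x = w t x &
     polar_sol (v t) (fun r a => F t (pt r a))]) /\
  forall t, [/\ pin (fun r a => F t (pt r a)) (fun _ _ => 1) = pin (fun r a => F 0 (pt r a)) (fun _ _ => 1),
      pin (fun r a => F t (pt r a)) (fun r _ => r ^+ 2) = pin (fun r a => F 0 (pt r a)) (fun r _ => r ^+ 2),
      pin (fun r a => F t (pt r a)) (fun r a => F t (pt r a)) = pin (fun r a => F 0 (pt r a)) (fun r a => F 0 (pt r a)) &
      pin (fun r a => F t (pt r a)) (jv (v t)) = pin (fun r a => F 0 (pt r a)) (jv (v 0))].
Proof.
move=> [[W [sW wW]] [u [hu eu]]].
have gW := smooth_grad3 [::] sW; have gW0 := smooth_grad3 [:: k0] sW.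
have gW1 := smooth_grad3 [:: k1] sW; have gW2 := smooth_grad3 [:: k2] sW.
have c00 := @smooth_cont _ [:: k0; k0] sW; have c11 := @smooth_cont _ [:: k1; k1] sW.
have c12 := @smooth_cont _ [:: k2; k1] sW; have c21 := @smooth_cont _ [:: k1; k2] sW.
have c22 := @smooth_cont _ [:: k2; k2] sW.
have euler t x : disk x -> foldr (fun v g => 'D_v g) W [:: k0] (t, x) =
    'D_e1 (u t) x * foldr (fun v g => 'D_v g) W [:: k2] (t, x) -
    'D_e2 (u t) x * foldr (fun v g => 'D_v g) W [:: k1] (t, x).
  move=> dx; have [dW d1 d2] := grad3_slice t x gW.
  have eW v : v != 0 -> 'D_v (w t) x = 'D_v (fun x => W (t, x)) x.
    move=> v0; apply: near_eq_derive => //; apply: filterS (disk_near dx) => y dy.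
    by rewrite wW//; exact: disk_closed.
  have := eu t x dx; rewrite /perp_grad /partial1 /partial2 -/e1 -/e2.
  have -> : (w ^~ x) = fun s => W (s, x).
    by apply/funext => s; rewrite wW//; exact: disk_closed.
  rewrite derive1E; have [_ ->] := grad3_der_s t x gW.
  have n1 : e1 != 0 :> R * R by apply/eqP => -[] /eqP; rewrite oner_eq0.
  have n2 : e2 != 0 :> R * R by apply/eqP => -[] /eqP; rewrite oner_eq0.
  rewrite /= (eW _ n1) (eW _ n2) d1 d2 /=.
  generalize ('D_k0 W (t, x)) ('D_k1 W (t, x)) ('D_k2 W (t, x)) ('D_e1 (u t) x) ('D_e2 (u t) x) => a b c d e h.
  have -> : a = a + (e * b + - d * c) - (e * b - d * c) by ring.
  by rewrite h; ring.
exists (fun t x => W (t, x)), (fun t => polar_of (u t)); split => t.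
  split.
  - exists (fun x => foldr (fun v g => 'D_v g) W [:: k1] (t, x)), (fun x => foldr (fun v g => 'D_v g) W [:: k2] (t, x)).
    have [h1 h2] := grad_chain_rule (fun x => grad3_slice t x gW).
    split; [exact: h1|exact: h2|exact: slice3_cont (@smooth_cont _ [:: k1] sW)|].
    exact: slice3_cont (@smooth_cont _ [:: k2] sW).
  - exact: wW.
  - exact: (fl_sol gW wW hu).
exact: (fl_conserved gW gW0 gW1 gW2 c00 c11 c12 c21 c22 wW hu euler).
Qed.

End euler_flow.

(** * Integrals over the disk in polar coordinates *)

Section polar_area.
Context {R : realType}.
Implicit Types (r s t : R).

Lemma param_der (f f' : R -> R -> R) (a b : R) : a <= b ->
  (forall r y, der r (f ^~ y) (f' r y)) -> cont2 f -> cont2 f' ->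
  forall r, der r (fun r => integ a b (f r)) (integ a b (f' r)).
Proof.
move=> ab df cf cf' r; apply: integ_param_der => //.
- by near=> s => y.
- by near=> s; exact: slice.
- exact: slice.
- by move=> y _; exact: cf'.
Unshelve. all: by end_near. Qed.

Lemma integ_scale (f : R -> R) c : continuous f ->
  integ (- c) c f = c * integ (- 1) 1 (fun s => f (s * c)).
Proof.
move=> cf; have cs : continuous (fun s : R => f (s * c)).
  by move=> x; apply: (@cont_comp _ _ (fun s : R => s * c) f); [ctac|exact: cf].
rewrite -integZ// (@integ_primitive _ (fun s => c * f (s * c)) (fun s => prim f (s * c))).
  by rewrite integE mulN1r mul1r.
move=> x; apply: der_eq; first by apply: der_comp; [exact: prim_der|dtac].
by rewrite /=; ring.
Qed.

Variables (g g1 g2 : R * R -> R).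
Hypothesis gg : chain_rule g g1 g2.
Hypotheses (cg : continuous g) (cg1 : continuous g1) (cg2 : continuous g2).

Lemma cont_plane (T : topologicalType) (G : R * R -> R) (a b : T -> R) x : continuous G ->
  {for x, continuous a} -> {for x, continuous b} -> {for x, continuous (fun y => G (a y, b y))}.
Proof.
move=> cG ca cb; apply: (@cont_pair _ _ _ _ (fun x y => G (x, y)) a b) => //.
rewrite (_ : (fun p0 : R * R => _) = G); first exact: cG.
by apply/funext => -[].
Qed.

(** For [-1 <= s <= 1] and [- pi / 2 <= t <= pi / 2] these points sweep the
    disk of radius [q], a horizontal chord for each [t]. *)
Definition chord (q t s : R) : R * R := (q * s * cos t, q * sin t).

Let p11 (p : (R * R) * R) : {for p, continuous (fun p : (R * R) * R => p.1.1)}.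
Proof. exact: cont_fst_fst. Qed.
Let p12 (p : (R * R) * R) : {for p, continuous (fun p : (R * R) * R => p.1.2)}.
Proof. exact: cont_fst_snd. Qed.
Let p2 (p : (R * R) * R) : {for p, continuous (fun p : (R * R) * R => p.2)}.
Proof. exact: cont_snd. Qed.

Lemma chord_cont (G : R * R -> R) : continuous G ->
  continuous (fun p : (R * R) * R => G (chord p.1.1 p.1.2 p.2)).
Proof.
move=> cG p; have k1 := @p11 p; have k2 := @p12 p; have k3 := @p2 p.
by apply: (@cont_plane _ G (fun p : (R * R) * R => p.1.1 * p.2 * cos p.1.2)
  (fun p : (R * R) * R => p.1.1 * sin p.1.2)) => //; ctac.
Qed.

Definition slab q t := integ (- 1) 1 (fun s => (q * cos t) ^+ 2 * g (chord q t s)).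
Definition slab' q t := integ (- 1) 1 (fun s => 2 * q * cos t ^+ 2 * g (chord q t s) +
  (q * cos t) ^+ 2 * (s * cos t * g1 (chord q t s) + sin t * g2 (chord q t s))).

Lemma slab_cont3 : continuous (fun p : (R * R) * R => (p.1.1 * cos p.1.2) ^+ 2 * g (chord p.1.1 p.1.2 p.2)).
Proof.
move=> p; have k1 := @p11 p; have k2 := @p12 p; have k3 := @p2 p; have k4 := @chord_cont g cg p.
by change {for p, continuous (fun p : (R * R) * R => (p.1.1 * cos p.1.2) ^+ 2 * g (chord p.1.1 p.1.2 p.2))}; ctac.
Qed.

Lemma slab'_cont3 : continuous (fun p : (R * R) * R => 2 * p.1.1 * cos p.1.2 ^+ 2 * g (chord p.1.1 p.1.2 p.2) +
  (p.1.1 * cos p.1.2) ^+ 2 * (p.2 * cos p.1.2 * g1 (chord p.1.1 p.1.2 p.2) + sin p.1.2 * g2 (chord p.1.1 p.1.2 p.2))).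
Proof.
move=> p; have k1 := @p11 p; have k2 := @p12 p; have k3 := @p2 p; have k4 := @chord_cont g cg p.
have k5 := @chord_cont g1 cg1 p; have k6 := @chord_cont g2 cg2 p.
by change {for p, continuous (fun p : (R * R) * R => 2 * p.1.1 * cos p.1.2 ^+ 2 * g (chord p.1.1 p.1.2 p.2) +
  (p.1.1 * cos p.1.2) ^+ 2 * (p.2 * cos p.1.2 * g1 (chord p.1.1 p.1.2 p.2) + sin p.1.2 * g2 (chord p.1.1 p.1.2 p.2)))}; ctac.
Qed.

Lemma slab_cont : cont2 slab.
Proof. exact: (@integ_param_continuous R _ (fun (p : R * R) s => (p.1 * cos p.2) ^+ 2 * g (chord p.1 p.2 s)) _ _ slab_cont3). Qed.

Lemma slab'_cont : cont2 slab'.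
Proof.
exact: (@integ_param_continuous R _ (fun (p : R * R) s => 2 * p.1 * cos p.2 ^+ 2 * g (chord p.1 p.2 s) +
  (p.1 * cos p.2) ^+ 2 * (s * cos p.2 * g1 (chord p.1 p.2 s) + sin p.2 * g2 (chord p.1 p.2 s))) _ _ slab'_cont3).
Qed.

Lemma cont3_fix2 (F : (R * R) * R -> R) t : continuous F -> cont2 (fun q s => F ((q, t), s)).
Proof.
move=> cF p; have h1 := @cont_fst R R p; have h2 := @cont_snd R R p.
have c := @cont_cst.
apply: (@continuous_comp _ _ _ (fun p : R * R => ((p.1, t), p.2)) F); last exact: cF.
have ht : (fun _ : R * R => t) @ p --> t by exact: cvg_cst.
exact: (cvg_pair (cvg_pair h1 ht) h2).
Qed.

Lemma cont3_fix1 (F : (R * R) * R -> R) q : continuous F -> cont2 (fun t s => F ((q, t), s)).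
Proof.
move=> cF p; have h1 := @cont_fst R R p; have h2 := @cont_snd R R p.
apply: (@continuous_comp _ _ _ (fun p : R * R => ((q, p.1), p.2)) F); last exact: cF.
have ht : (fun _ : R * R => q) @ p --> q by exact: cvg_cst.
exact: (cvg_pair (cvg_pair ht h1) h2).
Qed.

Lemma slab_der q t : der q (slab ^~ t) (slab' q t).
Proof.
apply: (@param_der (fun q s => (q * cos t) ^+ 2 * g (chord q t s)) (fun q s => 2 * q * cos t ^+ 2 * g (chord q t s) +
  (q * cos t) ^+ 2 * (s * cos t * g1 (chord q t s) + sin t * g2 (chord q t s)))).
- lra.
- move=> r s; apply: der_eq.
    apply: derM; first by dtac.
    by apply: (@gg (fun q => q * s * cos t) (fun q => q * sin t)); dtac.
  by rewrite /chord /=; ring.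
- exact: cont3_fix2 slab_cont3.
- exact: cont3_fix2 slab'_cont3.
Qed.

(** In the coordinates [(s, t)] of [chord] the integrand of [slab'] is the
    divergence of a field whose [t]-component [T] vanishes at the endpoints
    [- pi / 2] and [pi / 2]; what is left are the two ends [s = 1], [s = -1] of
    the chords, that is, the circle. *)
Lemma slab'_sides q : integ (- (pi / 2)) (pi / 2) (slab' q) =
  q * integ (- (pi / 2)) (pi / 2) (fun t => g (chord q t 1) + g (chord q t (- 1))).
Proof.
pose T t := integ (- 1) 1 (fun s => sin t * cos t * g (chord q t s)).
pose T' t := integ (- 1) 1 (fun s => (cos t ^+ 2 - sin t ^+ 2) * g (chord q t s) +
   sin t * cos t * (- (q * s * sin t) * g1 (chord q t s) + q * cos t * g2 (chord q t s))).
have cTF : continuous (fun p : (R * R) * R => sin p.1.2 * cos p.1.2 * g (chord p.1.1 p.1.2 p.2)).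
  move=> p; have k1 := @p11 p; have k2 := @p12 p; have k3 := @p2 p; have k4 := @chord_cont g cg p.
  by change {for p, continuous (fun p : (R * R) * R => sin p.1.2 * cos p.1.2 * g (chord p.1.1 p.1.2 p.2))}; ctac.
have cTF' : continuous (fun p : (R * R) * R => (cos p.1.2 ^+ 2 - sin p.1.2 ^+ 2) * g (chord p.1.1 p.1.2 p.2) +
   sin p.1.2 * cos p.1.2 * (- (p.1.1 * p.2 * sin p.1.2) * g1 (chord p.1.1 p.1.2 p.2) + p.1.1 * cos p.1.2 * g2 (chord p.1.1 p.1.2 p.2))).
  move=> p; have k1 := @p11 p; have k2 := @p12 p; have k3 := @p2 p; have k4 := @chord_cont g cg p.
  have k5 := @chord_cont g1 cg1 p; have k6 := @chord_cont g2 cg2 p.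
  by change {for p, continuous (fun p : (R * R) * R => (cos p.1.2 ^+ 2 - sin p.1.2 ^+ 2) * g (chord p.1.1 p.1.2 p.2) +
   sin p.1.2 * cos p.1.2 * (- (p.1.1 * p.2 * sin p.1.2) * g1 (chord p.1.1 p.1.2 p.2) + p.1.1 * cos p.1.2 * g2 (chord p.1.1 p.1.2 p.2)))}; ctac.
have c1 := @cont3_fix1 _ q cTF; have c2 := @cont3_fix1 _ q cTF'.
have dT t : der t T (T' t).
  apply: (@param_der (fun t s => sin t * cos t * g (chord q t s)) (fun t s => (cos t ^+ 2 - sin t ^+ 2) * g (chord q t s) +
   sin t * cos t * (- (q * s * sin t) * g1 (chord q t s) + q * cos t * g2 (chord q t s)))) => //.
  - move=> r s; apply: der_eq.
      apply: derM; first by dtac.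
      by apply: (@gg (fun t => q * s * cos t) (fun t => q * sin t)); dtac.
    by rewrite /chord /=; ring.
have IT : integ (- (pi / 2)) (pi / 2) T' = 0.
  have hc : cos (pi / 2) = 0 :> R by exact: cos_pihalf.
  have z t : cos t = 0 -> T t = 0.
    move=> ct; rewrite /T (_ : (fun s => _) = fun=> 0); first by rewrite integ_cst mul0r.
    by apply/funext => s; rewrite ct mulr0 mul0r.
  by rewrite (integ_primitive _ _ dT) !z ?subrr ?cosN.
have cg0 := @cont3_fix1 _ q (chord_cont cg).
have cg1' := @cont3_fix1 _ q (chord_cont cg1).
have cg2' := @cont3_fix1 _ q (chord_cont cg2).
have side t : slab' q t = q * (g (chord q t 1) + g (chord q t (- 1))) + q * T' t.
  have s0 := slice (r := t) cg0; have s1 := slice (r := t) cg1'; have s2 := slice (r := t) cg2'.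
  rewrite /= in s0 s1 s2.
  have -> : g (chord q t 1) + g (chord q t (- 1)) =
     integ (- 1) 1 (fun s => g (chord q t s) + s * (q * cos t) * g1 (chord q t s)).
    rewrite (@integ_primitive _ _ (fun s => s * g (chord q t s))); first by ring.
    move=> s; apply: der_eq.
      apply: derM; first by dtac.
      by apply: (@gg (fun s => q * s * cos t) (fun=> q * sin t)); dtac.
    by rewrite /chord /=; ring.
  rewrite /T' -!integZ -?integD; [|by ctac..].
  congr (integ _ _ _); apply/funext => s.
  have cs := @cos2Dsin2 R t.
  have -> : sin t ^+ 2 = 1 - cos t ^+ 2 by rewrite -cs; ring.
  have e : sin t * cos t * (- (q * s * sin t) * g1 (chord q t s) + q * cos t * g2 (chord q t s)) =
    - (q * s * cos t) * (1 - cos t ^+ 2) * g1 (chord q t s) + q * sin t * cos t ^+ 2 * g2 (chord q t s).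
    by rewrite (_ : 1 - cos t ^+ 2 = sin t ^+ 2); [ring|rewrite -cs; ring].
  by rewrite e; ring.
have cT' : continuous T'.
  exact: (@integ_param_continuous R _ (fun t s => (cos t ^+ 2 - sin t ^+ 2) * g (chord q t s) +
   sin t * cos t * (- (q * s * sin t) * g1 (chord q t s) + q * cos t * g2 (chord q t s))) _ _ c2).
have ce s : continuous (fun t => g (chord q t s)).
  move=> t; apply: (@cont_pair _ _ _ _ (fun t s => g (chord q t s)) id (fun=> s)); [exact: cg0|ctac..].
have ce1 := ce 1; have ce2 := ce (- 1).
rewrite (_ : slab' q = fun t => q * (g (chord q t 1) + g (chord q t (- 1))) + q * T' t).
  have k1 : continuous (fun t => g (chord q t 1) + g (chord q t (- 1))) by ctac.
  by rewrite [LHS]integD; [rewrite (integZ _ _ _ k1) (integZ _ _ _ cT') IT mulr0 addr0|ctac..].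
by apply/funext => t; exact: side.
Qed.

Lemma sides_oint q : integ (- (pi / 2)) (pi / 2) (fun t => g (chord q t 1) + g (chord q t (- 1))) =
  oint (fun t => g (pt q t)).
Proof.
have cF : continuous (fun t => g (pt q t)) by exact: slice (cont_pt cg).
pose F t := g (pt q t).
have -> : oint F = integ (- (pi / 2)) (- (pi / 2) + 2 * pi) F.
  by rewrite (integ_periodic (T := 2 * pi))// => t; rewrite /F pt_per.
rewrite -(integ_chasles F (- (pi / 2)) (pi / 2)).
have ce : continuous (fun t => g (chord q t (- 1))).
  by move=> t; apply: (@cont_plane _ g (fun t => q * (- 1) * cos t) (fun t => q * sin t)); [exact: cg|ctac..].
have -> : integ (pi / 2) (- (pi / 2) + 2 * pi) F = integ (- (pi / 2)) (pi / 2) (fun t => g (chord q t (- 1))).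
  have -> : integ (pi / 2) (- (pi / 2) + 2 * pi) F = integ (- (pi / 2) + pi) (pi / 2 + pi) F.
    by congr (integ _ _ _); lra.
  rewrite -integ_shift//; have := @integ_opp _ (fun t => g (chord q t (- 1))) (- (pi / 2)) (pi / 2) ce.
  rewrite opprK => <-; congr (integ _ _ _); apply/funext => t.
  by rewrite /F /pt /chord cosDpi sinDpi cosN sinN; congr (g (_, _)); ring.
have eF : F = fun t => g (chord q t 1) by apply/funext => t; rewrite /F /pt /chord mulr1.
by rewrite eF -integD// -eF.
Qed.

Lemma slab1 : integ (- (pi / 2)) (pi / 2) (slab 1) = integ 0 1 (fun r => r * oint (fun t => g (pt r t))).
Proof.
pose A q := integ (- (pi / 2)) (pi / 2) (slab q).
have dA q : der q A (q * oint (fun t => g (pt q t))).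
  rewrite -sides_oint -slab'_sides; apply: param_der.
  - by have := @pi_ge0 R; lra.
  - by move=> r t; exact: slab_der.
  - exact: slab_cont.
  - exact: slab'_cont.
rewrite (integ_primitive _ _ dA) -[LHS]subr0; congr (_ - _); rewrite /A.
rewrite (_ : slab 0 = fun=> 0); first by rewrite integ_cst mul0r.
apply/funext => t; rewrite /slab (_ : (fun s => _) = fun=> 0); first by rewrite integ_cst mul0r.
by apply/funext => s; rewrite mul0r expr0n mul0r.
Qed.

Definition half_chord (y : R) := Num.sqrt (1 - y ^+ 2).
Definition chord_integral y := integ (- half_chord y) (half_chord y) (fun x => g (x, y)).

Lemma cont_slice1 y : continuous (fun x => g (x, y)).
Proof. by move=> x; apply: (@cont_plane _ g (fun x => x) (fun=> y)); [exact: cg|ctac..]. Qed.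

Lemma half_chord_cont : continuous half_chord.
Proof.
move=> y; apply: (@cont_comp _ _ (fun y : R => 1 - y ^+ 2) (@Num.sqrt R)); first by ctac.
exact: sqrt_continuous.
Qed.

Lemma chord_integralE y : chord_integral y = half_chord y * integ (- 1) 1 (fun s => g (s * half_chord y, y)).
Proof. by rewrite /chord_integral integ_scale//; exact: cont_slice1. Qed.

Lemma chord_integral_cont : continuous chord_integral.
Proof.
rewrite (_ : chord_integral = fun y => half_chord y * integ (- 1) 1 (fun s => g (s * half_chord y, y))); last first.
  by apply/funext => y; exact: chord_integralE.
have ch := half_chord_cont.
have ci : continuous (fun y => integ (- 1) 1 (fun s => g (s * half_chord y, y))).
  apply: (@integ_param_continuous R _ (fun y s => g (s * half_chord y, y))) => p.
  have h1 := @cont_fst R R p; have h2 := @cont_snd R R p.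
  have h3 : {for p, continuous (fun p : R * R => half_chord p.1)}.
    by apply: (@cont_comp _ _ (fun p : R * R => p.1) half_chord); [exact: h1|exact: ch].
  by apply: (@cont_plane _ g (fun p : R * R => p.2 * half_chord p.1) (fun p => p.1)); [exact: cg|ctac..].
by ctac.
Qed.

(** The left side is the integral over the unit disk by horizontal chords, which
    [y = sin t] turns into the integral of [slab 1]. The latter grows with the
    radius at the rate of the circle integrals. *)
Lemma chords_polar : integ (- 1) 1 chord_integral = integ 0 1 (fun r => r * oint (fun t => g (pt r t))).
Proof.
rewrite -slab1; have cc := chord_integral_cont.
have ccos := @continuous_cos R; have csin := @continuous_sin R.
have cs : continuous (fun t : R => chord_integral (sin t)).
  by move=> t; apply: (@cont_comp _ _ sin); [exact: csin|exact: cc].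
transitivity (integ (- (pi / 2)) (pi / 2) (fun t => chord_integral (sin t) * cos t)).
  rewrite (@integ_primitive _ (fun t => chord_integral (sin t) * cos t) (fun t => prim chord_integral (sin t))).
    by rewrite sinN sin_pihalf integE.
  by move=> t; apply: der_comp; [exact: prim_der|exact: is_derive_sin].
apply: eq_integ; [by have := @pi_ge0 R; lra|by ctac|exact: slice slab_cont|].
move=> t /andP[t1 t2].
have c0 : 0 <= cos t by apply: cos_ge0_pihalf; rewrite !ltW.
have hE : half_chord (sin t) = cos t.
  rewrite /half_chord (_ : 1 - sin t ^+ 2 = cos t ^+ 2); first by rewrite sqrtr_sqr ger0_norm.
  by rewrite -(@cos2Dsin2 R t); ring.
have cgs : continuous (fun s => g (chord 1 t s)).
  by move=> s; apply: (@cont_plane _ g (fun s => 1 * s * cos t) (fun=> 1 * sin t)); [exact: cg|ctac..].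
rewrite chord_integralE hE /slab integZ// mul1r expr2.
rewrite mulrAC; congr (_ * _); congr (integ _ _ _); apply/funext => s.
by rewrite /chord !mul1r.
Qed.

End polar_area.

(** * The L2 norm on the disk *)

Section norm_formula.
Context {R : realType}.
Local Notation mu := (@lebesgue_measure R).

(** Open sets of the plane are countable unions of rational boxes, hence
    measurable for the product of the Borel structures. *)
Lemma open_plane_measurable (U : set (R * R)) : open U -> measurable U.
Proof.
move=> oU.
pose box (a b q : rat) : set (R * R) :=
  [set x | `|x.1 - ratr a| < ratr q /\ `|x.2 - ratr b| < ratr q].
pose F (a b q : rat) : set (R * R) := if `[< box a b q `<=` U >] then box a b q else set0.
have -> : U = \bigcup_a \bigcup_b \bigcup_q F a b q.
  apply/seteqP; split => [[x y] Uxy|x [a _ [b _ [q _]]]]; last by rewrite /F; case: asboolP => // h; exact: h.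
  have /nbhs_ballP[e /= e0 he] : nbhs (x, y) U by apply: open_nbhs_nbhs.
  have [q] := @rat_in_itvoo R 0 (e / 2) (ltac:(lra)); rewrite in_itv/= => /andP[q0 q2].
  have [a] := @rat_in_itvoo R x (x + ratr q) (ltac:(lra)); rewrite in_itv/= => /andP[a1 a2].
  have [b] := @rat_in_itvoo R y (y + ratr q) (ltac:(lra)); rewrite in_itv/= => /andP[b1 b2].
  exists a => //; exists b => //; exists q => //; rewrite /F.
  case: asboolP => [_|[]].
    by split; rewrite /= distrC gtr0_norm; lra.
  move=> [x' y'] [/= h1 h2]; apply: he; split => /=; rewrite /ball /=.
    have -> : x - x' = (x - ratr a) - (x' - ratr a) by ring.
    apply: le_lt_trans (ler_normB _ _) _; rewrite [`|x - _|]distrC [`|_ - x|]gtr0_norm; lra.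
  have -> : y - y' = (y - ratr b) - (y' - ratr b) by ring.
  apply: le_lt_trans (ler_normB _ _) _; rewrite [`|y - _|]distrC [`|_ - y|]gtr0_norm; lra.
do 3 apply: bigcupT_measurable_rat => ?.
rewrite /F; case: asboolP => // _.
set a := (X in box X); set b := (X in box _ X); set q := (X in box _ _ X).
rewrite (_ : box a b q = [set x | `|x - ratr a| < ratr q] `*` [set x | `|x - ratr b| < ratr q])//.
have ob (c : R) : measurable [set x : R | `|x - c| < ratr q].
  apply: open_measurable; apply: (@open_comp _ _ (fun x : R => `|x - c|) [set y | y < ratr q]); last exact: open_lt.
  by move=> x _; change {for x, continuous (fun x : R => `|x - c|)}; ctac.
by apply: measurableX; exact: ob.
Qed.

Lemma continuous_plane_measurable (G : R * R -> R) : continuous G -> measurable_fun setT G.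
Proof.
move=> /continuousP cG; apply: (measurability _ (measurable_realfun.RGenOpens.measurableE R)).
move=> _ [_ [a [b ->] <-]]; rewrite setTI; apply: open_plane_measurable.
by apply: cG; exact: interval_open.
Qed.

Lemma disk_measurable : measurable (@disk R).
Proof.
apply: open_plane_measurable.
apply: (@open_comp _ _ (fun x : R * R => x.1 ^+ 2 + x.2 ^+ 2) [set y | y < 1]); last exact: open_lt.
by move=> x _; exact: cont_sqnorm.
Qed.

Lemma in_chord (x y : R) : disk (x, y) <-> - half_chord y < x < half_chord y.
Proof.
rewrite /disk /half_chord /= -ltr_norml -(sqrtr_sqr x); split => h.
  by rewrite ltr_sqrt; have := sqr_ge0 x; lra.
have h0 : 0 < 1 - y ^+ 2 by rewrite -sqrtr_gt0; apply: le_lt_trans h; exact: sqrtr_ge0.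
by move: h; rewrite ltr_sqrt//; lra.
Qed.

Lemma chord_lebesgue (g : R * R -> R) y : continuous g ->
  (\int[mu]_x (((EFin \o g) \_ (@disk R)) (x, y)) = (chord_integral g y)%:E)%E.
Proof.
move=> cg; have c1 : continuous (fun x : R => g (x, y)).
  by move=> x; apply: (@cont_plane _ _ g (fun x => x) (fun=> y)); [exact: cg|ctac..].
pose I : set R := `]- half_chord y, half_chord y[%classic.
transitivity (\int[mu]_(x in I) (g (x, y))%:E)%E.
  rewrite [RHS]integral_mkcond; apply: eq_integral => x _.
  rewrite !patchE; congr (if _ then _ else _).
  by apply/idP/idP; rewrite !inE /I /= in_itv /=; move/in_chord.
have c0 : 0 <= half_chord y by exact: sqrtr_ge0.
rewrite /I {I}.
rewrite /chord_integral; move: c0; rewrite le_eqVlt => /orP[/eqP <-|c0].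
  by rewrite oppr0 integ_same set_itv_ge ?bnd_simp ?ltxx// integral_set0.
rewrite -lebesgue_int; [|by lra|by []].
rewrite [RHS]integral_itv_bndoo//.
apply/measurable_EFinP; apply: measurable_funTS.
exact: continuous_measurable_fun.
Qed.

Lemma chord_integral_out (g : R * R -> R) y : y \notin `[-1, 1] -> chord_integral g y = 0.
Proof.
rewrite in_itv/= -ler_norml -ltNge => y1.
rewrite /chord_integral /half_chord ler0_sqrtr ?oppr0 ?integ_same//.
have : 1 <= y ^+ 2 by rewrite -real_normK ?num_real// expr_ge1// ltW.
by lra.
Qed.

Lemma disk_integral (g : R * R -> R) : c1_plane g -> (forall x, 0 <= g x) ->
  (\int[mu \x mu]_x (((EFin \o g) \_ (@disk R)) x) =
    (integ 0 1 (fun r => r * oint (fun t => g (pt r t))))%:E)%E.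
Proof.
move=> [g1 [g2 [hg cg cg1 cg2]]] g0.
have cc := chord_integral_cont cg.
rewrite fubini_tonelli2; last 2 first.
- apply: (measurable_restrictT (EFin \o g) disk_measurable).1; apply/measurable_EFinP.
  by apply: measurable_funTS; exact: continuous_plane_measurable.
- by move=> x; rewrite patchE; case: ifP => // _; rewrite lee_fin.
rewrite -(chords_polar hg cg cg1 cg2) -lebesgue_int//.
rewrite [RHS]integral_mkcond; apply: eq_integral => y _.
rewrite /fubini_G chord_lebesgue// patchE; case: ifPn => //.
by rewrite notin_setE /= => h; rewrite chord_integral_out//; apply/negP.
Qed.

Lemma c1_planeM (G H : R * R -> R) : c1_plane G -> c1_plane H -> c1_plane (fun x => G x * H x).
Proof.
move=> [G1 [G2 [hG cG cG1 cG2]]] [H1 [H2 [hH cH cH1 cH2]]].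
exists (fun x => G1 x * H x + G x * H1 x), (fun x => G2 x * H x + G x * H2 x); split.
- move=> a b s a' b' da db; apply: der_eq; first by apply: derM; [exact: (hG a b s a' b')|exact: (hH a b s a' b')].
  by rewrite /=; ring.
- by cintro x; have k1 := @cG x; have k2 := @cH x; ctac.
- by cintro x; have k1 := @cG x; have k2 := @cH x; have k3 := @cG1 x; have k4 := @cH1 x; ctac.
- by cintro x; have k1 := @cG x; have k2 := @cH x; have k3 := @cG2 x; have k4 := @cH2 x; ctac.
Qed.

Lemma c1_planeD (G H : R * R -> R) : c1_plane G -> c1_plane H -> c1_plane (fun x => G x + H x).
Proof.
move=> [G1 [G2 [hG cG cG1 cG2]]] [H1 [H2 [hH cH cH1 cH2]]].
exists (fun x => G1 x + H1 x), (fun x => G2 x + H2 x); split.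
- move=> a b s a' b' da db; apply: der_eq; first by apply: derD; [exact: (hG a b s a' b')|exact: (hH a b s a' b')].
  by rewrite /=; ring.
- by cintro x; have k1 := @cG x; have k2 := @cH x; ctac.
- by cintro x; have k3 := @cG1 x; have k4 := @cH1 x; ctac.
- by cintro x; have k3 := @cG2 x; have k4 := @cH2 x; ctac.
Qed.

Lemma c1_plane_cst (c : R) : c1_plane (fun=> c).
Proof.
exists (fun=> 0), (fun=> 0); split; try by move=> x; exact: cont_cst.
by move=> a b s a' b' da db; apply: der_eq; [exact: der_cst|ring].
Qed.

Lemma c1_plane_fst : c1_plane (fun x : R * R => x.1).
Proof.
exists (fun=> 1), (fun=> 0); split; try by move=> x; exact: cont_cst.
  by move=> a b s a' b' da db; apply: der_eq; [exact: da|ring].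
by move=> x; exact: cont_fst.
Qed.

Lemma c1_plane_snd : c1_plane (fun x : R * R => x.2).
Proof.
exists (fun=> 0), (fun=> 1); split; try by move=> x; exact: cont_cst.
  by move=> a b s a' b' da db; apply: der_eq; [exact: db|ring].
by move=> x; exact: cont_snd.
Qed.

Lemma c1_plane_comp (h h' : R -> R) (G : R * R -> R) : (forall z, der z h (h' z)) -> continuous h' ->
  c1_plane G -> c1_plane (fun x => h (G x)).
Proof.
move=> dh ch' [G1 [G2 [hG cG cG1 cG2]]]; have ch := der_continuous dh.
exists (fun x => h' (G x) * G1 x), (fun x => h' (G x) * G2 x); split.
- move=> a b s a' b' da db; apply: der_eq; first by apply: der_comp; [exact: dh|exact: (hG a b s a' b')].
  by rewrite /=; ring.
- by move=> x; apply: (@cont_comp _ _ G h); [exact: cG|exact: ch].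
- cintro x; have k1 := @cG1 x.
  have k2 : {for x, continuous (fun x => h' (G x))} by apply: (@cont_comp _ _ G h'); [exact: cG|exact: ch'].
  by ctac.
- cintro x; have k1 := @cG2 x.
  have k2 : {for x, continuous (fun x => h' (G x))} by apply: (@cont_comp _ _ G h'); [exact: cG|exact: ch'].
  by ctac.
Qed.

(** Tonelli gives iterated integrals along chords, which are then rewritten in
    polar coordinates. *)
Lemma norm2_polar (f G : R * R -> R) : c1_plane G -> (forall x, disk x -> f x = G x) ->
  norm2 f = (Num.sqrt (pin (fun r t => G (pt r t)) (fun r t => G (pt r t))))%:E.
Proof.
move=> cG fG; have := disk_integral (c1_planeM cG cG) (fun x => sqr_ge0 (G x)).
move=> e; rewrite /norm2 Lnorm.unlock.
rewrite (_ : (\int[_]_x _)%E = (pin (fun r t => G (pt r t)) (fun r t => G (pt r t)))%:E).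
  by rewrite poweR_EFin powR12_sqrt//; apply: pin_ge0; case: cG => G1 [G2 [_ cG _ _]]; exact: cont_pt.
rewrite /pin -e; apply: eq_integral => x _; rewrite !patchE.
case: ifPn => [|_]; last by rewrite abse0 poweR_EFin powR0.
rewrite inE => dx; have -> : (EFin \o f) x = (G x)%:E by rewrite /= fG.
rewrite (_ : `|(G x)%:E|%E = (`|G x|)%:E)// poweR_EFin powR_mulrn//; congr (_%:E).
by rewrite real_normK ?num_real// expr2.
Qed.

End norm_formula.

(** * Stability of the orbit *)

Section stability.
Context {R : realType}.
Local Notation j := (j11 R).
Local Notation N := (@phi_norm R).
Local Notation N0 := (@psi_norm R).
Local Notation kappa := (integ 0 1 (fun r : R => r ^+ 3 * psi r)).
Local Notation mu := (@margin R).

Lemma polar_coordinates (x y : R) : exists t, (x, y) = pt (Num.sqrt (x ^+ 2 + y ^+ 2)) t.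
Proof.
set r := Num.sqrt _; have r2 : r ^+ 2 = x ^+ 2 + y ^+ 2 by rewrite sqr_sqrtr ?addr_ge0 ?sqr_ge0.
have r0 : 0 <= r by exact: sqrtr_ge0.
have [r00|rp] := eqVneq r 0.
  have x0 : x = 0 by apply/eqP; rewrite -sqrf_eq0; apply/eqP; have := sqr_ge0 x; have := sqr_ge0 y; rewrite r00 expr0n /= in r2; lra.
  have y0 : y = 0 by apply/eqP; rewrite -sqrf_eq0; apply/eqP; have := sqr_ge0 x; have := sqr_ge0 y; rewrite r00 expr0n /= in r2; lra.
  by exists 0; rewrite /pt r00 !mul0r x0 y0.
have {}r0 : 0 < r by rewrite lt_neqAle eq_sym rp.
have c1 : -1 <= x / r <= 1.
  rewrite -ler_norml -(@expr_le1 _ 2)// real_normK ?num_real// expr_div_n r2.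
  rewrite ler_pdivrMr; last by rewrite -r2 exprn_gt0.
  by have := sqr_ge0 y; lra.
have s1 : 1 - (x / r) ^+ 2 = (y / r) ^+ 2.
  by rewrite !expr_div_n -[1](@divff _ (r ^+ 2)) ?sqrf_eq0// -mulrBl r2; congr (_ / _); ring.
have cE : cos (acos (x / r)) = x / r by exact: acosK.
have sE : sin (acos (x / r)) = `|y / r| by rewrite sin_acos// s1 sqrtr_sqr.
have xr : r * (x / r) = x by rewrite mulrC divfK.
have yr : r * (y / r) = y by rewrite mulrC divfK.
case: (leP 0 (y / r)) => y0.
- by exists (acos (x / r)); rewrite /pt cE sE ger0_norm// xr yr.
- by exists (- acos (x / r)); rewrite /pt cosN sinN cE sE ltr0_norm// opprK xr yr.
Qed.

Lemma bess_c1 n : exists2 d : R -> R, (forall z, der z (bess n) (d z)) & continuous d.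
Proof.
exists (fun z => limn (pseries (pseries_diffs (@bcoef R n)) z)).
  by move=> z; exact: fdom_der (@bcoef_fdom R n).
by apply: der_continuous => z; apply: fdom_der; exact: fdom_diffs (@bcoef_fdom R n).
Qed.

(** The point of the orbit with phase [a] as a function on the whole plane: the
    Bessel functions are entire in the square of the radius. *)
Definition orbit_fun (A B a : R) (x : R * R) :=
  A * bess 0 (j ^+ 2 * (x.1 ^+ 2 + x.2 ^+ 2)) +
  j * B / 2 * (cos a * x.1 - sin a * x.2) * bess 1 (j ^+ 2 * (x.1 ^+ 2 + x.2 ^+ 2)).

Lemma orbit_fun_c1 A B a : c1_plane (fun x => - orbit_fun A B a x).
Proof.
have [d0 h0 k0] := bess_c1 0; have [d1 h1 k1] := bess_c1 1.
have cx := @c1_plane_fst R; have cy := @c1_plane_snd R.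
have cq : c1_plane (fun x : R * R => j ^+ 2 * (x.1 * x.1 + x.2 * x.2)).
  apply: c1_planeM; first exact: c1_plane_cst.
  by apply: c1_planeD; exact: c1_planeM.
have e : (fun x => - orbit_fun A B a x) = (fun x => - A * bess 0 (j ^+ 2 * (x.1 * x.1 + x.2 * x.2)) +
   ((- (j * B / 2) * cos a) * x.1 + j * B / 2 * sin a * x.2) * bess 1 (j ^+ 2 * (x.1 * x.1 + x.2 * x.2))).
  by apply/funext => x; rewrite /orbit_fun !expr2; ring.
rewrite e; apply: c1_planeD.
  apply: c1_planeM; first exact: c1_plane_cst.
  exact: (c1_plane_comp h0 k0 cq).
apply: c1_planeM; last exact: (c1_plane_comp h1 k1 cq).
by apply: c1_planeD; (apply: c1_planeM; first exact: c1_plane_cst).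
Qed.

Lemma orbit_fun_polar A B a r t :
  orbit_fun A B a (pt r t) = eigf A (j * B / 2 * cos a) (- (j * B / 2 * sin a)) r t.
Proof. by rewrite /orbit_fun /eigf pt_sq -exprMn /psi /phi /pt /=; ring. Qed.

Lemma orbit_fun_bessel A B a r t : orbit_fun A B a (pt r t) =
  A * besselJ 0 (j * r) + B * besselJ 1 (j * r) * cos (t + a).
Proof.
rewrite orbit_fun_polar /eigf /psi /phi !besselJE expr0 mul1r expr1 cosD.
by field.
Qed.

Lemma orbit_fun_in A B a : bessel_orbit A B (orbit_fun A B a).
Proof. by exists a => r t _; exact: orbit_fun_bessel. Qed.

Lemma orbit_on_disk A B f : bessel_orbit A B f ->
  exists a, forall x, disk x -> f x = orbit_fun A B a x.
Proof.
move=> [a h]; exists a => -[x y] dx; have [t e] := polar_coordinates x y.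
rewrite e orbit_fun_bessel -h//; apply/andP; split; first exact: sqrtr_ge0.
by move: dx; rewrite /disk /= => d1; rewrite -[ltRHS]sqrtr1 ltr_sqrt.
Qed.

Section orbit_distance.
Variables (w F : R * R -> R).
Hypotheses (cF : c1_plane F) (wF : forall x, closed_disk x -> F x = w x).
Let f r t := F (pt r t).

Lemma plane_dev A B a : norm2 (fun x => w x - orbit_fun A B a x) =
  (Num.sqrt (pin (dev f A (j * B / 2 * cos a) (- (j * B / 2 * sin a)))
     (dev f A (j * B / 2 * cos a) (- (j * B / 2 * sin a)))))%:E.
Proof.
rewrite (norm2_polar (c1_planeD cF (orbit_fun_c1 A B a))); last first.
  by move=> x dx; rewrite wF//; exact: disk_closed.
have -> : (fun r t => F (pt r t) - orbit_fun A B a (pt r t)) = dev f A (j * B / 2 * cos a) (- (j * B / 2 * sin a)).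
  by apply/funext => r; apply/funext => t; rewrite orbit_fun_polar.
by [].
Qed.

Lemma dist2_le A B a :
  (dist2 w (bessel_orbit A B) <= (Num.sqrt (pin (dev f A (j * B / 2 * cos a) (- (j * B / 2 * sin a)))
     (dev f A (j * B / 2 * cos a) (- (j * B / 2 * sin a)))))%:E)%E.
Proof.
rewrite -plane_dev; apply: ereal_inf_lbound.
by exists (orbit_fun A B a) => //; exact: orbit_fun_in.
Qed.

(** The infimum need not be attained: losing a factor 2 on [eps] selects a
    phase. *)
Lemma dist2_near A B eps : 0 < eps -> (dist2 w (bessel_orbit A B) <= eps%:E)%E -> exists a,
  pin (dev f A (j * B / 2 * cos a) (- (j * B / 2 * sin a)))
     (dev f A (j * B / 2 * cos a) (- (j * B / 2 * sin a))) <= 4 * eps ^+ 2.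
Proof.
move=> e0 h; have : (dist2 w (bessel_orbit A B) < (2 * eps)%:E)%E.
  by apply: le_lt_trans h _; rewrite lte_fin; lra.
move=> /ereal_inf_lt[_ [g hg <-]]; have [a ga] := orbit_on_disk hg.
have -> : norm2 (fun x => w x - g x) = norm2 (fun x => w x - orbit_fun A B a x).
  rewrite /norm2; congr Lnorm; apply/funext => x; rewrite !patchE; case: ifP => //.
  by rewrite inE => dx /=; rewrite ga.
rewrite plane_dev lte_fin => lt; exists a.
set D := pin _ _ in lt *; have [D0|D0] := leP 0 D; last by apply: le_trans (ltW D0) _; rewrite mulr_ge0 ?sqr_ge0.
rewrite -(sqr_sqrtr D0) (_ : 4 * eps ^+ 2 = (2 * eps) ^+ 2); last by ring.
by rewrite ler_pXn2r ?nnegrE ?sqrtr_ge0 ?mulr_ge0 ?(ltW lt)// ltW.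
Qed.

End orbit_distance.

(** A linear bound from a quadratic one, with [1 + y] in place of the square root. *)
Lemma sq_bound (x y e : R) : 0 <= y -> 0 <= e -> x ^+ 2 <= y * e ^+ 2 -> `|x| <= (1 + y) * e.
Proof.
move=> y0 e0 h; rewrite -(@ler_pXn2r _ 2)// ?nnegrE ?mulr_ge0 ?addr_ge0//.
rewrite real_normK ?num_real//; apply: (le_trans h); rewrite exprMn ler_wpM2r ?sqr_ge0//.
by rewrite sqrrD expr1n mul1r; have := sqr_ge0 y; lra.
Qed.

Section coordinates.
Variables (n n0 k mg : R).
Hypotheses (n_gt0 : 0 < n) (n0_gt0 : 0 < n0) (k_neq0 : k != 0) (mg_gt0 : 0 < mg).

(** [p], [c], [s] stand for the coordinates of the vorticity in the eigenspace, [rh]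
    for its squared distance to it, and the index 0 for the initial time. [p] is
    pinned by the moment [M], and then [c ^+ 2 + s ^+ 2] by the enstrophy. *)
Lemma coordinate_stability : exists2 K, 0 <= K &
  forall A b e m M p p0 c s c0 s0 x1 x2 rh rh0 : R,
  0 < e -> 0 <= b -> x1 ^+ 2 + x2 ^+ 2 = b ^+ 2 ->
  m ^+ 2 / pi + (p0 - 2 * pi * A) ^+ 2 * n0 / (2 * pi) +
    ((c0 - x1) ^+ 2 + (s0 - x2) ^+ 2) * n / pi + rh0 <= 4 * e ^+ 2 ->
  0 <= rh -> 0 <= rh0 -> mg * rh <= rh0 ->
  (M - m / 2 - p * k) ^+ 2 <= 2 * rh -> (M - m / 2 - p0 * k) ^+ 2 <= 2 * rh0 ->
  p ^+ 2 * n0 / (2 * pi) + (c ^+ 2 + s ^+ 2) * n / pi + rh =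
    p0 ^+ 2 * n0 / (2 * pi) + (c0 ^+ 2 + s0 ^+ 2) * n / pi + rh0 ->
  m ^+ 2 / pi + (p - 2 * pi * A) ^+ 2 * n0 / (2 * pi) + rh <= K * e ^+ 2 /\
  `|c ^+ 2 + s ^+ 2 - b ^+ 2| <= K * (e ^+ 2 + (`|A| + b) * e).
Proof.
have pi0 := @pi_gt0 R.
pose l0 := n0 / (2 * pi); have l0_gt0 : 0 < l0 by rewrite divr_gt0 ?mulr_gt0.
pose l := n / pi; have l_gt0 : 0 < l by rewrite divr_gt0.
pose d1 := 1 + 4 / l0; pose d2 := 1 + 4 / l; pose d3 := (10 + 8 / mg) / `|k|.
have dv (x y : R) : 0 <= x -> 0 < y -> 0 <= x / y by move=> x0 y0; rewrite divr_ge0// ltW.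
have l0' := ltW l0_gt0; have pi0' := ltW pi0.
have d1_gt0 : 0 <= d1 by apply: addr_ge0 => //; exact: dv.
have d2_gt0 : 0 <= d2 by apply: addr_ge0 => //; exact: dv.
have k_gt0 : 0 < `|k| by rewrite normr_gt0.
have m4 : 0 <= 4 / mg by exact: dv.
have m8 : 0 <= 8 / mg by exact: dv.
have d3_gt0 : 0 <= d3 by apply: dv => //; exact: addr_ge0.
pose K1 := 4 + (d1 + d3) ^+ 2 * l0 + 4 / mg.
pose K2 := (4 + 4 / mg + l0 * (d3 * (2 * d1 + d3))) / l + 2 * d2 ^+ 2.
pose K3 := l0 * (d3 * (4 * pi)) / l.
pose K4 := 4 * d2.
have K1_ge0 : 0 <= K1.
  by apply: addr_ge0 => //; apply: addr_ge0 => //; apply: mulr_ge0 => //; exact: sqr_ge0.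
have K2_ge0 : 0 <= K2.
  apply: addr_ge0; last by apply: mulr_ge0 => //; exact: sqr_ge0.
  apply: dv => //; apply: addr_ge0; first exact: addr_ge0.
  by do 2 apply: mulr_ge0 => //; apply: addr_ge0 => //; exact: mulr_ge0.
have K3_ge0 : 0 <= K3 by apply: dv => //; do 3 apply: mulr_ge0 => //.
have K4_ge0 : 0 <= K4 by apply: mulr_ge0.
exists (K1 + K2 + K3 + K4); first by do 3 apply: addr_ge0 => //.
move=> A b e m M p p0 c s c0 s0 x1 x2 rh rh0 e0 b0 xb h0 rh_ge0 rh0_ge0 hrh hM hM0 hZ.
have e2 : 0 <= e ^+ 2 by exact: sqr_ge0.
have en := ltW e0.
have hm : 0 <= m ^+ 2 / pi by rewrite divr_ge0 ?sqr_ge0// ltW.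
have E1 x : x * n0 / (2 * pi) = x * l0 by rewrite /l0 mulrA.
have E2 x : x * n / pi = x * l by rewrite /l mulrA.
rewrite !E1 !E2 in h0 hZ *.
have q1 : 0 <= (p0 - 2 * pi * A) ^+ 2 * l0 by rewrite mulr_ge0 ?sqr_ge0// ltW.
have q2 : 0 <= (c0 - x1) ^+ 2 * l by rewrite mulr_ge0 ?sqr_ge0// ltW.
have q3 : 0 <= (s0 - x2) ^+ 2 * l by rewrite mulr_ge0 ?sqr_ge0// ltW.
rewrite (mulrDl ((c0 - x1) ^+ 2)) in h0.
have hrh0 : rh0 <= 4 * e ^+ 2 by lra.
have hrh1 : rh <= 4 / mg * e ^+ 2.
  by rewrite [leRHS]mulrAC ler_pdivlMr// mulrC; lra.
have b1 : `|p0 - 2 * pi * A| <= d1 * e.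
  apply: sq_bound => //; first exact: dv.
  by rewrite [leRHS]mulrAC ler_pdivlMr//; lra.
have b2 : `|c0 - x1| <= d2 * e.
  apply: sq_bound => //; first exact: dv.
  by rewrite [leRHS]mulrAC ler_pdivlMr//; lra.
have b3 : `|s0 - x2| <= d2 * e.
  apply: sq_bound => //; first exact: dv.
  by rewrite [leRHS]mulrAC ler_pdivlMr//; lra.
have b4 : `|M - m / 2 - p * k| <= (1 + 8 / mg) * e.
  apply: sq_bound => //.
  by rewrite (_ : 8 / mg = 2 * (4 / mg)); [lra|ring].
have b5 : `|M - m / 2 - p0 * k| <= (1 + 8) * e by apply: sq_bound => //; lra.
have b6 : `|p - p0| <= d3 * e.
  rewrite /d3 [leRHS]mulrAC ler_pdivlMr// -normrM.
  have -> : (p - p0) * k = (M - m / 2 - p0 * k) - (M - m / 2 - p * k) by ring.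
  by apply: le_trans (ler_normB _ _) _; lra.
have b7 : `|p - 2 * pi * A| <= (d1 + d3) * e.
  have -> : p - 2 * pi * A = (p - p0) + (p0 - 2 * pi * A) by ring.
  by apply: le_trans (ler_normD _ _) _; lra.
clearbody d1 d2 d3 l0 l.
have K1K : K1 * e ^+ 2 <= (K1 + K2 + K3 + K4) * e ^+ 2 by rewrite ler_wpM2r//; lra.
split.
  apply: le_trans K1K.
  have : (p - 2 * pi * A) ^+ 2 <= (d1 + d3) ^+ 2 * e ^+ 2.
    rewrite -exprMn -(real_normK (num_real (p - _))) ler_pXn2r// nnegrE.
    exact: le_trans b7.
  move=> /(ler_wpM2r (ltW l0_gt0)) h1.
  have hm4 : m ^+ 2 / pi <= 4 * e ^+ 2 by lra.
  have -> : K1 * e ^+ 2 = 4 * e ^+ 2 + (d1 + d3) ^+ 2 * e ^+ 2 * l0 + 4 / mg * e ^+ 2 by rewrite /K1; ring.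
  by lra.
have xle x : x ^+ 2 <= b ^+ 2 -> `|x| <= b.
  by move=> h; rewrite -(@ler_pXn2r _ 2)// ?nnegrE// real_normK ?num_real.
have x1b : `|x1| <= b by apply: xle; have := sqr_ge0 x2; lra.
have x2b : `|x2| <= b by apply: xle; have := sqr_ge0 x1; lra.
have sqd y x : `|x| <= b -> `|y - x| <= d2 * e -> `|y ^+ 2 - x ^+ 2| <= d2 * e * (d2 * e + 2 * b).
  move=> xb' yx; rewrite (_ : y ^+ 2 - x ^+ 2 = (y - x) * ((y - x) + 2 * x)); last by ring.
  rewrite normrM ler_pM//; apply: le_trans (ler_normD _ _) _; rewrite normrM ger0_norm//; lra.
have s1 := sqd _ _ x1b b2; have s2 := sqd _ _ x2b b3.
have s3 : `|p ^+ 2 - p0 ^+ 2| <= d3 * e * ((2 * d1 + d3) * e + 4 * pi * `|A|).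
  rewrite (_ : p ^+ 2 - p0 ^+ 2 = (p - p0) * ((p - p0) + 2 * (p0 - 2 * pi * A) + 4 * pi * A)); last by ring.
  rewrite normrM ler_pM//.
  apply: le_trans (ler_normD _ _) _; apply: le_trans (lerD (ler_normD _ _) (lexx _)) _.
  rewrite !normrM (ger0_norm (ler0n _ _)) (ger0_norm (ler0n _ _)) (gtr0_norm pi0); lra.
have s4 : `|c ^+ 2 + s ^+ 2 - (c0 ^+ 2 + s0 ^+ 2)| <=
   (4 + 4 / mg) * e ^+ 2 / l + l0 * (d3 * e * ((2 * d1 + d3) * e + 4 * pi * `|A|)) / l.
  have -> : c ^+ 2 + s ^+ 2 - (c0 ^+ 2 + s0 ^+ 2) = ((rh0 - rh) - l0 * (p ^+ 2 - p0 ^+ 2)) / l.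
    by apply: (mulIf (lt0r_neq0 l_gt0)); rewrite divfK ?gt_eqF//; lra.
  rewrite -mulrDl normrM [`|l^-1|]gtr0_norm ?invr_gt0// ler_wpM2r ?invr_ge0 ?(ltW l_gt0)//.
  apply: le_trans (ler_normB _ _) _; apply: lerD.
    have h4 : 0 <= 4 / mg * e ^+ 2 by rewrite mulr_ge0.
    by rewrite ler_norml; apply/andP; split; lra.
  by rewrite normrM gtr0_norm// ler_wpM2l// ltW.
have -> : c ^+ 2 + s ^+ 2 - b ^+ 2 = (c ^+ 2 + s ^+ 2 - (c0 ^+ 2 + s0 ^+ 2)) + (c0 ^+ 2 - x1 ^+ 2) + (s0 ^+ 2 - x2 ^+ 2).
  by rewrite -xb; ring.
apply: le_trans (ler_normD _ _) _; apply: le_trans (lerD (ler_normD _ _) (lexx _)) _.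
apply: (@le_trans _ _ (K2 * e ^+ 2 + K3 * (`|A| * e) + K4 * (b * e))).
  rewrite (_ : K2 * e ^+ 2 + K3 * (`|A| * e) + K4 * (b * e) =
    ((4 + 4 / mg) * e ^+ 2 / l + l0 * (d3 * e * ((2 * d1 + d3) * e + 4 * pi * `|A|)) / l)
    + d2 * e * (d2 * e + 2 * b) + d2 * e * (d2 * e + 2 * b)); last by rewrite /K2 /K3 /K4; ring.
  by rewrite !lerD.
have a0 : 0 <= `|A| * e by rewrite mulr_ge0.
have be0 : 0 <= b * e by rewrite mulr_ge0.
rewrite mulrDr [X in _ <= _ + _ * X]mulrDl mulrDr addrA !lerD// ler_wpM2r//; lra.
Qed.

End coordinates.

Lemma dev0 (f : R -> R -> R) : dev f 0 0 0 = f.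
Proof.
by apply/funext => r; apply/funext => t; rewrite /dev /eigf !mul0r addr0 mulr0 addr0 subr0.
Qed.

Lemma pmeanE (f : R -> R -> R) : pmean f = pin f (fun _ _ => 1).
Proof. by []. Qed.

Lemma pmom3E (f : R -> R -> R) : cont2 f -> pmom3 f = pin f (fun r _ => r ^+ 2).
Proof.
move=> cf; congr (integ _ _ _); apply/funext => r.
have h := slice (r := r) cf.
rewrite exprS -mulrA; congr (_ * _); rewrite /mode /= -ointZ; last by ctac.
by congr oint; apply/funext => t; rewrite mulr1 mulrC.
Qed.

(** The phase is minus the polar angle of the point [(c, s)]. *)
Lemma orbit_phase (B c s : R) : 0 <= B -> exists a,
  (c - pi * (j * B / 2 * cos a)) ^+ 2 + (s - pi * (- (j * B / 2 * sin a))) ^+ 2 =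
  (Num.sqrt (c ^+ 2 + s ^+ 2) - pi * j / 2 * B) ^+ 2.
Proof.
move=> B0; have [t [e1 e2]] := polar_coordinates c s; exists (- t).
set r := Num.sqrt _ in e1 e2 *.
rewrite cosN sinN e1 e2; have cs := @cos2Dsin2 R t.
transitivity ((r - pi * j / 2 * B) ^+ 2 * (cos t ^+ 2 + sin t ^+ 2)); first by ring.
by rewrite cs mulr1.
Qed.

(** [y] is the radius of the two coordinates on mode 1 at time [t]: the
    coefficient of [psi] is pinned, the phase is absorbed by the orbit, and [y]
    is the only other place where the solution can drift. *)
Lemma flow_stability : exists2 K, 0 <= K & forall (A B eps : R) (w : R -> R * R -> R),
  0 <= B -> 0 < eps -> euler_smooth_solution w ->
  (dist2 (w 0%R) (bessel_orbit A B) <= eps%:E)%E -> forall t : R, exists y : R,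
  [/\ 0 <= y, `|y ^+ 2 - (pi * j / 2 * B) ^+ 2| <= K * (eps ^+ 2 + (`|A| + pi * j / 2 * B) * eps) &
    (dist2 (w t) (bessel_orbit A B) <=
      (Num.sqrt (K * eps ^+ 2 + (y - pi * j / 2 * B) ^+ 2 * (N / pi)))%:E)%E].
Proof.
have kn : kappa != 0 by rewrite lt_eqF// psi_moment.
have [K K0 hK] := coordinate_stability (@phi_norm_gt0 R) (@psi_norm_gt0 R) kn (@margin_gt0 R).
exists K => // A B eps w B0 e0 /euler_conserved[F [v [hF hcons]]] h0 t.
have pi0 := @pi_gt0 R; have j0 := @j_gt0 R.
have [cF0 wF0 sol0] := hF 0; have [cFt wFt solt] := hF t.
have [a ha] := dist2_near cF0 wF0 e0 h0.
pose f s r t := F s (pt r t).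
have cf0 : cont2 (f 0) := ps_contw sol0; have cft : cont2 (f t) := ps_contw solt.
have [c1 c2 c3 c4] := hcons t.
have m_eq : pmean (f t) = pmean (f 0) by rewrite !pmeanE.
have M_eq : pmom3 (f t) = pmom3 (f 0) by rewrite !pmom3E.
have Q_eq : Qf (pin (f t) (f t)) (pin (f t) (jv (v t))) (pmean (f t)) (pmom3 (f t)) =
   Qf (pin (f 0) (f 0)) (pin (f 0) (jv (v 0))) (pmean (f 0)) (pmom3 (f 0)).
  by rewrite m_eq M_eq /f c3 c4.
have /andP[q1 _] := Q_bounds cft solt; have /andP[_ q2] := Q_bounds cf0 sol0.
have hrho : mu * rho (f t) <= rho (f 0) by apply: le_trans q2; rewrite -Q_eq.
have mb := moment_bound cft; have mb0 := moment_bound cf0.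
rewrite M_eq m_eq in mb.
have Z_eq : pcoef (f t) ^+ 2 * N0 / (2 * pi) + (ccoef (f t) ^+ 2 + scoef (f t) ^+ 2) * N / pi + rho (f t) =
  pcoef (f 0) ^+ 2 * N0 / (2 * pi) + (ccoef (f 0) ^+ 2 + scoef (f 0) ^+ 2) * N / pi + rho (f 0).
  have := pin_dist cft 0 0 0; have := pin_dist cf0 0 0 0.
  rewrite !dev0 !mulr0 !subr0 -/(f t) -/(f 0) => z0 zt.
  have : pin (f t) (f t) = pin (f 0) (f 0) by [].
  by rewrite z0 zt m_eq; lra.
rewrite -/(f 0) (pin_dist cf0) in ha.
have bb : (pi * (j * B / 2 * cos a)) ^+ 2 + (pi * (- (j * B / 2 * sin a))) ^+ 2 = (pi * j / 2 * B) ^+ 2.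
  transitivity ((pi * j / 2 * B) ^+ 2 * (cos a ^+ 2 + sin a ^+ 2)); first by ring.
  by rewrite cos2Dsin2 mulr1.
have beta0 : 0 <= pi * j / 2 * B by rewrite !mulr_ge0 ?invr_ge0// ltW.
have [k1 k2] := hK _ _ _ _ _ _ _ _ _ _ _ _ _ _ _ e0 beta0 bb ha (rho_ge0 cft) (rho_ge0 cf0) hrho mb mb0 Z_eq.
exists (Num.sqrt (ccoef (f t) ^+ 2 + scoef (f t) ^+ 2)); split.
- exact: sqrtr_ge0.
- by rewrite sqr_sqrtr ?addr_ge0 ?sqr_ge0.
have [a' ha'] := orbit_phase (ccoef (f t)) (scoef (f t)) B0.
apply: le_trans (dist2_le cFt wFt A B a') _.
rewrite lee_fin ler_wsqrtr// -/(f t) (pin_dist cft) ha' m_eq -mulrA.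
by lra.
Qed.

Lemma sqrt_le (x y : R) : 0 <= y -> x <= y ^+ 2 -> Num.sqrt x <= y.
Proof. by move=> y0 h; rewrite -[leRHS]ger0_norm// -sqrtr_sqr; exact: ler_wsqrtr. Qed.

End stability.

Theorem theorem1p1 (R : realType) :
  exists C : R, 0 < C /\
    forall A B : R, 0 <= B ->
      (B <> 0 ->
        forall (eps : R) (w : R -> R * R -> R),
          0 < eps -> euler_smooth_solution w ->
          (dist2 (w 0%R) (bessel_orbit A B) <= eps%:E)%E ->
          forall t : R,
            (dist2 (w t) (bessel_orbit A B) <=
               (C * B^-1 * Num.sqrt (A ^+ 2 + B ^+ 2) * eps
                  + C * B^-1 * eps ^+ 2)%R%:E)%E) /\
      (B = 0 ->
        forall (eps : R) (w : R -> R * R -> R),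
          0 < eps -> euler_smooth_solution w ->
          (dist2 (w 0%R) (bessel_orbit A B) <= eps%:E)%E ->
          forall t : R,
            (dist2 (w t) (bessel_orbit A B) <=
               (C * Num.sqrt `|A| * Num.sqrt eps + C * eps)%R%:E)%E).
Proof.
have [K K0 hK] := @flow_stability R.
have pi0 := @pi_gt0 R; have j0 := @j_gt0 R; have N_gt0 := @phi_norm_gt0 R.
pose h : R := pi * j11 R / 2; have h0 : 0 < h by rewrite /h !mulr_gt0 ?invr_gt0.
pose n : R := @phi_norm R / pi; have n0 : 0 < n by rewrite divr_gt0.
pose D : R := n * K ^+ 2 * (1 + h) ^+ 2 / h ^+ 2.
have D0 : 0 <= D.
  apply: divr_ge0; last exact: sqr_ge0.
  apply: mulr_ge0; last exact: sqr_ge0.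
  by apply: mulr_ge0; [exact: ltW|exact: sqr_ge0].
pose C : R := 1 + K + n * K + D.
have nK0 : 0 <= n * K by rewrite mulr_ge0// ltW.
have C1 : 1 <= C by rewrite /C; lra.
have CC : C <= C ^+ 2 by rewrite expr2 ler_peMl//; lra.
exists C; split; first by lra.
move=> A B B0; split => Bn eps w e0 sw hw t.
- have Bp : 0 < B by rewrite lt_neqAle B0 andbT eq_sym; apply/eqP.
  have [y [y0 yb /le_trans]] := hK A B eps w B0 e0 sw hw t; apply.
  rewrite -/h -/n in yb *.
  pose T := Num.sqrt (A ^+ 2 + B ^+ 2).
  have sq0 : 0 <= A ^+ 2 + B ^+ 2 by rewrite addr_ge0 ?sqr_ge0.
  have AT : `|A| <= T by rewrite -sqrtr_sqr ler_wsqrtr// lerDl sqr_ge0.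
  have BT : B <= T by rewrite -[leLHS]ger0_norm// -sqrtr_sqr ler_wsqrtr// lerDr sqr_ge0.
  rewrite -/T; pose Y := T * eps / B; pose Z := eps ^+ 2 / B.
  have T0 : 0 <= T by exact: sqrtr_ge0.
  have Y0 : 0 <= Y by rewrite /Y !mulr_ge0 ?invr_ge0// ltW.
  have Z0 : 0 <= Z by rewrite /Z mulr_ge0 ?sqr_ge0 ?invr_ge0.
  have -> : C * B^-1 * T * eps + C * B^-1 * eps ^+ 2 = C * (Y + Z) by rewrite /Y /Z; ring.
  rewrite lee_fin; apply: sqrt_le; first by rewrite mulr_ge0 ?addr_ge0//; lra.
  have eY : eps <= Y.
    by rewrite /Y ler_pdivlMr// mulrC ler_wpM2r// ltW.
  have e2Y : eps ^+ 2 <= (Y + Z) ^+ 2 by rewrite ler_pXn2r ?nnegrE ?addr_ge0 ?(ltW e0)//; lra.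
  have hB : 0 < h * B by rewrite mulr_gt0.
  have yB : `|y - h * B| <= K * (1 + h) / h * (Y + Z).
    have : `|y - h * B| * (h * B) <= K * (eps ^+ 2 + (`|A| + h * B) * eps).
      apply: le_trans yb; rewrite subr_sqr normrM ler_wpM2l//.
      by rewrite ger0_norm ?addr_ge0 ?(ltW hB)// lerDr.
    rewrite -ler_pdivlMr// => /le_trans; apply.
    rewrite ler_pdivrMr// (_ : K * (1 + h) / h * (Y + Z) * (h * B) = K * ((1 + h) * (eps ^+ 2 + T * eps))); last first.
      by rewrite /Y /Z; field; rewrite !gt_eqF.
    rewrite ler_wpM2l//.
    have t1 : `|A| * eps <= T * eps by rewrite ler_wpM2r// ltW.
    have t2 : h * (B * eps) <= h * (T * eps) by rewrite ler_pM2l// ler_wpM2r// ltW.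
    have t3 : 0 <= h * eps ^+ 2 by rewrite mulr_ge0 ?sqr_ge0// ltW.
    by lra.
  have yB2 : (y - h * B) ^+ 2 * n <= D * (Y + Z) ^+ 2.
    have -> : D * (Y + Z) ^+ 2 = (K * (1 + h) / h * (Y + Z)) ^+ 2 * n by rewrite /D; field; rewrite gt_eqF.
    rewrite ler_wpM2r ?(ltW n0)// -(real_normK (num_real (y - _))) ler_pXn2r ?nnegrE//.
    exact: le_trans yB.
  have KY : K * eps ^+ 2 <= K * (Y + Z) ^+ 2 by rewrite ler_wpM2l.
  apply: (@le_trans _ _ (C * (Y + Z) ^+ 2)).
    have : 0 <= (1 + n * K) * (Y + Z) ^+ 2 by rewrite mulr_ge0 ?sqr_ge0 ?addr_ge0.
    by rewrite /C; lra.
  by rewrite exprMn ler_wpM2r// sqr_ge0.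
- have [y [y0 yb /le_trans]] := hK A B eps w B0 e0 sw hw t; apply.
  rewrite -/h -/n Bn mulr0 addr0 expr0n subr0 (ger0_norm (sqr_ge0 _)) in yb *.
  rewrite subr0; set a := Num.sqrt `|A|; set b := Num.sqrt eps.
  have a0 : 0 <= a by exact: sqrtr_ge0.
  have b0 : 0 <= b by exact: sqrtr_ge0.
  have a2 : a ^+ 2 = `|A| by rewrite sqr_sqrtr.
  have b2 : b ^+ 2 = eps by rewrite sqr_sqrtr// ltW.
  have ab : 0 <= a * b by rewrite mulr_ge0.
  have -> : C * a * b + C * eps = C * (a * b + eps) by ring.
  rewrite lee_fin; apply: sqrt_le; first by rewrite mulr_ge0 ?addr_ge0 ?(ltW e0)//; lra.
  have S : `|A| * eps + eps ^+ 2 <= (a * b + eps) ^+ 2.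
    have -> : `|A| * eps = (a * b) ^+ 2 by rewrite exprMn a2 b2.
    have p0 : 0 <= a * b * eps by rewrite mulr_ge0// ltW.
    by rewrite sqrrD; lra.
  have S0 : 0 <= (a * b + eps) ^+ 2 by exact: sqr_ge0.
  apply: (@le_trans _ _ (C * (a * b + eps) ^+ 2)); last by rewrite exprMn ler_wpM2r.
  have t1 : y ^+ 2 * n <= n * K * (a * b + eps) ^+ 2.
    rewrite mulrC -mulrA ler_pM2l//; apply: le_trans yb _; rewrite ler_wpM2l//; lra.
  have t2 : K * eps ^+ 2 <= K * (a * b + eps) ^+ 2.
    have p0 : 0 <= `|A| * eps by rewrite mulr_ge0// ltW.
    by rewrite ler_wpM2l//; lra.
  have t3 : 0 <= (1 + D) * (a * b + eps) ^+ 2 by rewrite mulr_ge0 ?addr_ge0.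
  by rewrite /C; lra.
Qed.
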